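(* There exists an analytic map $\Phi \colon \mathbb{D}^2 \to \mathbb{D}^2$ such that: 1) the composition operator $C_\Phi \colon H^2(\mathbb{D}^2) \to H^2(\mathbb{D}^2)$, $C_\Phi f = f\circ\Phi$, is bounded and compact; 2) $\|\Phi\|_\infty = 1$ and $\Phi$ is truly $2$-dimensional, so that $\beta_2^-(C_\Phi) > 0$; 3) there are constants $\alpha, \beta > 0$ such that $a_n(C_\Phi) \leq \alpha\, e^{-\beta\sqrt{n}}$ for all $n \geq 1$; in particular $\beta_2^+(C_\Phi) < 1$.
   Context: $\mathbb{D}$ is the open unit disk of $\mathbb{C}$. $H^2(\mathbb{D}^2)$ is the Hardy space of holomorphic functions $f(z_1,z_2) = \sum_{j,k\geq 0} c_{j,k} z_1^j z_2^k$ on $\mathbb{D}^2$ with $\|f\|^2 = \sum_{j,k} |c_{j,k}|^2 < \infty$. For $\Phi = (\Phi_1,\Phi_2)$, $\|\Phi\|_\infty = \sup_{z\in\mathbb{D}^2} \max(|\Phi_1(z)|, |\Phi_2(z)|)$. The map $\Phi$ is truly $2$-dimensional if $\Phi(\mathbb{D}^2)$ has non-void interior. For a bounded operator $T$ on a Hilbert space, the approximation numbers are $a_n(T) = \inf_{\mathrm{rank}\, R < n} \|T - R\|$, $n\geq 1$, and $\beta_2^-(T) = \liminf_{n\to\infty} [a_{n^2}(T)]^{1/n}$, $\beta_2^+(T) = \limsup_{n\to\infty} [a_{n^2}(T)]^{1/n}$. *)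

(* Defs.v *)
From HB Require Import structures.
From mathcomp Require Import all_boot all_order all_algebra.
From mathcomp Require Import complex ring lra.
From mathcomp Require Import all_classical all_reals all_analysis.

Set Implicit Arguments.
Unset Strict Implicit.
Unset Printing Implicit Defensive.

Import Order.TTheory GRing.Theory Num.Theory.
Import numFieldNormedType.Exports.

Local Open Scope classical_set_scope.
Local Open Scope ring_scope.
Local Open Scope complex_scope.

(* The norm of a normed space over R[i] is an element of R[i] (a nonnegative
   real number); [cnorm] is the same number in R. On R[i] it is the modulus. *)
Definition cnorm (R : realType) (V : normedZmodType R[i]) (x : V) : R :=
  complex.Re `|x|.

Section cnorm.
Context {R : realType}.
Implicit Type V : normedZmodType R[i].

Lemma cnormE V (x : V) : (cnorm x)%:C = `|x|.
Proof. by rewrite /cnorm RRe_real// normr_real. Qed.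

Lemma cnorm_ge0 V (x : V) : 0 <= cnorm x.
Proof. by rewrite -ler0c cnormE normr_ge0. Qed.

Lemma ler_cnormD V (x y : V) : cnorm (x + y) <= cnorm x + cnorm y.
Proof. by rewrite -lecR rmorphD /= !cnormE ler_normD. Qed.

Lemma cnorm0_eq0 V (x : V) : cnorm x = 0 -> x = 0.
Proof. by move=> x0; apply/normr0_eq0; rewrite -cnormE x0. Qed.

Lemma cnorm0 V : cnorm (0 : V) = 0.
Proof. by rewrite /cnorm normr0. Qed.

Lemma cnormM (x y : R[i]) : cnorm (x * y) = cnorm x * cnorm y.
Proof. by apply/complexI; rewrite rmorphM /= !cnormE normrM. Qed.

Lemma cnormZ (V : normedModType R[i]) (a : R[i]) (x : V) :
  cnorm (a *: x) = cnorm a * cnorm x.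
Proof. by apply/complexI; rewrite rmorphM /= !cnormE normrZ. Qed.

End cnorm.

Definition bidisk (R : realType) : set (R[i]^o * R[i]^o) :=
  [set z | `|z.1| < 1 /\ `|z.2| < 1].
Arguments bidisk : clear implicits.

(* Complex Fréchet differentiability at every point of the open set [D]; since
   [differentiable] needs a function on the whole space, [f] is extended beyond
   [D] by an arbitrary [F]. *)
Definition holomorphic (R : realType) (V W : normedModType R[i]) (D : set V)
    (f : D -> W) :=
  exists2 F : V -> W, (forall z : D, F (val z) = f z)
    & forall z, D z -> differentiable F z.

Section hardy_coefficients.
Context {R : realType}.
Implicit Types (c d : nat * nat -> R[i]) (f g : bidisk R -> R[i]^o).

Definition sq_sum c : \bar R := \esum_(p in setT) (cnorm (c p) ^+ 2)%:E.

Definition partial_sum c (z : R[i]^o * R[i]^o) (n : nat) : R[i]^o :=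
  \sum_(j < n) \sum_(k < n)
     c (nat_of_ord j, nat_of_ord k) * z.1 ^+ j * z.2 ^+ k.

(* For square-summable [c] the double series converges absolutely on the
   bidisk, so the choice of the square partial sums is immaterial. *)
Definition power_series_on_bidisk c f := forall z : bidisk R,
  partial_sum c (val z) @ \oo --> f z.

Definition hardy_pred : {pred (bidisk R -> R[i]^o)} :=
  [pred f | `[< exists2 c, (sq_sum c < +oo)%E & power_series_on_bidisk c f >]].

End hardy_coefficients.

Section hardy_coefficients_theory.
Context {R : realType}.
Implicit Types (c d : nat * nat -> R[i]) (f g : bidisk R -> R[i]^o).

Lemma le_esumZ (T : choiceType) (k : R) (u : T -> R) :
  0 <= k -> (forall p, 0 <= u p) ->
  (\esum_(p in setT) (k * u p)%:E <= k%:E * \esum_(p in setT) (u p)%:E)%E.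
Proof.
move=> k0 u0; apply: ge_ereal_sup => _ /= [A [finA _] <-].
under eq_fsbigr do rewrite EFinM.
rewrite -ge0_mule_fsumr; last by move=> p; rewrite lee_fin.
by apply: lee_wpmul2l; rewrite ?lee_fin//; apply: ereal_sup_ubound; exists A.
Qed.

Lemma sq_sum_ge0 c : (0 <= sq_sum c)%E.
Proof. by apply: esum_ge0 => p _; rewrite lee_fin sqr_ge0. Qed.

Lemma sq_sum_le c p : ((cnorm (c p) ^+ 2)%:E <= sq_sum c)%E.
Proof.
apply: esum_ge; exists [set p]; first by split=> //; exact: finite_set1.
by rewrite fsbig_set1.
Qed.

Lemma sq_sum_eq0 c : sq_sum c = 0%E -> c = 0.
Proof.
move=> c0; apply/funext => p; apply: cnorm0_eq0; apply/eqP.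
have := sq_sum_le c p; rewrite c0 lee_fin => cp0.
by rewrite -sqrf_eq0 eq_le sqr_ge0 andbT.
Qed.

Lemma sq_sum0 : sq_sum (0 : nat * nat -> R[i]) = 0%E.
Proof. by apply: esum1 => p _; rewrite cnorm0 expr0n. Qed.

Lemma le_sq_sumD c d (t : R) : 0 < t ->
  (sq_sum (c + d)%R
     <= (1 + t)%:E * sq_sum c + (1 + t^-1)%:E * sq_sum d)%E.
Proof.
move=> t0; have ti0 : 0 < t^-1 by rewrite invr_gt0.
have le2 (x y : R) : (x + y) ^+ 2 <= (1 + t) * x ^+ 2 + (1 + t^-1) * y ^+ 2.
  rewrite -subr_ge0.
  rewrite (_ : _ - _ = t^-1 * (t * x - y) ^+ 2).
    by rewrite mulr_ge0 ?sqr_ge0// ltW.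
  by field; rewrite gt_eqF.
have le_term p : ((cnorm ((c + d)%R p) ^+ 2)%:E
    <= ((1 + t) * cnorm (c p) ^+ 2)%:E + ((1 + t^-1) * cnorm (d p) ^+ 2)%:E)%E.
  rewrite -EFinD lee_fin (le_trans _ (le2 _ _))//.
  by rewrite lerXn2r ?nnegrE ?addr_ge0 ?cnorm_ge0 ?ler_cnormD.
apply: (le_trans (le_esum (fun p _ => le_term p))).
rewrite esumD; last 2 first.
- by move=> p _; rewrite lee_fin mulr_ge0 ?sqr_ge0 ?addr_ge0// ltW.
- by move=> p _; rewrite lee_fin mulr_ge0 ?sqr_ge0 ?addr_ge0// ltW.
by apply: leeD; apply: le_esumZ => *; rewrite ?sqr_ge0 ?addr_ge0// ltW.
Qed.

Lemma le_sq_sumZ (a : R[i]) c :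
  (sq_sum (a *: c) <= (cnorm a ^+ 2)%:E * sq_sum c)%E.
Proof.
apply: le_trans (le_esumZ (sqr_ge0 _) (fun p => sqr_ge0 _)).
by apply: le_esum => p _; rewrite cnormM exprMn.
Qed.

Lemma sq_sumZ (a : R[i]) c :
  sq_sum (a *: c) = ((cnorm a ^+ 2)%:E * sq_sum c)%E.
Proof.
have [->|a0] := eqVneq a 0.
  by rewrite scale0r sq_sum0 cnorm0 expr0n mul0e.
apply/eqP; rewrite eq_le le_sq_sumZ/=.
have na0 : 0 < cnorm a.
  by rewrite lt_neqAle cnorm_ge0 andbT eq_sym; apply: contra_neq a0 => /cnorm0_eq0.
rewrite muleC -lee_pdivlMr ?exprn_gt0//.
have := le_sq_sumZ a^-1 (a *: c); rewrite scalerA mulVf// scale1r.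
rewrite muleC; move/le_trans; apply.
rewrite -exprVn; suff -> : cnorm a^-1 = (cnorm a)^-1 by [].
apply: (mulfI (lt0r_neq0 na0)); rewrite -cnormM divff// divff ?gt_eqF//.
by rewrite /cnorm normr1.
Qed.

Lemma sq_sumD_fin c d : (sq_sum c < +oo)%E -> (sq_sum d < +oo)%E ->
  (sq_sum (c + d)%R < +oo)%E.
Proof.
move=> cy dy; apply: (le_lt_trans (le_sq_sumD c d ltr01)).
rewrite lte_add_pinfty//; exact: lte_mul_pinfty.
Qed.

Lemma sq_sumZ_fin a c : (sq_sum c < +oo)%E -> (sq_sum (a *: c) < +oo)%E.
Proof.
move=> cy; rewrite sq_sumZ lte_mul_pinfty//; by rewrite lee_fin sqr_ge0.
Qed.

Lemma partial_sumD c d z :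
  partial_sum (c + d) z = partial_sum c z + partial_sum d z.
Proof.
apply/funext => n; rewrite [in RHS]addrfctE /partial_sum -big_split.
apply: eq_bigr => j _; rewrite -big_split; apply: eq_bigr => k _.
by rewrite /= -!mulrDl.
Qed.

Lemma partial_sumZ a c z : partial_sum (a *: c) z = a *: partial_sum c z.
Proof.
apply/funext => n; rewrite [in RHS]scalrfctE /partial_sum scaler_sumr.
apply: eq_bigr => j _; rewrite scaler_sumr; apply: eq_bigr => k _.
by rewrite /= -!mulrA.
Qed.

Lemma partial_sum0 z : partial_sum (0 : nat * nat -> R[i]) z = 0.
Proof.
apply/funext => n; rewrite /partial_sum big1// => j _.
by rewrite big1// => k _; rewrite !mul0r.
Qed.

Lemma power_seriesD c d f g : power_series_on_bidisk c f ->
  power_series_on_bidisk d g -> power_series_on_bidisk (c + d) (f + g).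
Proof. by move=> cf dg z; rewrite partial_sumD; exact: cvgD (cf z) (dg z). Qed.

Lemma power_seriesZ a c f : power_series_on_bidisk c f ->
  power_series_on_bidisk (a *: c) (a *: f).
Proof. by move=> cf z; rewrite partial_sumZ; exact: cvgZr (cf z). Qed.

Lemma power_series0 : power_series_on_bidisk (0 : nat * nat -> R[i]) 0.
Proof. by move=> z; rewrite partial_sum0; exact: cvg_cst. Qed.

Lemma hardy_submod_closed : submod_closed (@hardy_pred R).
Proof.
split; first by apply/asboolP; exists 0; [rewrite sq_sum0|exact: power_series0].
move=> a f g /asboolP[c cy cf] /asboolP[d dy dg]; apply/asboolP.
exists (a *: c + d); first exact/sq_sumD_fin/dy/sq_sumZ_fin.
exact/power_seriesD/dg/power_seriesZ.
Qed.

HB.instance Definition _ :=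
  GRing.isSubmodClosed.Build _ _ hardy_pred hardy_submod_closed.

End hardy_coefficients_theory.

Section uniqueness.
Context {R : realType}.
Local Notation C := R[i].

Lemma geometric_le2 (t : C) n : 0 <= t -> t <= 2^-1 ->
  \sum_(i < n) t ^+ i <= 2.
Proof.
move=> t0 t2; elim: n => [|n IH]; first by rewrite big_ord0 ler0n.
rewrite big_ord_recl expr0 (_ : 2 = 1 + 2^-1 * 2) ?lerD2l; last first.
  by rewrite mulVf ?pnatr_eq0// -[RHS]/(1 + 1).
under eq_bigr do rewrite exprS.
by rewrite -mulr_sumr ler_pM// sumr_ge0// => i _; rewrite exprn_ge0.
Qed.

Lemma vanishing_coefs (M : C) (b : nat -> nat -> C) :
  (forall n i, `|b n i| <= M) ->
  (forall x : C, `|x| <= 2^-1 ->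
     (fun n => \sum_(i < n) b n i * x ^+ i : R[i]^o) @ \oo --> (0 : R[i]^o)) ->
  forall i, (fun n => b n i : R[i]^o) @ \oo --> (0 : R[i]^o).
Proof.
move=> bM b0 i; elim/ltn_ind: i => i IH.
have M0 : 0 <= M by apply: le_trans (bM 0%N 0%N).
apply/cvgrPdist_lt => e e0.
pose D := 2 * e + 4 * M + 4.
have D0 : 0 < D by rewrite ltr_wpDl// addr_ge0// mulr_ge0// ltW.
pose t := e / D.
have t0 : 0 < t by rewrite divr_gt0.
have t2 : t <= 2^-1.
  rewrite /t ler_pdivrMr// mulrC ler_pdivlMr// mulrC.
  by rewrite /D -addrA lerDl addr_ge0// mulr_ge0.
have tM : M * (t * 2) <= e / 2.
  rewrite ler_pdivlMr// (_ : M * (t * 2) * 2 = e * (4 * M) / D); last first.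
    by rewrite /t; field; rewrite gt_eqF.
  rewrite ler_pdivrMr// ler_pM2l// /D addrAC lerDr addr_ge0// mulr_ge0//.
  exact: ltW.
have ti0 : 0 < t ^+ i by rewrite exprn_gt0.
have e4 : 0 < t ^+ i * (e / 4) by rewrite mulr_gt0// divr_gt0.
have nt : `|t| <= 2^-1 by rewrite gtr0_norm.
have head0 m : (m <= i)%N ->
    (fun n => \sum_(l < m) b n l * t ^+ l : R[i]^o) @ \oo --> (0 : R[i]^o).
  elim: m => [_|m IHm mi].
    by under eq_cvg do rewrite big_ord0; exact: cvg_cst.
  under eq_cvg do rewrite big_ord_recr.
  have := cvgD (IHm (ltnW mi)) (cvgMr_tmp (b := t ^+ m) (IH m mi)).
  by rewrite mul0r addr0; apply.
have /cvgrPdist_lt/(_ _ e4) n1 := b0 t nt.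
have /cvgrPdist_lt/(_ _ e4) n2 := head0 i (leqnn i).
near=> n; rewrite sub0r normrN.
have ltin : (i < n)%N by near: n; exact: nbhs_infty_gt.
have h1 : `|\sum_(l < n) b n l * t ^+ l| < t ^+ i * (e / 4).
  by near: n; apply: filterS n1 => n; rewrite sub0r normrN.
have h2 : `|\sum_(l < i) b n l * t ^+ l| < t ^+ i * (e / 4).
  by near: n; apply: filterS n2 => n; rewrite sub0r normrN.
pose tail := \sum_(l < n - i.+1) b n (i.+1 + l)%N * t ^+ l.
have split_sum : \sum_(l < n) b n l * t ^+ l
    = \sum_(l < i) b n l * t ^+ l + b n i * t ^+ i + t ^+ i.+1 * tail.
  rewrite -(subnKC ltin) big_split_ord/= big_ord_recr/=; congr (_ + _).
  rewrite subnKC// mulr_sumr; apply: eq_bigr => l _.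
  by rewrite exprD mulrCA.
have tail_le : `|tail| <= M * 2.
  apply: (le_trans (ler_norm_sum _ _ _)).
  apply: (@le_trans _ _ (\sum_(l < n - i.+1) M * t ^+ l)).
    apply: ler_sum => l _; rewrite normrM normrX (gtr0_norm t0).
    by rewrite ler_wpM2r// exprn_ge0// ltW.
  by rewrite -mulr_sumr ler_wpM2l// geometric_le2// ltW.
rewrite -(ltr_pM2l ti0) -[X in X * `|_|](gtr0_norm ti0) -normrM.
rewrite (_ : _ * _ = \sum_(l < n) b n l * t ^+ l
  - \sum_(l < i) b n l * t ^+ l - t ^+ i.+1 * tail); last first.
  by rewrite split_sum; ring.
apply: (le_lt_trans (ler_normB _ _)).
rewrite (_ : t ^+ i * e = t ^+ i * (e / 4) + t ^+ i * (e / 4) + t ^+ i * (e / 2));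
  last by field.
apply: ltr_leD.
  by apply: (le_lt_trans (ler_normB _ _)); rewrite ltrD.
rewrite normrM normrX (gtr0_norm t0) exprSr -mulrA ler_wpM2l ?(ltW ti0)//.
apply: le_trans tM; rewrite mulrCA ler_wpM2l// ltW//.
Unshelve. all: by end_near. Qed.

Lemma power_series_unique (c d : nat * nat -> R[i]) (f : bidisk R -> R[i]^o) :
  (sq_sum c < +oo)%E -> (sq_sum d < +oo)%E ->
  power_series_on_bidisk c f -> power_series_on_bidisk d f -> c = d.
Proof.
suff uniq0 (a : nat * nat -> R[i]) : (sq_sum a < +oo)%E ->
    power_series_on_bidisk a 0 -> a = 0.
  move=> cy dy cf df; apply/eqP; rewrite -subr_eq0; apply/eqP.
  rewrite -scaleN1r; apply: uniq0; first exact/sq_sumD_fin/sq_sumZ_fin.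
  rewrite -(subrr f) -[X in f - X]scale1r -scaleNr.
  exact/power_seriesD/power_seriesZ.
move=> ay a0.
have [M aM] : exists M : C, forall p, `|a p| <= M.
  exists (1 + fine (sq_sum a))%:C => p; rewrite -cnormE lecR.
  have : cnorm (a p) ^+ 2 <= fine (sq_sum a).
    by rewrite -lee_fin fineK ?sq_sum_le// ge0_fin_numE// sq_sum_ge0.
  by have := sqr_ge0 (cnorm (a p) - 1); rewrite sqrrB1; nra.
have M0 : 0 <= M by apply: le_trans (aM (0, 0)%N).
have cols (y : C) : `|y| <= 2^-1 -> forall j,
    (fun n => \sum_(k < n) a (j, nat_of_ord k) * y ^+ k : R[i]^o) @ \oo
      --> (0 : R[i]^o).
  move=> y2 j.
  apply: (@vanishing_coefs (M * 2)
    (fun n j => \sum_(k < n) a (j, nat_of_ord k) * y ^+ k)) => [n i|x x2].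
    apply: (le_trans (ler_norm_sum _ _ _)).
    apply: (@le_trans _ _ (\sum_(l < n) M * `|y| ^+ l)).
      by apply: ler_sum => l _; rewrite normrM normrX ler_wpM2r// exprn_ge0.
    by rewrite -mulr_sumr ler_wpM2l// geometric_le2.
  have lt1 (u : C) : `|u| <= 2^-1 -> `|u| < 1.
    by move/le_lt_trans; apply; rewrite invf_lt1// ltr1n.
  have xyD : ((x, y) : R[i]^o * R[i]^o) \in bidisk R.
    by apply/mem_set; split; exact: lt1.
  have := a0 (SigSub xyD); apply: cvg_trans; apply: near_eq_cvg.
  near=> n; rewrite /partial_sum /=; apply: eq_bigr => i _.
  rewrite mulr_suml; apply: eq_bigr => k _; ring.
apply/funext => -[j k].
have := @vanishing_coefs M (fun _ k => a (j, k)) (fun _ k => aM (j, k))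
  (fun y y2 => cols y y2 j) k.
move/(cvg_lim (@norm_hausdorff _ R[i]^o)); rewrite lim_cst//.
Unshelve. all: by end_near. Qed.

End uniqueness.

(* The Hardy space of the bidisk: an element is a function on the bidisk that is
   the sum of a power series with square-summable coefficients. Such functions
   are holomorphic, and their coefficients are unique. *)
Record hardy (R : realType) := Hardy {
  hardy_fun :> bidisk R -> R[i]^o;
  hardy_funP : hardy_fun \in hardy_pred }.

HB.instance Definition _ (R : realType) := [isSub of hardy R for @hardy_fun R].
HB.instance Definition _ (R : realType) := [Choice of hardy R by <:].
HB.instance Definition _ (R : realType) :=
  [SubChoice_isSubLmodule of hardy R by <:].

Lemma hardy_coef_subproof (R : realType) (f : hardy R) :
  exists2 c, (sq_sum c < +oo)%E & power_series_on_bidisk c f.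
Proof. exact/asboolP/hardy_funP. Qed.

(* Locked: unification may otherwise try to unfold the choice of the
   coefficients and take very long. *)
HB.lock Definition hardy_coef (R : realType) (f : hardy R) :
  nat * nat -> R[i] := sval (cid2 (hardy_coef_subproof f)).

Lemma hardy_coef_fin (R : realType) (f : hardy R) :
  (sq_sum (hardy_coef f) < +oo)%E.
Proof. by rewrite unlock; case: cid2. Qed.

Lemma hardy_coefP (R : realType) (f : hardy R) :
  power_series_on_bidisk (hardy_coef f) f.
Proof. by rewrite unlock; case: cid2. Qed.
Arguments hardy_coefP {R} f z.

Section hardy_norm.
Context {R : realType}.
Implicit Types f g : hardy R.

Lemma hardy_coefE f c : (sq_sum c < +oo)%E -> power_series_on_bidisk c f ->
  hardy_coef f = c.
Proof.
by move=> cy cf; apply: power_series_unique cf => //;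
  [exact: hardy_coef_fin|exact: hardy_coefP].
Qed.

Lemma hardy_funD f g : hardy_fun (f + g) = hardy_fun f + hardy_fun g.
Proof. by []. Qed.

Lemma hardy_funZ a f : hardy_fun (a *: f) = a *: hardy_fun f.
Proof. by []. Qed.

Lemma hardy_coefD f g : hardy_coef (f + g) = hardy_coef f + hardy_coef g.
Proof.
apply: hardy_coefE; first by apply: sq_sumD_fin; exact: hardy_coef_fin.
by rewrite hardy_funD; exact: power_seriesD (hardy_coefP f) (hardy_coefP g).
Qed.

Lemma hardy_coefZ a f : hardy_coef (a *: f) = a *: hardy_coef f.
Proof.
apply: hardy_coefE; first exact/sq_sumZ_fin/hardy_coef_fin.
by rewrite hardy_funZ; exact: power_seriesZ (hardy_coefP f).
Qed.

Definition hardy_norm f : R := Num.sqrt (fine (sq_sum (hardy_coef f))).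

Lemma hardy_norm_ge0 f : 0 <= hardy_norm f.
Proof. exact: sqrtr_ge0. Qed.

Lemma hardy_norm_sqr f : (hardy_norm f ^+ 2)%:E = sq_sum (hardy_coef f).
Proof.
rewrite sqr_sqrtr ?fine_ge0 ?sq_sum_ge0// fineK//.
by rewrite ge0_fin_numE ?sq_sum_ge0// hardy_coef_fin.
Qed.

Lemma hardy_normZ a f : hardy_norm (a *: f) = cnorm a * hardy_norm f.
Proof.
have := hardy_norm_sqr (a *: f); rewrite hardy_coefZ sq_sumZ.
rewrite -(hardy_norm_sqr f) -EFinM -exprMn => -[].
move: (hardy_norm_ge0 (a *: f)) (hardy_norm_ge0 f) (cnorm_ge0 a).
move: (hardy_norm _) (hardy_norm _) (cnorm _) => x y z x0 y0 z0.
by move/eqP; rewrite eqrXn2 ?mulr_ge0// => /eqP.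
Qed.

Lemma hardy_norm0_eq0 f : hardy_norm f = 0 -> f = 0.
Proof.
move=> f0; have := hardy_norm_sqr f; rewrite f0 expr0n => /esym/sq_sum_eq0 cf0.
apply/val_inj/funext => z /=; have := hardy_coefP f z; rewrite cf0 partial_sum0.
by move/(cvg_lim (@norm_hausdorff _ R[i]^o)); rewrite lim_cst.
Qed.

Lemma ler_hardy_normD f g : hardy_norm (f + g) <= hardy_norm f + hardy_norm g.
Proof.
have [/hardy_norm0_eq0 ->|f0] := eqVneq (hardy_norm f) 0.
  by rewrite add0r lerDr hardy_norm_ge0.
have [/hardy_norm0_eq0 ->|g0] := eqVneq (hardy_norm g) 0.
  by rewrite addr0 lerDl hardy_norm_ge0.
have {}f0 : 0 < hardy_norm f by rewrite lt_neqAle eq_sym f0 hardy_norm_ge0.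
have {}g0 : 0 < hardy_norm g by rewrite lt_neqAle eq_sym g0 hardy_norm_ge0.
have := le_sq_sumD (hardy_coef f) (hardy_coef g) (divr_gt0 g0 f0).
rewrite -hardy_coefD -!hardy_norm_sqr -!EFinM -EFinD lee_fin => fg.
rewrite -(@ler_pXn2r _ 2) ?nnegrE ?addr_ge0 ?hardy_norm_ge0//.
rewrite (le_trans fg)// le_eqVlt; apply/orP; left; apply/eqP.
by field; rewrite !gt_eqF.
Qed.

End hardy_norm.

Section hardy_normedModType.
Context {R : realType}.
Implicit Types f g : hardy R.

Let norm f : R[i] := (hardy_norm f)%:C.

Let normD f g : norm (f + g) <= norm f + norm g.
Proof. by rewrite -rmorphD lecR ler_hardy_normD. Qed.

Let normZ (a : R[i]) f : norm (a *: f) = `|a| * norm f.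
Proof. by rewrite /norm hardy_normZ rmorphM/= cnormE. Qed.

Let norm0_eq0 f : norm f = 0 -> f = 0.
Proof. by move/complexI/hardy_norm0_eq0. Qed.

HB.instance Definition _ :=
  Lmodule_isNormed.Build R[i] (hardy R) normD normZ norm0_eq0.

Lemma hardy_cnormE f : cnorm f = hardy_norm f.
Proof. by []. Qed.

End hardy_normedModType.

Section operators.
Context {R : realType} {V W : normedModType R[i]}.
Implicit Types S T : {linear V -> W}.

Definition bounded_operator T :=
  exists M : R, forall x, cnorm (T x) <= M * cnorm x.

Definition compact_operator T := precompact (T @` [set x | cnorm x <= 1]).

Definition operator_norm (T : V -> W) : R :=
  sup [set cnorm (T x) | x in [set x | cnorm x <= 1]].

(* The range of [S] is spanned by fewer than [n] vectors. *)
Definition rank_lt S (n : nat) := exists (k : nat) (e : 'I_k -> W),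
  (k < n)%N /\ forall x, exists a : 'I_k -> R[i], S x = \sum_i a i *: e i.

(* Meaningful for [0 < n] only: no operator has rank [< 0]. *)
Definition approximation_number (n : nat) T : R :=
  inf [set operator_norm (T \- S) | S in
    [set S : {linear V -> W} | bounded_operator S /\ rank_lt S n]].

Definition beta2_minus T : \bar R :=
  limn_einf (fun n => (approximation_number (n ^ 2) T `^ n%:R^-1)%:E).

Definition beta2_plus T : \bar R :=
  limn_esup (fun n => (approximation_number (n ^ 2) T `^ n%:R^-1)%:E).

End operators.

Section self_maps_of_the_bidisk.
Context {R : realType}.
Implicit Types Phi : bidisk R -> bidisk R.

Definition analytic_self_map Phi := holomorphic (fun z => val (Phi z)).

Definition sup_norm Phi : R :=
  sup [set Num.max (cnorm (val (Phi z)).1) (cnorm (val (Phi z)).2) | z in setT].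

Definition truly_2dimensional Phi :=
  (range (fun z => val (Phi z)))° !=set0.

Definition is_composition_operator Phi (C : {linear hardy R -> hardy R}) :=
  forall f, C f = f \o Phi :> (bidisk R -> R[i]^o).

End self_maps_of_the_bidisk.

(* Main.v *)
(** The map is Phi(z1, z2) = (phi(z1), psi(z1) z2) with phi = 1 - v(1 - z1) and
    psi = (1 - z1) / 8, where v(x) is the sum of the 2^-i x / (x + t_i) / 128 with
    knots t_i = 64^-(2^i). When t_(i+1) < |x| <= t_i, the point phi lies at depth
    about 2^-i in the disk, whereas |psi| <= 2^-(2^i): the second coordinate is
    exponentially small compared with the inverse of the depth of the first one.

    The reproducing kernel at Phi(z) grows only like 2^i, and an explicit H in the
    Hardy space is at least 4^(2^i) / 16 there. Since pointwise domination |F| <= M |H|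
    gives the same inequality for the norms, C_Phi is bounded, and its tails on
    functions with vanishing low coefficients are O(N^(-1/2)), so C_Phi is compact.

    Upper bound: expand f in powers of z2, f = sum_k z2^k f_k, and subtract from f_k
    its residual modulo a Blaschke product with zeros 1 - 2^-i, i ranging over
    max(k, 1) 2^i <= L, each with multiplicity L. The total number of zeros is O(L^2),
    and after composition the error is O(q^L): either the Blaschke product is small at
    phi, or psi^k, resp. the weight gained from H, is.

    Lower bound: Lagrange interpolation at the images of the n^2 points
    (w^a / 10, w^b / 2), w a primitive n-th root of unity, gives functions with norm at
    most B^n, so no operator of rank < n^2 is closer to C_Phi than c^n. *)
Require Import Defs.
From HB Require Import structures.
From mathcomp Require Import all_boot all_order all_algebra.
From mathcomp Require Import all_solvable all_field.
From mathcomp Require Import complex ring lra zify.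
From mathcomp Require Import all_classical all_reals all_analysis.

Set Implicit Arguments.
Unset Strict Implicit.
Unset Printing Implicit Defensive.

Import Order.TTheory GRing.Theory Num.Theory.
Import numFieldNormedType.Exports.

Local Open Scope classical_set_scope.
Local Open Scope ring_scope.
Local Open Scope complex_scope.

(** The obstacle is the count of dimensions. An error q^L near the boundary would ordinarily take
    about L depths 2^-i for each of the powers z2^k with k <= L, and L-fold zeros: rank L^3, hence
    only exp(-c n^(1/3)). Coupling the coordinates removes one factor L: as |psi|^k <= 2^-(k 2^i),
    depth i needs zeros for z2^k only if k 2^i <= L, and the sum of L / 2^i over i is O(L). The
    column k = 0 gets no help from psi. The majorant H steps in, and it also plays the part of a
    Carleson embedding: 4^(2^i) is the square of y = 2^(2^i), where one y pays for the missing zeros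
    and the other covers the kernel growth 2^i. The base 64 of the knots makes the series of H
    converge, because t_i / (1 - z1 + t_i) has norm at most sqrt(t_i) = 8^-(2^i). *)

Local Notation Re := complex.Re.
Local Notation Im := complex.Im.

(** * Moduli and limits of complex numbers *)

Section modulus.
Context {R : realType}.
Implicit Types x y : R[i].

Lemma cnorm_sqr x : cnorm x ^+ 2 = Re x ^+ 2 + Im x ^+ 2.
Proof. by apply: complexI; rewrite rmorphXn /= cnormE add_Re2_Im2. Qed.

Lemma cnormR (a : R) : cnorm (a%:C : R[i]) = `|a|.
Proof.
apply/eqP; rewrite -(@eqrXn2 _ 2) ?cnorm_ge0//.
by rewrite cnorm_sqr /= expr0n addr0 real_normK// num_real.
Qed.

Lemma cnormR_ge0 (a : R) : 0 <= a -> cnorm (a%:C : R[i]) = a.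
Proof. by move=> a0; rewrite cnormR ger0_norm. Qed.

Lemma cnorm1 : cnorm (1 : R[i]) = 1.
Proof. by rewrite /cnorm normr1. Qed.

Lemma cnormN (V : normedZmodType R[i]) (x : V) : cnorm (- x) = cnorm x.
Proof. by rewrite /cnorm normrN. Qed.

Lemma cnormBC (V : normedZmodType R[i]) (x y : V) : cnorm (x - y) = cnorm (y - x).
Proof. by rewrite -cnormN opprB. Qed.

Lemma ler_cnormB (V : normedZmodType R[i]) (x y : V) :
  cnorm (x - y) <= cnorm x + cnorm y.
Proof. by rewrite (le_trans (ler_cnormD _ _))// cnormN. Qed.

Lemma cnormX x n : cnorm (x ^+ n) = cnorm x ^+ n.
Proof. by elim: n => [|n IH]; rewrite ?expr0 ?cnorm1// !exprS cnormM IH. Qed.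

Lemma cnormV x : cnorm x^-1 = (cnorm x)^-1.
Proof.
have [->|x0] := eqVneq x 0; first by rewrite invr0 cnorm0 invr0.
have cx0 : cnorm x != 0 by apply: contra_neq x0 => /cnorm0_eq0.
by apply: (mulfI cx0); rewrite -cnormM !divff ?cnorm1.
Qed.

Lemma cnorm_div x y : cnorm (x / y) = cnorm x / cnorm y.
Proof. by rewrite cnormM cnormV. Qed.

Lemma cnorm_gt0 x : (0 < cnorm x) = (x != 0).
Proof.
rewrite lt_neqAle cnorm_ge0 andbT eq_sym; congr negb.
by apply/eqP/eqP => [/cnorm0_eq0//|->]; rewrite cnorm0.
Qed.

Lemma ler_cnorm_sum (V : normedZmodType R[i]) (I : Type) (r : seq I) (P : pred I)
  (F : I -> V) :
  cnorm (\sum_(i <- r | P i) F i) <= \sum_(i <- r | P i) cnorm (F i).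
Proof.
elim/big_rec2: _ => [|i a b _ ab]; first by rewrite cnorm0.
by rewrite (le_trans (ler_cnormD _ _))// lerD2l.
Qed.

Lemma cnorm_prod (I : Type) (r : seq I) (P : pred I) (F : I -> R[i]) :
  cnorm (\prod_(i <- r | P i) F i) = \prod_(i <- r | P i) cnorm (F i).
Proof. by apply: (big_morph _ cnormM cnorm1). Qed.

Lemma Re_le_cnorm x : Re x <= cnorm x.
Proof.
rewrite (le_trans (ler_norm _))//.
rewrite -(@ler_pXn2r _ 2) ?nnegrE ?cnorm_ge0// cnorm_sqr real_normK ?num_real//.
by rewrite lerDl sqr_ge0.
Qed.

Lemma norm_Re_le x : `|Re x| <= cnorm x.
Proof.
rewrite -(@ler_pXn2r _ 2) ?nnegrE ?cnorm_ge0// cnorm_sqr real_normK ?num_real//.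
by rewrite lerDl sqr_ge0.
Qed.

Lemma norm_Im_le x : `|Im x| <= cnorm x.
Proof.
rewrite -(@ler_pXn2r _ 2) ?nnegrE ?cnorm_ge0// cnorm_sqr real_normK ?num_real//.
by rewrite lerDr sqr_ge0.
Qed.

Lemma cnorm_le_Re_Im x : cnorm x <= `|Re x| + `|Im x|.
Proof.
rewrite -(@ler_pXn2r _ 2) ?nnegrE ?cnorm_ge0 ?addr_ge0// cnorm_sqr.
rewrite -(@real_normK _ (Re x)) ?num_real// -(@real_normK _ (Im x)) ?num_real//.
by rewrite sqrrD lerD2r lerDl mulrn_wge0// mulr_ge0.
Qed.

Lemma normr_lt1 x : (`|x| < 1) = (cnorm x < 1).
Proof. by rewrite -cnormE -[1](rmorph1 (real_complex R)) ltcR. Qed.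

Lemma cReD x y : Re (x + y) = Re x + Re y.
Proof. by case: x y => [a b] [c d]. Qed.
Lemma cImD x y : Im (x + y) = Im x + Im y.
Proof. by case: x y => [a b] [c d]. Qed.
Lemma cReN x : Re (- x) = - Re x. Proof. by case: x. Qed.
Lemma cImN x : Im (- x) = - Im x. Proof. by case: x. Qed.
Lemma cReB x y : Re (x - y) = Re x - Re y. Proof. by rewrite cReD cReN. Qed.
Lemma cImB x y : Im (x - y) = Im x - Im y. Proof. by rewrite cImD cImN. Qed.
Lemma cReM x y : Re (x * y) = Re x * Re y - Im x * Im y.
Proof. by case: x y => [a b] [c d]. Qed.
Lemma cImM x y : Im (x * y) = Re x * Im y + Im x * Re y.
Proof. by case: x y => [a b] [c d]. Qed.

Lemma Re_sum (I : Type) (r : seq I) (P : pred I) (F : I -> R[i]) :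
  Re (\sum_(i <- r | P i) F i) = \sum_(i <- r | P i) Re (F i).
Proof. by apply: (big_morph _ cReD). Qed.

End modulus.

Section limits.
Context {R : realType}.

(** The balls of a normed space over [R[i]] have radii in [R[i]]; the estimates below are real,
    hence this form with real radii. *)
Lemma cvg_epsP (V : normedModType R[i]) (u : nat -> V) (l : V) :
  (u @ \oo --> l) <->
  (forall e : R, 0 < e -> exists N, forall n, (N <= n)%N -> cnorm (u n - l) < e).
Proof.
split=> [/cvgrPdist_lt ul e e0|ul].
  have ec0 : 0 < (e%:C : R[i]) by rewrite ltcR.
  have [N _ NP] := ul _ ec0; exists N => n Nn.
  by rewrite cnormBC -ltcR cnormE; apply: NP.
apply/cvgrPdist_lt => e e0.
have /complex_realP[d de] : e \is Num.real by rewrite realE ltW.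
move: e0; rewrite de ltcR => d0.
have [N NP] := ul _ d0; exists N => // n /= Nn.
by rewrite -cnormE ltcR cnormBC; apply: NP.
Qed.

Lemma cvgR_epsP (u : nat -> R) (l : R) :
  (u @ \oo --> l) <->
  (forall e : R, 0 < e -> exists N, forall n, (N <= n)%N -> `|u n - l| < e).
Proof.
split=> [/cvgrPdist_lt ul e e0|ul].
  by have [N _ NP] := ul _ e0; exists N => n Nn; rewrite distrC; apply: NP.
apply/cvgrPdist_lt => e e0.
by have [N NP] := ul _ e0; exists N => // n /= Nn; rewrite distrC; apply: NP.
Qed.

Lemma cvg_cnorm_le (V : normedModType R[i]) (u : nat -> V) (l : V) (e : nat -> R) :
  e @ \oo --> (0 : R) -> (forall n, cnorm (u n - l) <= e n) -> u @ \oo --> l.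
Proof.
move=> /cvgR_epsP e0 ue; apply/cvg_epsP => d d0.
have [N NP] := e0 _ d0; exists N => n /NP; rewrite subr0 => /(le_lt_trans _); apply.
by rewrite (le_trans (ue _))// ler_norm.
Qed.

Lemma cvg_Re (u : nat -> R[i]) (l : R[i]) :
  (u : nat -> R[i]^o) @ \oo --> (l : R[i]^o) -> (fun n => Re (u n)) @ \oo --> Re l.
Proof.
move/cvg_epsP => ul; apply/cvgR_epsP => e e0.
have [N NP] := ul _ e0; exists N => n /NP; apply: le_lt_trans.
by rewrite -cReB norm_Re_le.
Qed.

Lemma cvg_cnorm (V : normedModType R[i]) (u : nat -> V) (l : V) :
  u @ \oo --> l -> (fun n => cnorm (u n)) @ \oo --> cnorm l.
Proof.
move/cvg_epsP => ul; apply/cvgR_epsP => e e0.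
have [N NP] := ul _ e0; exists N => n /NP; apply: le_lt_trans.
rewrite ler_distl lerBlDr; apply/andP; split.
  by rewrite addrC cnormBC -[X in cnorm X <= _](subrK (u n)) ler_cnormD.
by rewrite -[X in cnorm X <= _](subrK l) addrC ler_cnormD.
Qed.

Lemma cvg_cnorm_lim_le (V : normedModType R[i]) (u : nat -> V) (l : V) (M : R) :
  u @ \oo --> l -> (exists N, forall n, (N <= n)%N -> cnorm (u n) <= M) ->
  cnorm l <= M.
Proof.
move=> /cvg_cnorm ul [N NP].
rewrite -(cvg_lim (@Rhausdorff R) ul); apply: limr_le; first exact: cvgP ul.
by exists N.
Qed.

Lemma cauchy_rate_cvgR (u : nat -> R) (e : nat -> R) :
  e @ \oo --> (0 : R) -> (forall n m, (n <= m)%N -> `|u m - u n| <= e n) ->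
  cvg (u @ \oo).
Proof.
move=> /cvgR_epsP e0 ue; apply/cauchy_cvgP/cauchy_ballP => d d0.
have [N NP] := e0 _ (divr_gt0 d0 (ltr0n _ 2)).
have uN n : (N <= n)%N -> `|u n - u N| < d / 2.
  move=> Nn; rewrite (le_lt_trans (ue _ _ Nn))// (le_lt_trans (ler_norm _))//.
  by have := NP _ (leqnn N); rewrite subr0.
near_simpl; near=> a b => /=.
rewrite /ball/= (_ : u a - u b = (u a - u N) - (u b - u N)); last by ring.
rewrite (le_lt_trans (ler_normB _ _))// [d]splitr ltrD// uN//.
  by near: a; exact: nbhs_infty_ge.
by near: b; exact: nbhs_infty_ge.
Unshelve. all: by end_near. Qed.

Lemma cauchy_rate_cvg (u : nat -> R[i]) (e : nat -> R) :
  e @ \oo --> (0 : R) -> (forall n m, (n <= m)%N -> cnorm (u m - u n) <= e n) ->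
  exists l : R[i], ((u : nat -> R[i]^o) @ \oo --> (l : R[i]^o)) /\
    forall n, cnorm (l - u n) <= e n.
Proof.
move=> e0 ue.
have /cvg_ex[/= a ua] : cvg ((fun n => Re (u n)) @ \oo).
  apply: (cauchy_rate_cvgR e0) => n m nm.
  by rewrite -cReB (le_trans (norm_Re_le _))// ue.
have /cvg_ex[/= b ub] : cvg ((fun n => Im (u n)) @ \oo).
  apply: (cauchy_rate_cvgR e0) => n m nm.
  by rewrite -cImB (le_trans (norm_Im_le _))// ue.
have ul : (u : nat -> R[i]^o) @ \oo --> (Complex a b : R[i]^o).
  apply/cvg_epsP => d d0; have d20 : 0 < d / 2 by rewrite divr_gt0.
  have [N NP] := (cvgR_epsP _ _).1 ua _ d20.
  have [M MP] := (cvgR_epsP _ _).1 ub _ d20.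
  exists (maxn N M) => n; rewrite geq_max => /andP[/NP ha /MP hb].
  apply: (le_lt_trans (cnorm_le_Re_Im _)).
  by rewrite cReB cImB [d]splitr ltrD.
exists (Complex a b); split=> // n.
have uln : (fun m => u m - u n : R[i]^o) @ \oo --> (Complex a b - u n : R[i]^o).
  by apply: (cvgB ul); exact: cvg_cst.
apply: (cvg_cnorm_lim_le uln); exists n => m nm; exact: ue.
Qed.

Lemma cvgMl_c (a : R[i]) (u : nat -> R[i]) (l : R[i]) :
  (u : nat -> R[i]^o) @ \oo --> (l : R[i]^o) ->
  (fun n => a * u n : R[i]^o) @ \oo --> (a * l : R[i]^o).
Proof.
move=> /cvg_epsP ul; apply/cvg_epsP => e e0.
have a0 : 0 < cnorm a + 1 by rewrite ltr_wpDl ?cnorm_ge0.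
have [N NP] := ul _ (divr_gt0 e0 a0); exists N => n /NP.
rewrite ltr_pdivlMr// => ule; rewrite -mulrBr cnormM.
apply: le_lt_trans ule; rewrite mulrC ler_wpM2l ?cnorm_ge0// lerDl//.
Qed.

Lemma cvg_unique_c (u : nat -> R[i]) (l l' : R[i]) :
  (u : nat -> R[i]^o) @ \oo --> (l : R[i]^o) ->
  (u : nat -> R[i]^o) @ \oo --> (l' : R[i]^o) -> l = l'.
Proof. by move=> /(cvg_lim (@norm_hausdorff _ R[i]^o)) <- /(cvg_lim (@norm_hausdorff _ R[i]^o)) <-. Qed.

Lemma cvg_exprR (r : R) : 0 <= r -> r < 1 -> (fun n => r ^+ n) @ \oo --> (0 : R).
Proof. by move=> r0 r1; apply: cvg_expr; rewrite ger0_norm. Qed.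

End limits.

(** * Square-summable coefficients *)

Section coefficients.
Context {R : realType}.
Implicit Types (c d : nat * nat -> R[i]) (w : R[i] * R[i]).

(** Lagrange's identity: the squares of all 2 x 2 minors add up to twice the difference of the two
    sides. *)
Lemma cauchy_schwarz_sum (I : finType) (x y : I -> R) :
  (\sum_i x i * y i) ^+ 2 <= (\sum_i x i ^+ 2) * (\sum_i y i ^+ 2).
Proof.
have : 0 <= \sum_i \sum_j (x i * y j - x j * y i) ^+ 2.
  by apply: sumr_ge0 => i _; apply: sumr_ge0 => j _; rewrite sqr_ge0.
suff -> : \sum_i \sum_j (x i * y j - x j * y i) ^+ 2 =
    2 * ((\sum_i x i ^+ 2) * (\sum_i y i ^+ 2) - (\sum_i x i * y i) ^+ 2).
  by rewrite pmulr_rge0 ?ltr0n// subr_ge0.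
pose X := \sum_i x i ^+ 2; pose Y := \sum_i y i ^+ 2; pose Z := \sum_i x i * y i.
transitivity (\sum_i (x i ^+ 2 * Y - 2 * (x i * y i) * Z + y i ^+ 2 * X)).
  apply: eq_bigr => i _; rewrite /X /Y /Z !mulr_sumr -sumrB -big_split/=.
  by apply: eq_bigr => j _; ring.
rewrite big_split sumrB/= -!mulr_suml -mulr_sumr -/X -/Y -/Z; ring.
Qed.

(** [partial_sum] with independent side lengths, since a shift of the coefficients lengthens one
    side only. *)
Definition rect_sum c w m n : R[i] :=
  \sum_(j < m) \sum_(k < n) c (nat_of_ord j, nat_of_ord k) * w.1 ^+ j * w.2 ^+ k.

Definition square_sum c n : R :=
  \sum_(j < n) \sum_(k < n) cnorm (c (nat_of_ord j, nat_of_ord k)) ^+ 2.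

Lemma square_sum_fsbig c n :
  (square_sum c n)%:E = (\sum_(p \in [set p : nat * nat | (p.1 < n)%N && (p.2 < n)%N])
     (cnorm (c p) ^+ 2)%:E)%E.
Proof.
rewrite (_ : [set p : nat * nat | _] =
  [set` [seq (j, k) | j <- iota 0 n, k <- iota 0 n]]); last first.
  apply/seteqP; split=> -[j k] /=.
    by move=> /andP[jn kn]; apply/allpairsP; exists (j, k); rewrite !mem_iota.
  by move=> /allpairsP[[a b] /=]; rewrite !mem_iota /= => -[an bn [-> ->]]; rewrite an bn.
rewrite -fsbig_seq; last first.
  by apply: allpairs_uniq; rewrite ?iota_uniq// => -[a b] [a' b'].
have -> : iota 0 n = index_iota 0 n by rewrite /index_iota subn0.
rewrite big_allpairs /= big_mkord /square_sum -sumEFin.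
by apply: eq_bigr => j _; rewrite big_mkord -sumEFin.
Qed.

Lemma square_sum_le c n : (sq_sum c < +oo)%E -> square_sum c n <= fine (sq_sum c).
Proof.
move=> cy; rewrite -lee_fin fineK ?ge0_fin_numE ?sq_sum_ge0// square_sum_fsbig.
apply: esum_ge; exists [set p : nat * nat | (p.1 < n)%N && (p.2 < n)%N] => //.
split=> //; rewrite (_ : [set p : nat * nat | _] = `I_n `*` `I_n).
  exact: finite_setX.
by apply/seteqP; split=> -[j k] /= => [/andP|[-> ->]].
Qed.

Lemma sq_sum_le_bound c (M : R) : (forall n, square_sum c n <= M) ->
  (sq_sum c <= M%:E)%E.
Proof.
move=> cM; apply: ge_ereal_sup => _ /= [A [finA _] <-].
have [n An] : exists n, A `<=` [set p : nat * nat | (p.1 < n)%N && (p.2 < n)%N].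
  exists (\max_(p <- finmap.enum_fset (fset_set A)) (maxn p.1 p.2)).+1 => p Ap /=.
  have : (maxn p.1 p.2 <= \max_(p <- finmap.enum_fset (fset_set A)) maxn p.1 p.2)%N.
    by apply: leq_bigmax_seq => //; rewrite in_fset_set// inE.
  by rewrite geq_max !ltnS => /andP[-> ->].
apply: le_trans (_ : (square_sum c n)%:E <= _)%E; last by rewrite lee_fin.
rewrite square_sum_fsbig; apply: lee_fsum_nneg_subset => //.
- rewrite (_ : [set p : nat * nat | _] = `I_n `*` `I_n); first exact: finite_setX.
  by apply/seteqP; split=> -[j k] /= => [/andP|[-> ->]].
- by move=> p; rewrite !inE; apply: An.
- by move=> p _; rewrite lee_fin sqr_ge0.
Qed.

Lemma le_square_sum c m n : (m <= n)%N -> square_sum c m <= square_sum c n.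
Proof.
move=> mn; rewrite /square_sum.
rewrite (big_ord_widen _ (fun j => \sum_(k < m) cnorm (c (j, nat_of_ord k)) ^+ 2) mn).
rewrite big_mkcond/=; apply: ler_sum => j _.
case: ifP => _; last by apply: sumr_ge0 => k _; rewrite sqr_ge0.
rewrite (big_ord_widen _ (fun k => cnorm (c (nat_of_ord j, k)) ^+ 2) mn).
by rewrite big_mkcond/=; apply: ler_sum => k _; case: ifP => // _; rewrite sqr_ge0.
Qed.

(* Dominates the sum of |w1^j w2^k|^2 over the (j, k) with m <= j or n <= k. *)
Definition kernel_bound w m n : R :=
  ((cnorm w.1 ^+ 2) ^+ m + (cnorm w.2 ^+ 2) ^+ n) /
    ((1 - cnorm w.1 ^+ 2) * (1 - cnorm w.2 ^+ 2)).

Lemma geometric_sum_le (u : R) m : 0 <= u -> u < 1 ->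
  \sum_(j < m) u ^+ j <= (1 - u)^-1.
Proof.
move=> u0 u1; rewrite -[leRHS]mul1r ler_pdivlMr ?subr_gt0// mulrC.
have := subrX1 u m; rewrite -[u - 1]opprB mulNr => /(congr1 -%R).
by rewrite opprK opprB => <-; rewrite gerBl exprn_ge0.
Qed.

Lemma geometric_tail_le (u : R) m M : 0 <= u -> u < 1 ->
  \sum_(j < M) (m <= j)%N%:R * u ^+ j <= u ^+ m / (1 - u).
Proof.
move=> u0 u1; apply: (@le_trans _ _ (\sum_(j < M) u ^+ m * ((m <= j)%N%:R * u ^+ (j - m)))).
  apply: ler_sum => j _; case: leqP => mj; last by rewrite !mul0r mulr0.
  by rewrite !mul1r -exprD subnKC.
rewrite -mulr_sumr ler_wpM2l ?exprn_ge0//.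
apply: le_trans (geometric_sum_le M u0 u1).
have [Mm|mM] := leqP M m.
  rewrite big1; first by apply: sumr_ge0 => *; rewrite exprn_ge0.
  by move=> j _; rewrite leqNgt (leq_trans (ltn_ord j) Mm) mul0r.
rewrite -(subnKC (ltnW mM)) big_split_ord/= big1 ?add0r; last first.
  by move=> j _; rewrite leqNgt ltn_ord mul0r.
under eq_bigr do rewrite leq_addr mul1r addKn.
rewrite addnC big_split_ord/= lerDl; apply: sumr_ge0 => *; exact: exprn_ge0.
Qed.

(** Cauchy-Schwarz against the monomials outside the m x n rectangle. The indicator of this union of
    two strips is at most the sum of their indicators, and each strip factors into two geometric
    series. *)
Lemma rect_sum_bound c w m n M (Q : R) : cnorm w.1 < 1 -> cnorm w.2 < 1 ->
  (forall j k, (j < m)%N -> (k < n)%N -> c (j, k) = 0) -> square_sum c M <= Q ->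
  cnorm (rect_sum c w M M) ^+ 2 <= Q * kernel_bound w m n.
Proof.
move=> w1 w2 c0 cQ; set u := cnorm w.1 ^+ 2; set v := cnorm w.2 ^+ 2.
have u0 : 0 <= u by rewrite sqr_ge0.
have v0 : 0 <= v by rewrite sqr_ge0.
have u1 : u < 1 by rewrite expr_lt1// cnorm_ge0.
have v1 : v < 1 by rewrite expr_lt1// cnorm_ge0.
pose b (p : 'I_M * 'I_M) : R := ((m <= p.1) || (n <= p.2))%N%:R
  * cnorm w.1 ^+ p.1 * cnorm w.2 ^+ p.2.
pose a (p : 'I_M * 'I_M) : R := cnorm (c (nat_of_ord p.1, nat_of_ord p.2)).
apply: (@le_trans _ _ ((\sum_p a p * b p) ^+ 2)).
  rewrite ler_pXn2r ?nnegrE ?cnorm_ge0//; last first.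
    by apply: sumr_ge0 => p _; rewrite !mulr_ge0 ?cnorm_ge0 ?exprn_ge0 ?cnorm_ge0 ?ler0n.
  rewrite /rect_sum pair_bigA/=; apply: (le_trans (ler_cnorm_sum _ _ _)).
  apply: ler_sum => -[j k] _ /=; rewrite /a /b/= !cnormM !cnormX.
  case: (leqP m j) => [_|jm] /=; first by rewrite mul1r mulrA.
  case: (leqP n k) => [_|kn] /=; first by rewrite mul1r mulrA.
  by rewrite c0// cnorm0 !mul0r.
apply: (le_trans (cauchy_schwarz_sum _ _)).
have b0 : 0 <= \sum_p b p ^+ 2 by apply: sumr_ge0 => p _; rewrite sqr_ge0.
apply: (@le_trans _ _ (Q * \sum_p b p ^+ 2)).
  rewrite ler_wpM2r//; apply: le_trans cQ.
  by rewrite /square_sum pair_bigA/=.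
have Q0 : 0 <= Q.
  apply: le_trans cQ; apply: sumr_ge0 => j _; apply: sumr_ge0 => k _.
  exact: sqr_ge0.
rewrite ler_wpM2l//.
apply: (@le_trans _ _ (\sum_(j < M) \sum_(k < M)
   ((m <= j)%N%:R * u ^+ j * v ^+ k + u ^+ j * ((n <= k)%N%:R * v ^+ k)))).
  rewrite [leRHS]pair_bigA/=; apply: ler_sum => -[j k] _ /=.
  rewrite /b/=.
  have uj : (cnorm w.1 ^+ j) ^+ 2 = u ^+ j by rewrite /u -!exprM mulnC.
  have vk : (cnorm w.2 ^+ k) ^+ 2 = v ^+ k by rewrite /v -!exprM mulnC.
  rewrite [leLHS]exprMn [X in X * _ <= _]exprMn uj vk.
  have uv : 0 <= u ^+ j * v ^+ k by rewrite mulr_ge0// exprn_ge0.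
  move: uv; move: (u ^+ j) (v ^+ k) => x y xy.
  by case: leqP => _; case: leqP => _ /=; rewrite ?mulr1n ?mulr0n ?expr1n ?expr0n/= ?mul1r ?mul0r ?mulr0 ?addr0 ?add0r ?lerDl//.
under eq_bigr do rewrite big_split/= -!mulr_sumr.
rewrite big_split/= -!mulr_suml /kernel_bound -/u -/v.
have -> : (u ^+ m + v ^+ n) / ((1 - u) * (1 - v)) =
   u ^+ m / (1 - u) / (1 - v) + (1 - u)^-1 * (v ^+ n / (1 - v)).
  by field; rewrite !subr_eq0 !gt_eqF.
have s0 (l : nat) (x : R) (F : nat -> R) : 0 <= x -> (forall i, 0 <= F i) ->
    0 <= \sum_(j < l) F j * x ^+ j.
  by move=> x0 F0; apply: sumr_ge0 => i _; rewrite mulr_ge0 ?exprn_ge0.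
have s1 (l : nat) (x : R) : 0 <= x -> 0 <= \sum_(j < l) x ^+ j.
  by move=> x0; apply: sumr_ge0 => i _; rewrite exprn_ge0.
apply: lerD; apply: ler_pM; rewrite ?s1 ?(s0 _ _ (fun i => (_ <= i)%N%:R))//.
- exact: geometric_tail_le.
- exact: geometric_sum_le.
- exact: geometric_sum_le.
- exact: geometric_tail_le.
Qed.

Definition truncate c m n : nat * nat -> R[i] :=
  fun p => if ((p.1 < m) && (p.2 < n))%N then c p else 0.

Lemma rect_sum_truncate c w m n M : (m <= M)%N -> (n <= M)%N ->
  rect_sum (truncate c m n) w M M = rect_sum c w m n.
Proof.
move=> mM nM; rewrite /rect_sum.
rewrite (big_ord_widen _ (fun j => \sum_(k < n) c (j, nat_of_ord k) * w.1 ^+ j * w.2 ^+ k) mM).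
rewrite [RHS]big_mkcond/=; apply: eq_bigr => j _; rewrite /truncate/=.
case: ifP => jm; last by rewrite big1// => k _; rewrite !mul0r.
rewrite (big_ord_widen _ (fun k => c (nat_of_ord j, k) * w.1 ^+ j * w.2 ^+ k) nM).
rewrite [RHS]big_mkcond/=; apply: eq_bigr => k _.
by case: ifP => //; rewrite !mul0r.
Qed.

Lemma rect_sumB c d w m n :
  rect_sum (c - d) w m n = rect_sum c w m n - rect_sum d w m n.
Proof.
rewrite /rect_sum -sumrB; apply: eq_bigr => j _; rewrite -sumrB.
by apply: eq_bigr => k _; rewrite -!mulrBl.
Qed.

Lemma square_sum_subtruncate c m n M :
  square_sum (c - truncate c m n) M <= square_sum c M.
Proof.
rewrite /square_sum; apply: ler_sum => j _; apply: ler_sum => k _.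
rewrite [X in cnorm X](_ : _ = c (nat_of_ord j, nat_of_ord k) - truncate c m n (nat_of_ord j, nat_of_ord k))//.
rewrite /truncate; case: ifP => _; first by rewrite subrr cnorm0 expr0n sqr_ge0.
by rewrite subr0.
Qed.

Lemma rect_sum_dist c w m n M (Q : R) : cnorm w.1 < 1 -> cnorm w.2 < 1 ->
  (m <= M)%N -> (n <= M)%N -> square_sum c M <= Q ->
  cnorm (rect_sum c w M M - rect_sum c w m n) ^+ 2 <= Q * kernel_bound w m n.
Proof.
move=> w1 w2 mM nM cQ.
rewrite -(rect_sum_truncate c w mM nM) -rect_sumB; apply: rect_sum_bound => //.
  move=> j k jm kn; rewrite -[LHS]/(c (j, k) - truncate c m n (j, k)).
  by rewrite /truncate/= jm kn subrr.
exact: le_trans (square_sum_subtruncate _ _ _ _) cQ.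
Qed.

End coefficients.

(** * The Hardy space *)

Section hardy_space.
Context {R : realType}.
Implicit Types (c d : nat * nat -> R[i]) (w : R[i] * R[i]) (f g : hardy R).
Implicit Type z : bidisk R.

Lemma bidisk1 z : cnorm ((val z).1 : R[i]) < 1.
Proof. by have /set_mem[] := valP z; rewrite normr_lt1. Qed.

Lemma bidisk2 z : cnorm ((val z).2 : R[i]) < 1.
Proof. by have /set_mem[_] := valP z; rewrite normr_lt1. Qed.

Lemma bidisk_exists (w : R[i] * R[i]) : cnorm w.1 < 1 -> cnorm w.2 < 1 ->
  exists z : bidisk R, val z = w.
Proof.
move=> w1 w2; have wD : (w : R[i]^o * R[i]^o) \in bidisk R.
  by apply/mem_set; split; rewrite normr_lt1.
by exists (SigSub wD).
Qed.

Lemma sqrt_cvg0 (u : nat -> R) : u @ \oo --> (0 : R) ->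
  (fun n => Num.sqrt (u n)) @ \oo --> (0 : R).
Proof.
by move=> u0; rewrite -[X in _ --> X](@sqrtr0 R); apply: continuous_cvg => //;
  exact: sqrt_continuous.
Qed.

Lemma kernel_bound_cvg0 w : cnorm w.1 < 1 -> cnorm w.2 < 1 ->
  (fun n => kernel_bound w n n) @ \oo --> (0 : R).
Proof.
move=> w1 w2; have e0 (x : R[i]) : cnorm x < 1 ->
    (fun n => (cnorm x ^+ 2) ^+ n) @ \oo --> (0 : R).
  by move=> x1; apply: cvg_exprR; rewrite ?sqr_ge0// expr_lt1// cnorm_ge0.
have := cvgMr_tmp (b := ((1 - cnorm w.1 ^+ 2) * (1 - cnorm w.2 ^+ 2))^-1)
  (cvgD (e0 _ w1) (e0 _ w2)).
by rewrite addr0 mul0r; apply.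
Qed.

Lemma square_sum_hardy f n : square_sum (hardy_coef f) n <= hardy_norm f ^+ 2.
Proof.
rewrite -lee_fin hardy_norm_sqr.
by rewrite -(@fineK _ (sq_sum _)) ?ge0_fin_numE ?sq_sum_ge0 ?lee_fin ?square_sum_le ?hardy_coef_fin.
Qed.

Lemma hardy_norm_le f (M : R) : 0 <= M ->
  (forall n, square_sum (hardy_coef f) n <= M ^+ 2) -> hardy_norm f <= M.
Proof.
move=> M0 fM; rewrite -(@ler_pXn2r _ 2) ?nnegrE ?hardy_norm_ge0//.
by rewrite -lee_fin hardy_norm_sqr; exact: sq_sum_le_bound.
Qed.

Lemma cnorm_le_sqrt (x : R[i]) (a b : R) : 0 <= a -> cnorm x ^+ 2 <= a ^+ 2 * b ->
  cnorm x <= a * Num.sqrt b.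
Proof.
move=> a0 xab; have : Num.sqrt (cnorm x ^+ 2) <= Num.sqrt (a ^+ 2 * b).
  by rewrite ler_wsqrtr.
by rewrite [X in _ <= X]sqrtrM ?sqr_ge0// !sqrtr_sqr (ger0_norm a0) ger0_norm ?cnorm_ge0.
Qed.

Lemma hardy_exists c : (sq_sum c < +oo)%E -> exists f, hardy_coef f = c.
Proof.
move=> cy; pose Q := fine (sq_sum c).
have Q0 : 0 <= Q by rewrite fine_ge0// sq_sum_ge0.
pose e w n := Num.sqrt Q * Num.sqrt (kernel_bound w n n).
have lim_ex z : exists l : R[i], (partial_sum c (val z) : nat -> R[i]^o) @ \oo --> (l : R[i]^o).
  have [||l [cl _]] := @cauchy_rate_cvg R (fun n => rect_sum c (val z) n n) (e (val z)).
  - have /(cvgMl_tmp (a := Num.sqrt Q)) := sqrt_cvg0 (kernel_bound_cvg0 (bidisk1 z) (bidisk2 z)).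
    by rewrite mulr0; apply.
  - move=> n m nm; apply: cnorm_le_sqrt; first exact: sqrtr_ge0.
    rewrite sqr_sqrtr//; apply: rect_sum_dist => //; rewrite ?bidisk1 ?bidisk2//.
    exact: square_sum_le.
  - by exists l.
pose F z : R[i]^o := sval (cid (lim_ex z)).
have cF : power_series_on_bidisk c F by move=> z; rewrite /F; case: cid.
have FP : F \in hardy_pred by apply/asboolP; exists c.
by exists (Hardy FP); apply: hardy_coefE.
Qed.

Lemma hardy_coef_inj : injective (@hardy_coef R).
Proof.
move=> f g fg; apply/eqP; rewrite -subr_eq0; apply/eqP/hardy_norm0_eq0/eqP.
rewrite eq_le hardy_norm_ge0 andbT hardy_norm_le// => n.
rewrite -scaleN1r hardy_coefD hardy_coefZ fg scaleN1r subrr expr0n/=.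
by rewrite /square_sum big1// => j _; rewrite big1// => k _; rewrite cnorm0 expr0n.
Qed.

Lemma hardy_coefB f g : hardy_coef (f - g) = hardy_coef f - hardy_coef g.
Proof. by rewrite -scaleN1r hardy_coefD hardy_coefZ scaleN1r. Qed.

Lemma hardy_norm0 : hardy_norm (0 : hardy R) = 0.
Proof. by rewrite -hardy_cnormE cnorm0. Qed.

Lemma hardy_rect_sum_close f z m n :
  cnorm (f z - rect_sum (hardy_coef f) (val z) m n) <=
    hardy_norm f * Num.sqrt (kernel_bound (val z) m n).
Proof.
have fz := hardy_coefP f z.
have fl : (fun M => partial_sum (hardy_coef f) (val z) M - rect_sum (hardy_coef f) (val z) m n : R[i]^o)
    @ \oo --> (f z - rect_sum (hardy_coef f) (val z) m n : R[i]^o).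
  by apply: (cvgB fz); exact: cvg_cst.
apply: (cvg_cnorm_lim_le fl); exists (maxn m n) => M; rewrite geq_max => /andP[mM nM].
apply: cnorm_le_sqrt; first exact: hardy_norm_ge0.
by apply: rect_sum_dist => //; rewrite ?bidisk1 ?bidisk2 ?square_sum_hardy.
Qed.

Lemma rect_sum0 c w m n : (forall j k, (j < m)%N -> (k < n)%N -> c (j, k) = 0) ->
  rect_sum c w m n = 0.
Proof.
move=> c0; rewrite /rect_sum big1// => j _; rewrite big1// => k _.
by rewrite c0// !mul0r.
Qed.

Lemma hardy_value_bound f z m n :
  (forall j k, (j < m)%N -> (k < n)%N -> hardy_coef f (j, k) = 0) ->
  cnorm (f z : R[i]) <= hardy_norm f * Num.sqrt (kernel_bound (val z) m n).
Proof.
move=> f0; have := hardy_rect_sum_close f z m n.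
by rewrite rect_sum0// subr0.
Qed.

(** [kernel_bound w 0 0] is twice the squared norm of the reproducing kernel at w, the price of
    bounding a union of strips by a sum. *)
Lemma hardy_value_le f z :
  cnorm (f z : R[i]) <= hardy_norm f * Num.sqrt (kernel_bound (val z) 0 0).
Proof. exact: hardy_value_bound. Qed.

Lemma square_sum_cvg (c : nat -> nat * nat -> R[i]) (d : nat * nat -> R[i]) n :
  (forall p, (fun m => c m p : R[i]^o) @ \oo --> (d p : R[i]^o)) ->
  (fun m => square_sum (c m) n) @ \oo --> square_sum d n.
Proof.
move=> cd; have csum (F : nat -> nat -> R) (G : nat -> R) l :
    (forall j, (fun m => F m j) @ \oo --> G j) ->
    (fun m => \sum_(j < l) F m (nat_of_ord j)) @ \oo --> \sum_(j < l) G (nat_of_ord j).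
  move=> FG; elim: l => [|l IH].
    under eq_cvg do rewrite big_ord0; rewrite big_ord0; exact: cvg_cst.
  by under eq_cvg do rewrite big_ord_recr; rewrite big_ord_recr; apply: cvgD.
apply: (csum (fun m j => \sum_(k < n) cnorm (c m (j, nat_of_ord k)) ^+ 2)
  (fun j => \sum_(k < n) cnorm (d (j, nat_of_ord k)) ^+ 2)) => j.
apply: (csum (fun m k => cnorm (c m (j, k)) ^+ 2) (fun k => cnorm (d (j, k)) ^+ 2)) => k.
by rewrite expr2; under eq_cvg do rewrite expr2; apply: cvgM; exact: (@cvg_cnorm _ R[i]^o _ _ (cd _)).
Qed.

Lemma cnorm_coef_le f p : cnorm (hardy_coef f p) <= hardy_norm f.
Proof.
rewrite -(@ler_pXn2r _ 2) ?nnegrE ?hardy_norm_ge0 ?cnorm_ge0//.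
by rewrite -lee_fin hardy_norm_sqr sq_sum_le.
Qed.

(** The coefficients converge one by one. On a finite block the bound [e n] survives the limit in m,
    and a bound on all finite blocks is a bound on the norm. The limit thus keeps the rate of the
    sequence, which later arguments exploit. *)
Lemma hardy_complete (F : nat -> hardy R) (e : nat -> R) :
  e @ \oo --> (0 : R) ->
  (forall n m, (n <= m)%N -> hardy_norm (F m - F n) <= e n) ->
  exists G, forall n, hardy_norm (G - F n) <= e n.
Proof.
move=> e0 Fe.
have e_ge0 n : 0 <= e n by apply: le_trans (Fe n n (leqnn n)); exact: hardy_norm_ge0.
have d_ex p : exists l : R[i], (fun n => hardy_coef (F n) p : R[i]^o) @ \oo --> (l : R[i]^o).
  have [|l [ul _]] := @cauchy_rate_cvg R (fun n => hardy_coef (F n) p) e e0.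
    move=> n m nm; rewrite -[X in cnorm X]/((hardy_coef (F m) - hardy_coef (F n)) p).
    by rewrite -hardy_coefB (le_trans (cnorm_coef_le _ _))// Fe.
  by exists l.
pose d p := sval (cid (d_ex p)).
have dP p : (fun n => hardy_coef (F n) p : R[i]^o) @ \oo --> (d p : R[i]^o).
  by rewrite /d; case: cid.
have de n N : square_sum (d - hardy_coef (F n)) N <= e n ^+ 2.
  have dc : (fun m => square_sum (hardy_coef (F m) - hardy_coef (F n)) N) @ \oo
      --> square_sum (d - hardy_coef (F n)) N.
    apply: square_sum_cvg => p.
    by apply: cvgB; [exact: dP|exact: cvg_cst].
  rewrite -(cvg_lim (@Rhausdorff R) dc); apply: limr_le; first exact: cvgP dc.
  exists n => // m /= nm; rewrite -hardy_coefB (le_trans (square_sum_hardy _ _))//.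
  by rewrite ler_pXn2r ?nnegrE ?hardy_norm_ge0// Fe.
have dfin : (sq_sum d < +oo)%E.
  rewrite -(subrK (hardy_coef (F 0%N)) d); apply: sq_sumD_fin; last exact: hardy_coef_fin.
  by apply: le_lt_trans (sq_sum_le_bound (de 0%N)) _; rewrite ltry.
have [G Gd] := hardy_exists dfin.
exists G => n; apply: hardy_norm_le => // N.
by rewrite hardy_coefB Gd.
Qed.

Lemma cvg_hardy_value (F : nat -> hardy R) G z :
  (fun n => hardy_norm (G - F n)) @ \oo --> (0 : R) ->
  (fun n => F n z : R[i]^o) @ \oo --> (G z : R[i]^o).
Proof.
move=> FG; apply: (cvg_cnorm_le (e := fun n => hardy_norm (G - F n) * Num.sqrt (kernel_bound (val z) 0 0))).
  by have := cvgMr_tmp (b := Num.sqrt (kernel_bound (val z) 0 0)) FG; rewrite mul0r; apply.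
by move=> n; rewrite cnormBC; exact: (hardy_value_le (G - F n)).
Qed.

End hardy_space.

(** * Pointwise domination *)

Section parseval.
Context {R : realType}.
Implicit Types (c d : nat * nat -> R[i]) (F H : hardy R) (z : bidisk R).

Lemma prim_root_exists n : (0 < n)%N -> exists w : R[i], n.-primitive_root w.
Proof.
move=> n0; have [r pr] := closed_field_poly_normal ('X^n - 1 : {poly R[i]}).
move: pr; rewrite (monicP (monic_Xn_sub_1 _ n0)) scale1r => pr.
have r1 : all n.-unity_root r.
  by apply/allP => x; rewrite -root_prod_XsubC -pr.
have ur : uniq r.
  by rewrite -separable_prod_XsubC -pr separable_Xn_sub_1// pnatr_eq0 -lt0n.
have sr : (n <= size r)%N by rewrite -ltnS -(size_prod_XsubC r id) -pr size_Xn_sub_1.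
by have /hasP[w _ wn] := has_prim_root n0 r1 ur sr; exists w.
Qed.

Lemma cnorm_prim_root n (w : R[i]) : (0 < n)%N -> n.-primitive_root w -> cnorm w = 1.
Proof.
move=> n0 /prim_expr_order wn; apply/eqP.
by rewrite -(@pexpr_eq1 _ _ n) ?cnorm_ge0// -cnormX wn cnorm1.
Qed.

Lemma cnorm_sqrC (x : R[i]) : ((cnorm x ^+ 2)%:C : R[i]) = x * conjc x.
Proof. by rewrite rmorphXn/= cnormE sqr_normc. Qed.

Lemma prim_root_sum n (w : R[i]) j l : n.-primitive_root w -> (j < n)%N -> (l < n)%N ->
  \sum_(a < n) (w ^+ a) ^+ j * conjc ((w ^+ a) ^+ l) = n%:R * (j == l)%:R.
Proof.
move=> wn jn ln; have n0 : (0 < n)%N := leq_ltn_trans (leq0n _) jn.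
have wl0 : w ^+ l != 0.
  by rewrite -cnorm_gt0 cnormX (cnorm_prim_root n0 wn) expr1n ltr01.
have conjV : conjc (w ^+ l) = (w ^+ l)^-1.
  apply: (mulfI wl0); rewrite -cnorm_sqrC divff// cnormX.
  by rewrite (cnorm_prim_root n0 wn) !expr1n.
transitivity (\sum_(a < n) (w ^+ j / w ^+ l) ^+ a).
  apply: eq_bigr => a _; rewrite -!exprM ![(a * _)%N]mulnC !exprM.
  by rewrite rmorphXn/= conjV exprMn.
have [->|jl] := eqVneq j l.
  rewrite divff// mulr1; under eq_bigr do rewrite expr1n.
  by rewrite sumr_const card_ord.
rewrite mulr0; apply/eqP; set y := _ / _.
have y1 : y - 1 != 0.
  rewrite subr_eq0 /y; apply: contraNneq jl => /(canRL (mulfVK wl0)).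
  by rewrite mul1r => /eqP; rewrite (eq_prim_root_expr wn) !modn_small.
rewrite -(mulrI_eq0 _ (mulfI y1)) -subrX1 /y expr_div_n -!exprM.
by rewrite ![(_ * n)%N]mulnC !exprM (prim_expr_order wn) !expr1n divr1 subrr.
Qed.

Lemma dft_parseval n (w : R[i]) (A : nat -> R[i]) : n.-primitive_root w ->
  \sum_(a < n) cnorm (\sum_(j < n) A j * (w ^+ a) ^+ j) ^+ 2 =
    n%:R * \sum_(j < n) cnorm (A j) ^+ 2.
Proof.
move=> wn; apply: complexI; rewrite rmorphM rmorph_nat/= !rmorph_sum/=.
under eq_bigr do rewrite cnorm_sqrC rmorph_sum big_distrlr /=.
rewrite exchange_big/= mulr_sumr; apply: eq_bigr => j _.
rewrite exchange_big/= (bigD1 j)//= [X in _ + X]big1 ?addr0 => [|l lj].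
  under eq_bigr do rewrite rmorphM/= mulrACA.
  by rewrite -mulr_sumr prim_root_sum// eqxx mulr1 cnorm_sqrC mulrC.
under eq_bigr do rewrite rmorphM/= mulrACA.
by rewrite -mulr_sumr prim_root_sum// eq_sym (_ : _ == _ = false) ?mulr0//; apply/negbTE.
Qed.

Definition dilate (r : R) c : nat * nat -> R[i] :=
  fun p => c p * (r%:C) ^+ p.1 * (r%:C) ^+ p.2.

Lemma grid_parseval n (w : R[i]) c (r : R) : n.-primitive_root w ->
  \sum_(a < n) \sum_(b < n)
     cnorm (rect_sum c (r%:C * w ^+ a, r%:C * w ^+ b) n n) ^+ 2 =
  n%:R ^+ 2 * square_sum (dilate r c) n.
Proof.
move=> wn; rewrite exchange_big/=.
transitivity (\sum_(b < n) n%:R * \sum_(j < n)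
    cnorm (\sum_(k < n) dilate r c (nat_of_ord j, nat_of_ord k) * (w ^+ b) ^+ k) ^+ 2).
  apply: eq_bigr => b _; rewrite -(dft_parseval (fun j =>
    \sum_(k < n) dilate r c (j, nat_of_ord k) * (w ^+ b) ^+ k) wn).
  apply: eq_bigr => a _; congr (cnorm _ ^+ 2).
  apply: eq_bigr => j _; rewrite mulr_suml; apply: eq_bigr => k _.
  by rewrite /dilate/= !exprMn; ring.
rewrite -mulr_sumr exchange_big/= /square_sum expr2 -mulrA; congr (_ * _).
rewrite mulr_sumr; apply: eq_bigr => j _.
exact: (dft_parseval (fun k => dilate r c (nat_of_ord j, k)) wn).
Qed.

Lemma square_sum_dilate_le (r : R) c n : 0 <= r -> r <= 1 ->
  square_sum (dilate r c) n <= square_sum c n.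
Proof.
move=> r0 r1; apply: ler_sum => j _; apply: ler_sum => k _.
rewrite ler_pXn2r ?nnegrE ?cnorm_ge0// /dilate/= !cnormM !cnormX cnormR_ge0//.
rewrite -mulrA ler_piMr ?cnorm_ge0// mulr_ile1 ?exprn_ge0 ?exprn_ile1//.
Qed.

(** The crude exponent is harmless: n stays fixed while r tends to 1. *)
Lemma square_sum_dilate_ge (r : R) c n : 0 <= r -> r <= 1 ->
  r ^+ (4 * n) * square_sum c n <= square_sum (dilate r c) n.
Proof.
move=> r0 r1; rewrite /square_sum mulr_sumr; apply: ler_sum => j _.
rewrite mulr_sumr; apply: ler_sum => k _.
rewrite /dilate/= !cnormM !cnormX cnormR_ge0// -mulrA exprMn mulrC.
rewrite ler_wpM2l ?sqr_ge0// -exprD -exprM ler_wiXn2l//.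
by have := ltn_ord j; have := ltn_ord k; lia.
Qed.

(* Parseval for the truncations of F and H on the grid of points (r w^a, r w^b),
   w a primitive N-th root of unity; then N tends to infinity and r to 1. *)
Lemma hardy_norm_le_pointwise F H (M : R) : 0 <= M ->
  (forall z, cnorm (F z : R[i]) <= M * cnorm (H z : R[i])) ->
  hardy_norm F <= M * hardy_norm H.
Proof.
move=> M0 FH; set Y := (M * hardy_norm H) ^+ 2.
have dil (r d : R) K : 0 <= r -> r < 1 -> 0 < d ->
    square_sum (dilate r (hardy_coef F)) K <= (1 + d) * Y.
  move=> r0 r1 d0; pose w0 : R[i] * R[i] := (r%:C, r%:C).
  have nr : cnorm (r%:C : R[i]) < 1 by rewrite cnormR_ge0.
  pose s N := Num.sqrt (kernel_bound w0 N N).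
  pose e N := (hardy_norm F + M * hardy_norm H) * s N.
  have e0 : (fun N => (1 + d) * Y + (1 + d^-1) * (e N * e N)) @ \oo --> (1 + d) * Y.
    have s0 := sqrt_cvg0 (@kernel_bound_cvg0 _ w0 nr nr).
    have ee : e @ \oo --> (0 : R).
      have := cvgMl_tmp (a := hardy_norm F + M * hardy_norm H) s0.
      by rewrite mulr0; apply.
    have := cvgD (cvg_cst ((1 + d) * Y)) (cvgMl_tmp (a := 1 + d^-1) (cvgM ee ee)).
    by rewrite !mulr0 addr0; apply.
  rewrite -(cvg_lim (@Rhausdorff R) e0); apply: limr_ge; first exact: cvgP e0.
  exists K.+1 => // N /= KN; have N0 : (0 < N)%N by apply: leq_ltn_trans KN.
  apply: (le_trans (le_square_sum _ (ltnW KN))).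
  have [w wN] := prim_root_exists N0.
  have w1 := cnorm_prim_root N0 wN.
  have N2 : 0 < (N%:R : R) ^+ 2 by rewrite exprn_gt0// ltr0n.
  rewrite -(ler_pM2l N2) -(grid_parseval _ r wN).
  have sE x : cnorm x = 1 -> cnorm ((r%:C : R[i]) * x) = r.
    by move=> x1; rewrite cnormM x1 mulr1 cnormR_ge0.
  have wX a : cnorm (w ^+ a) = 1 by rewrite cnormX w1 expr1n.
  apply: (@le_trans _ _ (\sum_(a < N) \sum_(b < N) ((1 + d) * M ^+ 2 *
      cnorm (rect_sum (hardy_coef H) (r%:C * w ^+ a, r%:C * w ^+ b) N N) ^+ 2 +
      (1 + d^-1) * (e N * e N)))).
    apply: ler_sum => a _; apply: ler_sum => b _.
    have [z zE] : exists z : bidisk R, val z = (r%:C * w ^+ a, r%:C * w ^+ b).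
      by apply: bidisk_exists => /=; rewrite sE.
    have sz : Num.sqrt (kernel_bound (val z) N N) = s N.
      by rewrite /s /kernel_bound zE/= !sE// cnormR_ge0.
    have := hardy_rect_sum_close F z N N; have := hardy_rect_sum_close H z N N.
    rewrite sz zE; set f := rect_sum _ _ _ _; set h := rect_sum _ _ _ _ => hh ff.
    have fz : cnorm h <= M * cnorm f + e N.
      have fH : cnorm (H z : R[i]) <= cnorm f + hardy_norm H * s N.
        by rewrite -[H z : R[i]](subrK f) (le_trans (ler_cnormD _ _))// [leRHS]addrC lerD2r.
      have := ler_wpM2l M0 fH; rewrite mulrDr mulrA => fH'.
      have := ler_cnormB (F z : R[i]) (F z - h); rewrite subKr => hF.
      have := FH z; move: hh ff hF fH'; rewrite /e mulrDl; lra.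
    have ge0 : 0 <= e N.
      by rewrite mulr_ge0 ?sqrtr_ge0// addr_ge0 ?mulr_ge0 ?hardy_norm_ge0.
    (* Young's inequality (x + y)^2 <= (1 + d) x^2 + (1 + 1/d) y^2: only the truncation error, which
       vanishes as N grows, carries the large factor 1/d. *)
    apply: (@le_trans _ _ ((M * cnorm f + e N) ^+ 2)).
      rewrite ler_pXn2r ?nnegrE ?cnorm_ge0//; apply: addr_ge0 => //.
      by apply: mulr_ge0 => //; exact: cnorm_ge0.
    rewrite -subr_ge0 -mulrA -exprMn; move: (M * _) (e N) => x y.
    rewrite (_ : _ - _ = d^-1 * (d * x - y) ^+ 2); last by field; rewrite gt_eqF.
    by rewrite mulr_ge0 ?sqr_ge0// invr_ge0 ltW.
  under eq_bigr do rewrite big_split/= -mulr_sumr sumr_const card_ord.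
  rewrite big_split/= -mulr_sumr sumr_const card_ord grid_parseval//.
  rewrite -mulrnA -[X in _ + X]mulr_natl natrM -expr2 mulrDr lerD2r.
  rewrite mulrCA ler_pM2l// /Y exprMn -!mulrA.
  rewrite ler_wpM2l//; first by rewrite addr_ge0// ltW.
  do 2! rewrite ler_wpM2l//.
  by apply: le_trans (square_sum_hardy H N); apply: square_sum_dilate_le => //; exact: ltW.
apply: hardy_norm_le; first by rewrite mulr_ge0// hardy_norm_ge0.
move=> K; rewrite -/Y; set X := square_sum _ _.
(* With r = 1 - 1/(n+1) and d = 1/(n+1), a single sequence takes r to 1 and d to 0 together. *)
have h0 := @cvg_harmonic R.
have lhs : (fun n => (1 - harmonic n) ^+ (4 * K) * X) @ \oo --> X.
  have : (fun n => (1 - harmonic n) ^+ (4 * K) : R) @ \oo --> (1 : R).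
    have r1 : (fun n => 1 - harmonic n : R) @ \oo --> (1 : R).
      by have := cvgB (cvg_cst (1 : R)) h0; rewrite subr0; apply.
    elim: (4 * K)%N => [|m IH].
      by under eq_cvg do rewrite expr0; exact: cvg_cst.
    by under eq_cvg do rewrite exprS; have := cvgM r1 IH; rewrite mulr1; apply.
  by move=> /(cvgMr_tmp (b := X)); rewrite mul1r; apply.
have rhs : (fun n => (1 + harmonic n) * Y) @ \oo --> Y.
  have := cvgMr_tmp (b := Y) (cvgD (cvg_cst (1 : R)) h0).
  by rewrite addr0 mul1r; apply.
rewrite -(cvg_lim (@Rhausdorff R) lhs) -(cvg_lim (@Rhausdorff R) rhs).
apply: ler_lim; [exact: cvgP lhs|exact: cvgP rhs|].
exists 0%N => // n _ /=.
have hn0 : 0 < harmonic n :> R by rewrite /harmonic/= invr_gt0 ltr0n.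
have hn1 : harmonic n <= 1 :> R by rewrite /harmonic/= invf_le1 ?ler1n ?ltr0n.
have r0 : 0 <= 1 - harmonic n :> R by rewrite subr_ge0.
have r1 : 1 - harmonic n < 1 :> R by rewrite gtrBl.
by apply: le_trans (dil _ _ K r0 r1 hn0); apply: square_sum_dilate_ge => //; rewrite ltW.
Qed.

End parseval.

(** * Coefficient shifts and multipliers *)

Lemma linear_exists (K : pzRingType) (V W : lmodType K) (f : V -> W) :
  linear f -> exists g : {linear V -> W}, forall x, g x = f x.
Proof.
move=> lf; pose F : {linear V -> W} := HB.pack f (GRing.isLinear.Build K V W *:%R f lf).
by exists F.
Qed.

Section operators_on_hardy.
Context {R : realType}.
Implicit Types (c d : nat * nat -> R[i]) (F G : hardy R) (z : bidisk R).

Lemma hardy_ext F G : (forall z, F z = G z) -> F = G.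
Proof. by move=> FG; apply/val_inj/funext. Qed.

Lemma hardyD F G z : (F + G) z = F z + G z. Proof. by []. Qed.
Lemma hardyZ (a : R[i]) F z : (a *: F) z = a * F z. Proof. by []. Qed.
Lemma hardyB F G z : (F - G) z = F z - G z. Proof. by []. Qed.
Lemma hardy_sum (I : Type) (r : seq I) (P : pred I) (H : I -> hardy R) z :
  (\sum_(i <- r | P i) H i) z = \sum_(i <- r | P i) (H i z : R[i]).
Proof. by apply: (big_morph (fun f : hardy R => f z : R[i])). Qed.

(** The slack [n.+1] accommodates the backward shifts, whose n-block reads coefficients of index
    n. *)
Lemma coefficient_operator (T : (nat * nat -> R[i]) -> nat * nat -> R[i]) :
  linear T -> (forall c n, square_sum (T c) n <= square_sum c n.+1) ->
  exists A : {linear hardy R -> hardy R},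
    (forall F, hardy_coef (A F) = T (hardy_coef F)) /\
    (forall F, hardy_norm (A F) <= hardy_norm F).
Proof.
move=> linT leT.
have Tfin F : (sq_sum (T (hardy_coef F)) < +oo)%E.
  apply: (@le_lt_trans _ _ (hardy_norm F ^+ 2)%:E); last exact: ltry.
  apply: sq_sum_le_bound => n; apply: le_trans (leT _ _) _.
  exact: square_sum_hardy.
pose A F := sval (cid (hardy_exists (Tfin F))).
have AE F : hardy_coef (A F) = T (hardy_coef F) by rewrite /A; case: cid.
have linA : linear A.
  move=> a F G; apply: hardy_coef_inj.
  by rewrite AE !hardy_coefD !hardy_coefZ !AE linT.
have [B BA] := linear_exists linA; exists B; split=> F; rewrite BA//.
apply: hardy_norm_le; first exact: hardy_norm_ge0.
move=> n; rewrite AE; apply: le_trans (leT _ _) _; exact: square_sum_hardy.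
Qed.

Definition shift1 c : nat * nat -> R[i] :=
  fun p => if p.1 is j.+1 then c (j, p.2) else 0.
Definition shift2 c : nat * nat -> R[i] :=
  fun p => if p.2 is k.+1 then c (p.1, k) else 0.
Definition unshift1 c : nat * nat -> R[i] := fun p => c (p.1.+1, p.2).
Definition unshift2 c : nat * nat -> R[i] := fun p => c (p.1, p.2.+1).

Lemma linear_shift1 : linear shift1.
Proof.
move=> a c d; apply/funext => -[[|j] k]; last by [].
by rewrite -[RHS]/(a * 0 + 0) mulr0 addr0.
Qed.

Lemma linear_shift2 : linear shift2.
Proof.
move=> a c d; apply/funext => -[j [|k]]; last by [].
by rewrite -[RHS]/(a * 0 + 0) mulr0 addr0.
Qed.

Lemma linear_unshift1 : linear unshift1. Proof. by []. Qed.
Lemma linear_unshift2 : linear unshift2. Proof. by []. Qed.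

Lemma le_sum_ord_recr (F : nat -> R) n : (forall i, 0 <= F i) ->
  \sum_(i < n) F i <= \sum_(i < n.+1) F i.
Proof. by move=> F0; rewrite big_ord_recr lerDl. Qed.

Lemma le_sum_ord_recl (F : nat -> R) n : (forall i, 0 <= F i) ->
  \sum_(i < n) F i.+1 <= \sum_(i < n.+1) F i.
Proof. by move=> F0; rewrite big_ord_recl lerDr. Qed.

Lemma le_sum_ord_shift (F : nat -> R) n : (forall i, 0 <= F i) ->
  \sum_(i < n) (if nat_of_ord i is j.+1 then F j else 0) <= \sum_(i < n) F i.
Proof.
case: n => [|n] F0; first by rewrite !big_ord0.
by rewrite big_ord_recl add0r le_sum_ord_recr.
Qed.

Let sqr_norm_ge0 c p : 0 <= cnorm (c p) ^+ 2. Proof. exact: sqr_ge0. Qed.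
Let sumr_sqr_ge0 c n j : 0 <= \sum_(k < n) cnorm (c (j, nat_of_ord k)) ^+ 2.
Proof. by apply: sumr_ge0 => k _; exact: sqr_ge0. Qed.

Lemma square_sum_shift1 c n : square_sum (shift1 c) n <= square_sum c n.+1.
Proof.
apply: le_trans (le_square_sum _ (leqnSn n)).
apply: le_trans (le_sum_ord_shift n (sumr_sqr_ge0 c n)).
apply: ler_sum => -[[|j] jn] _ /=; last by [].
by rewrite big1// => k _; rewrite cnorm0 expr0n.
Qed.

Lemma square_sum_shift2 c n : square_sum (shift2 c) n <= square_sum c n.+1.
Proof.
apply: le_trans (le_square_sum _ (leqnSn n)); apply: ler_sum => j _.
apply: le_trans (le_sum_ord_shift n (fun k => sqr_norm_ge0 c (nat_of_ord j, k))).
apply: ler_sum => -[[|k] kn] _ /=; last by [].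
by rewrite cnorm0 expr0n.
Qed.

Lemma square_sum_unshift1 c n : square_sum (unshift1 c) n <= square_sum c n.+1.
Proof.
apply: le_trans (le_sum_ord_recl n (sumr_sqr_ge0 c n.+1)).
apply: ler_sum => j _; exact: (le_sum_ord_recr n (fun k => sqr_norm_ge0 c (j.+1, k))).
Qed.

Lemma square_sum_unshift2 c n : square_sum (unshift2 c) n <= square_sum c n.+1.
Proof.
apply: le_trans (le_sum_ord_recr n (sumr_sqr_ge0 c n.+1)).
apply: ler_sum => j _; exact: (le_sum_ord_recl n (fun k => sqr_norm_ge0 c (nat_of_ord j, k))).
Qed.

Lemma le_kernel_bound (w : R[i] * R[i]) m n m' n' : cnorm w.1 < 1 -> cnorm w.2 < 1 ->
  (m <= m')%N -> (n <= n')%N -> kernel_bound w m' n' <= kernel_bound w m n.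
Proof.
move=> w1 w2 mm nn; rewrite /kernel_bound ler_wpM2r//.
  rewrite invr_ge0; apply: mulr_ge0; rewrite subr_ge0 expr_le1 ?cnorm_ge0 ?ltW//.
by apply: lerD; apply: ler_wiXn2l; rewrite ?sqr_ge0// expr_le1 ?cnorm_ge0 ?ltW.
Qed.

Lemma cvg_rect_sum F z (a b : nat -> nat) : (forall n, (n <= a n)%N) ->
  (forall n, (n <= b n)%N) ->
  (fun n => rect_sum (hardy_coef F) (val z) (a n) (b n) : R[i]^o) @ \oo --> (F z : R[i]^o).
Proof.
move=> an bn; apply: (cvg_cnorm_le (e := fun n => hardy_norm F * Num.sqrt (kernel_bound (val z) n n))).
  have /(cvgMl_tmp (a := hardy_norm F)) := sqrt_cvg0 (kernel_bound_cvg0 (bidisk1 z) (bidisk2 z)).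
  by rewrite mulr0; apply.
move=> n; rewrite cnormBC; apply: (le_trans (hardy_rect_sum_close F z _ _)).
rewrite ler_wpM2l ?hardy_norm_ge0// ler_wsqrtr//.
by apply: le_kernel_bound; rewrite ?bidisk1 ?bidisk2.
Qed.

Lemma rect_sum_shift1 c (w : R[i] * R[i]) m n :
  rect_sum (shift1 c) w m.+1 n = w.1 * rect_sum c w m n.
Proof.
rewrite /rect_sum big_ord_recl big1 ?add0r => [|k _]; last by rewrite !mul0r.
rewrite mulr_sumr; apply: eq_bigr => j _; rewrite mulr_sumr; apply: eq_bigr => k _.
by rewrite exprS /shift1/=; ring.
Qed.

Lemma rect_sum_shift2 c (w : R[i] * R[i]) m n :
  rect_sum (shift2 c) w m n.+1 = w.2 * rect_sum c w m n.
Proof.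
rewrite /rect_sum mulr_sumr; apply: eq_bigr => j _.
rewrite big_ord_recl !mul0r add0r mulr_sumr; apply: eq_bigr => k _.
by rewrite exprS /shift2/=; ring.
Qed.

Lemma shift1_value F G : hardy_coef G = shift1 (hardy_coef F) ->
  forall z, G z = (val z).1 * F z.
Proof.
move=> GF z; have FF := @cvg_rect_sum F z id id (fun=> leqnn _) (fun=> leqnn _).
have GG := @cvg_rect_sum G z succn id (fun n => leqnSn n) (fun=> leqnn _).
apply: (cvg_unique_c GG); under eq_cvg do rewrite GF rect_sum_shift1.
exact: cvgMl_c FF.
Qed.

Lemma shift2_value F G : hardy_coef G = shift2 (hardy_coef F) ->
  forall z, G z = (val z).2 * F z.
Proof.
move=> GF z; have FF := @cvg_rect_sum F z id id (fun=> leqnn _) (fun=> leqnn _).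
have GG := @cvg_rect_sum G z id succn (fun=> leqnn _) (fun n => leqnSn n).
apply: (cvg_unique_c GG); under eq_cvg do rewrite GF rect_sum_shift2.
exact: cvgMl_c FF.
Qed.

(** Fixed point of the affine contraction G |-> F + p T G, iterated from 0. The iterates stay in the
    ball of radius M = |F| / (1 - p), which starts the geometric rate [e n]. Forward shifts yield
    geometric multipliers this way, and backward shifts yield division by a Blaschke factor. *)
Lemma neumann_series (T : {linear hardy R -> hardy R}) (p : R) F :
  (forall G, hardy_norm (T G) <= hardy_norm G) -> 0 <= p -> p < 1 ->
  exists G, G - p%:C *: T G = F.
Proof.
move=> T1 p0 p1; pose u n := iter n (fun G => F + p%:C *: T G) 0.
have q0 : 0 < 1 - p by rewrite subr_gt0.
pose M := hardy_norm F / (1 - p).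
have M0 : 0 <= M by rewrite divr_ge0 ?hardy_norm_ge0// ltW.
have pT G H : hardy_norm (p%:C *: T G - p%:C *: T H) <= p * hardy_norm (G - H).
  by rewrite -scalerBr -linearB hardy_normZ cnormR_ge0// ler_wpM2l.
have uM n : hardy_norm (u n) <= M.
  elim: n => [|n IH]; first by rewrite hardy_norm0.
  rewrite /u iterS -/(u n) (le_trans (ler_hardy_normD _ _))//.
  rewrite (_ : M = hardy_norm F + p * M); last by rewrite /M; field; rewrite gt_eqF.
  rewrite lerD2l hardy_normZ cnormR_ge0// ler_wpM2l// (le_trans (T1 _))//.
pose e n := p ^+ n * M.
have ue n m : (n <= m)%N -> hardy_norm (u m - u n) <= e n.
  elim: n m => [|n IH] [|m]//; rewrite /e ?expr0 ?mul1r; try by rewrite subr0.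
  rewrite ltnS => nm; rewrite /u !iterS -!/(u _).
  rewrite [X in hardy_norm X](_ : _ = p%:C *: T (u m) - p%:C *: T (u n)); last first.
    by rewrite opprD addrACA subrr add0r.
  by rewrite (le_trans (pT _ _))// exprS -mulrA ler_wpM2l// IH.
have e0 : e @ \oo --> (0 : R).
  by have := cvgMr_tmp (b := M) (cvg_exprR p0 p1); rewrite mul0r; apply.
have [G GP] := hardy_complete e0 ue.
exists G; apply/eqP; rewrite -subr_eq0; apply/eqP/hardy_norm0_eq0/eqP.
rewrite eq_le hardy_norm_ge0 andbT.
(* The defect of G equals (G - u n.+1) - p T (G - u n), which is bounded by this null sequence. *)
have e20 : (fun n => e n.+1 + p * e n) @ \oo --> (0 : R).
  have e1 : (fun n => e n.+1) @ \oo --> (0 : R) by rewrite (cvg_shiftS e).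
  have := cvgD e1 (cvgMl_tmp (a := p) e0).
  by rewrite mulr0 addr0; apply.
rewrite -(cvg_lim (@Rhausdorff R) e20); apply: limr_ge; first exact: cvgP e20.
exists 0%N => // n _ /=.
have -> : G - p%:C *: T G - F = (G - u n.+1) - (p%:C *: T G - p%:C *: T (u n)).
  by rewrite /u iterS -/(u n) opprD opprB !addrA subrK addrAC.
rewrite -hardy_cnormE (le_trans (ler_cnormB _ _))// !hardy_cnormE lerD//.
by rewrite (le_trans (pT _ _))// ler_wpM2l.
Qed.

End operators_on_hardy.

Section multipliers.
Context {R : realType}.
Implicit Types (F G H : hardy R) (z : bidisk R) (g : bidisk R -> R[i]).

(** No norm is recorded: a pointwise bound on g turns into an operator bound through
    [hardy_norm_le_pointwise]. *)
Definition multiplier g := forall F, exists G, forall z, G z = g z * F z.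

Lemma eq_multiplier g g' : g =1 g' -> multiplier g -> multiplier g'.
Proof.
by move=> gg gm F; have [G GF] := gm F; exists G => z; rewrite GF gg.
Qed.

Lemma multiplier_cst (a : R[i]) : multiplier (fun=> a).
Proof. by move=> F; exists (a *: F). Qed.

Lemma multiplierD g g' : multiplier g -> multiplier g' ->
  multiplier (fun z => g z + g' z).
Proof.
move=> gm gm' F; have [G GF] := gm F; have [G' GF'] := gm' F.
by exists (G + G') => z; rewrite hardyD GF GF' mulrDl.
Qed.

Lemma multiplierM g g' : multiplier g -> multiplier g' ->
  multiplier (fun z => g z * g' z).
Proof.
move=> gm gm' F; have [G' GF'] := gm' F; have [G GF] := gm G'.
by exists G => z; rewrite GF GF' mulrA.
Qed.

Lemma multiplierB g g' : multiplier g -> multiplier g' ->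
  multiplier (fun z => g z - g' z).
Proof.
move=> gm gm'; apply: eq_multiplier (multiplierD gm (multiplierM (multiplier_cst (-1)) gm')).
by move=> z; rewrite mulN1r.
Qed.

Lemma multiplierX g n : multiplier g -> multiplier (fun z => g z ^+ n).
Proof.
move=> gm; elim: n => [|n IH]; first exact: multiplier_cst.
by apply: eq_multiplier (multiplierM gm IH) => z; rewrite exprS.
Qed.

Lemma multiplier_sum (I : Type) (r : seq I) (P : pred I) (h : I -> bidisk R -> R[i]) :
  (forall i, P i -> multiplier (h i)) -> multiplier (fun z => \sum_(i <- r | P i) h i z).
Proof.
move=> hm; elim: r => [|i r IH].
  by apply: eq_multiplier (multiplier_cst 0) => z; rewrite big_nil.
have [Pi|Pi] := boolP (P i); last by apply: eq_multiplier IH => z; rewrite big_cons (negbTE Pi).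
by apply: eq_multiplier (multiplierD (hm i Pi) IH) => z; rewrite big_cons Pi.
Qed.

Lemma multiplier_prod (I : Type) (r : seq I) (P : pred I) (h : I -> bidisk R -> R[i]) :
  (forall i, P i -> multiplier (h i)) -> multiplier (fun z => \prod_(i <- r | P i) h i z).
Proof.
move=> hm; elim: r => [|i r IH].
  by apply: eq_multiplier (multiplier_cst 1) => z; rewrite big_nil.
have [Pi|Pi] := boolP (P i); last by apply: eq_multiplier IH => z; rewrite big_cons (negbTE Pi).
by apply: eq_multiplier (multiplierM (hm i Pi) IH) => z; rewrite big_cons Pi.
Qed.

Lemma multiplier_z1 : multiplier (fun z => (val z).1).
Proof.
have [S [SE _]] := coefficient_operator (@linear_shift1 R) (@square_sum_shift1 R).
by move=> F; exists (S F); apply: shift1_value.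
Qed.

Lemma multiplier_z2 : multiplier (fun z => (val z).2).
Proof.
have [S [SE _]] := coefficient_operator (@linear_shift2 R) (@square_sum_shift2 R).
by move=> F; exists (S F); apply: shift2_value.
Qed.

Lemma geometric_denom_neq0 (p : R) (w : R[i]) : 0 <= p -> p <= 1 -> cnorm w < 1 ->
  1 - p%:C * w != 0.
Proof.
move=> p0 p1 w1; rewrite subr_eq0; apply: contraTneq w1 => /(congr1 (@cnorm R _)).
rewrite cnorm1 cnormM cnormR_ge0// -leNgt => h.
have := cnorm_ge0 (w : R[i]); nra.
Qed.

Lemma resolvent_factor (a b x : R[i]) : x - a * (b * x) = (1 - a * b) * x.
Proof. by ring. Qed.

Lemma multiplier_geometric (p : R) : 0 <= p -> p < 1 ->
  multiplier (fun z => (1 - p%:C * (val z).1)^-1).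
Proof.
move=> p0 p1 F.
have [S [SE S1]] := coefficient_operator (@linear_shift1 R) (@square_sum_shift1 R).
have [G GF] := neumann_series F S1 p0 p1.
exists G => z; rewrite -GF hardyB hardyZ (shift1_value (SE G)) resolvent_factor.
by rewrite mulKf// geometric_denom_neq0 ?(ltW p1) ?bidisk1.
Qed.

Lemma multiplier_operator g : multiplier g ->
  exists A : {linear hardy R -> hardy R}, forall F z, A F z = g z * F z.
Proof.
move=> gm; pose A F := sval (cid (gm F)).
have AE F z : A F z = g z * F z by rewrite /A; case: cid.
have linA : linear A.
  move=> a F G; apply: hardy_ext => z.
  by rewrite hardyD hardyZ !AE hardyD hardyZ mulrDr mulrCA.
by have [B BA] := linear_exists linA; exists B => F z; rewrite BA AE.
Qed.

(** The rate is uniform in z, so pointwise domination makes h n F a Cauchy sequence in norm; norm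
    limits are pointwise limits. *)
Lemma multiplier_lim (h : nat -> bidisk R -> R[i]) g (e : nat -> R) :
  (forall n, multiplier (h n)) -> e @ \oo --> (0 : R) ->
  (forall n m z, (n <= m)%N -> cnorm (h m z - h n z) <= e n) ->
  (forall z, (fun n => h n z : R[i]^o) @ \oo --> (g z : R[i]^o)) ->
  multiplier g.
Proof.
move=> hm e0 he hg F; pose u n := sval (cid (hm n F)).
have uE n z : u n z = h n z * F z by rewrite /u; case: cid.
have [z0 _] : exists z : bidisk R, val z = ((0, 0) : R[i] * R[i]).
  by apply: bidisk_exists; rewrite /= cnorm0.
have e_ge0 n : 0 <= e n by apply: le_trans (he n n z0 (leqnn n)); exact: cnorm_ge0.
pose e' n := e n * hardy_norm F.
have e'0 : e' @ \oo --> (0 : R).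
  by have := cvgMr_tmp (b := hardy_norm F) e0; rewrite mul0r; apply.
have ue n m : (n <= m)%N -> hardy_norm (u m - u n) <= e' n.
  move=> nm; apply: hardy_norm_le_pointwise => // z.
  by rewrite hardyB !uE -mulrBl cnormM ler_wpM2r ?cnorm_ge0// he.
have [G GP] := hardy_complete e'0 ue.
exists G => z.
have Gz : (fun n => u n z : R[i]^o) @ \oo --> (G z : R[i]^o).
  apply: cvg_hardy_value; apply: (squeeze_cvgr _ (cvg_cst 0) e'0).
  by apply: nearW => n; rewrite hardy_norm_ge0 GP.
apply: (cvg_unique_c Gz); under eq_cvg do rewrite uE mulrC.
by rewrite mulrC; exact: cvgMl_c (hg z).
Qed.

Lemma hardy_one_exists : exists F : hardy R,
  hardy_coef F = (fun p => (p == (0, 0)%N)%:R) /\ forall z, F z = 1.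
Proof.
pose c (p : nat * nat) : R[i] := (p == (0, 0)%N)%:R.
have sq n : square_sum c n <= 1.
  case: n => [|n]; first by rewrite /square_sum big_ord0.
  rewrite /square_sum big_ord_recl [X in _ + X]big1 => [|j _]; last first.
    by rewrite big1// => k _; rewrite /c cnorm0 expr0n.
  rewrite big_ord_recl big1 => [|k _]; last by rewrite /c cnorm0 expr0n.
  by rewrite /c cnorm1 expr1n !addr0.
have [|F Fc] := @hardy_exists R c.
  by apply: le_lt_trans (sq_sum_le_bound sq) _; rewrite ltry.
exists F; split=> // z.
have FF := @cvg_rect_sum R F z succn succn (fun n => leqnSn n) (fun n => leqnSn n).
apply: (cvg_unique_c FF); apply: (cvg_cnorm_le (e := fun=> 0)); first exact: cvg_cst.
move=> n; rewrite Fc /rect_sum big_ord_recl [X in _ + X - _]big1 => [|j _]; last first.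
  by rewrite big1// => k _; rewrite /c !mul0r.
rewrite big_ord_recl big1 => [|k _]; last by rewrite /c !mul0r.
by rewrite /c !expr0 !mulr1 !addr0 subrr cnorm0.
Qed.

Lemma multiplier_hardy g : multiplier g -> exists G, forall z, G z = g z.
Proof.
have [E [_ E1]] := hardy_one_exists.
by move=> gm; have [G GE] := gm E; exists G => z; rewrite GE E1 mulr1.
Qed.

(** From G = 1 + p z1 G, every block sum X of squares satisfies X <= 1 + p^2 X. The sharp constant
    matters: the Neumann bound 1 / (1 - p) would leave no decay for the building blocks of the
    majorant. *)
Lemma hardy_geometric (p : R) : 0 <= p -> p < 1 ->
  exists G, (forall z, G z = (1 - p%:C * (val z).1)^-1) /\
    hardy_norm G ^+ 2 <= (1 - p ^+ 2)^-1.
Proof.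
move=> p0 p1; have [E [Ec E1]] := hardy_one_exists.
have [S [SE S1]] := coefficient_operator (@linear_shift1 R) (@square_sum_shift1 R).
have [G GE] := neumann_series E S1 p0 p1.
have p21 : p ^+ 2 < 1 by rewrite expr_lt1.
exists G; split=> [z|].
  have := E1 z; rewrite -GE hardyB hardyZ (shift1_value (SE G)) resolvent_factor.
  move=> h; apply: (mulfI (geometric_denom_neq0 p0 (ltW p1) (bidisk1 z))).
  by rewrite h divff// geometric_denom_neq0 ?(ltW p1) ?bidisk1.
have cG : hardy_coef G = (fun q => (q == (0, 0)%N)%:R) + p%:C *: shift1 (hardy_coef G).
  by rewrite -Ec -SE -hardy_coefZ -hardy_coefD -[in RHS]GE subrK.
have cGE q : hardy_coef G q = (q == (0, 0)%N)%:R + p%:C * shift1 (hardy_coef G) q.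
  by rewrite {1}cG.
have step n : square_sum (hardy_coef G) n.+1 <= 1 + p ^+ 2 * square_sum (hardy_coef G) n.+1.
  rewrite {1}/square_sum big_ord_recl.
  have -> : \sum_(k < n.+1) cnorm (hardy_coef G (nat_of_ord (ord0 : 'I_n.+1), nat_of_ord k)) ^+ 2 = 1.
    rewrite big_ord_recl big1 => [|k _].
      by rewrite cGE /= mulr0 !addr0 mulr1n cnorm1 expr1n.
    by rewrite cGE /= mulr0 addr0 cnorm0 expr0n.
  rewrite lerD2l /square_sum mulr_sumr.
  apply: (@le_trans _ _ (\sum_(j < n) p ^+ 2 * \sum_(k < n.+1) cnorm (hardy_coef G (nat_of_ord j, nat_of_ord k)) ^+ 2)).
    apply: ler_sum => j _; rewrite mulr_sumr; apply: ler_sum => k _.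
    by rewrite cGE /= add0r cnormM exprMn cnormR_ge0.
  rewrite big_ord_recr/= lerDl mulr_ge0 ?sqr_ge0//.
  by apply: sumr_ge0 => k _; rewrite sqr_ge0.
have pi0 : 0 <= (1 - p ^+ 2)^-1 by rewrite invr_ge0 subr_ge0 ltW.
rewrite -[leRHS](sqr_sqrtr pi0) ler_pXn2r ?nnegrE ?hardy_norm_ge0 ?sqrtr_ge0//.
apply: hardy_norm_le; rewrite ?sqrtr_ge0// => n; rewrite sqr_sqrtr//.
apply: le_trans (le_square_sum _ (leqnSn n)) _.
by rewrite -[leRHS]mul1r ler_pdivlMr ?subr_gt0//; have := step n; lra.
Qed.

End multipliers.

(** * Division by Blaschke factors *)

Section blaschke_division.
Context {R : realType}.
Implicit Types (F G H : hardy R) (z : bidisk R).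

Lemma hardy_coef0 : hardy_coef (0 : hardy R) = 0.
Proof. by rewrite -(scale0r (0 : hardy R)) hardy_coefZ scale0r. Qed.

Lemma hardy_norm_approx F (e : R) : 0 < e -> exists N, forall n, (N <= n)%N ->
  hardy_norm F ^+ 2 - e <= square_sum (hardy_coef F) n.
Proof.
move=> e0; have [e1|e1] := leP (hardy_norm F ^+ 2 - e) 0.
  exists 0%N => n _; apply: le_trans e1 _; rewrite /square_sum.
  by apply: sumr_ge0 => j _; apply: sumr_ge0 => k _; exact: sqr_ge0.
have [[N FN]|noN] := pselect (exists N, hardy_norm F ^+ 2 - e <= square_sum (hardy_coef F) N).
  by exists N => n Nn; apply: le_trans FN (le_square_sum _ Nn).
have : hardy_norm F <= Num.sqrt (hardy_norm F ^+ 2 - e).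
  apply: hardy_norm_le; rewrite ?sqrtr_ge0// => n; rewrite sqr_sqrtr ?ltW//.
  by rewrite ltNge; apply/negP => h; apply: noN; exists n.
rewrite -(@ler_pXn2r _ 2) ?nnegrE ?hardy_norm_ge0 ?sqrtr_ge0// (sqr_sqrtr (ltW e1)).
by move: (hardy_norm F ^+ 2) => x ?; exfalso; lra.
Qed.

Definition one_variable F := forall j k, hardy_coef F (j, k.+1) = 0.

Definition blaschke (p : R) (w : R[i]) : R[i] := (w - p%:C) / (1 - p%:C * w).

Lemma sqr_cnorm_swap (p : R) (a b : R[i]) :
  cnorm (a - p%:C * b) ^+ 2 =
  cnorm (b - p%:C * a) ^+ 2 + (1 - p ^+ 2) * (cnorm a ^+ 2 - cnorm b ^+ 2).
Proof.
rewrite !cnorm_sqr; case: a b => [a1 a2] [b1 b2].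
by rewrite !(cReB, cImB, cReM, cImM)/=; ring.
Qed.

(* With S* the backward shift and G - p S*G = F, the operator is D F = S*G - p G;
   [sqr_cnorm_swap] on coefficients makes it a contraction. *)
Lemma blaschke_divide (p : R) : 0 <= p -> p < 1 ->
  exists D : {linear hardy R -> hardy R},
    (forall F, hardy_norm (D F) <= hardy_norm F) /\
    forall F, one_variable F -> one_variable (D F) /\ exists a : R[i], forall z,
      F z = blaschke p (val z).1 * D F z + a * (1 - p%:C * (val z).1)^-1.
Proof.
move=> p0 p1.
have [S [SE _]] := coefficient_operator (@linear_shift1 R) (@square_sum_shift1 R).
have [B [BE B1]] := coefficient_operator (@linear_unshift1 R) (@square_sum_unshift1 R).
have [B2 [B2E _]] := coefficient_operator (@linear_unshift2 R) (@square_sum_unshift2 R).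
(* B is a contraction and p < 1. This uniqueness makes the chosen solution G linear in F, and lets
   it inherit from F the absence of the second variable. *)
have injB H : H - p%:C *: B H = 0 -> H = 0.
  move=> /eqP; rewrite subr_eq0 => /eqP HB; apply: hardy_norm0_eq0; apply/eqP.
  have : hardy_norm H <= p * hardy_norm H.
    by rewrite {1}HB hardy_normZ cnormR_ge0// ler_wpM2l.
  rewrite -subr_le0 -[X in X - _]mul1r -mulrBl pmulr_rle0 ?subr_gt0// => h.
  by rewrite eq_le h hardy_norm_ge0.
pose G F := sval (cid (neumann_series F B1 p0 p1)).
have GE F : G F - p%:C *: B (G F) = F by rewrite /G; case: cid.
have linL : linear (fun H => H - p%:C *: B H).
  move=> a F H; rewrite /= (linearP B) !scalerDr scalerN opprD addrACA !scalerA.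
  by rewrite [a * _]mulrC.
have [L LE] := linear_exists linL.
have linG : linear G.
  move=> a F H; apply/eqP; rewrite -subr_eq0; apply/eqP/injB.
  by rewrite -LE linearB linearP !LE !GE subrr.
have [G' G'E] := linear_exists linG.
have linD : linear (fun F => B (G' F) - p%:C *: G' F).
  move=> a F H; rewrite /= !(linearP G') (linearP B) !scalerDr scalerN opprD addrACA !scalerA.
  by rewrite [a * _]mulrC.
have [D DE] := linear_exists linD; exists D.
have coefD F q : hardy_coef (D F) q =
    hardy_coef (G F) (q.1.+1, q.2) - p%:C * hardy_coef (G F) q.
  by rewrite DE G'E hardy_coefB hardy_coefZ BE.
have coefF F q : hardy_coef F q =
    hardy_coef (G F) q - p%:C * hardy_coef (G F) (q.1.+1, q.2).
  by rewrite -{1}(GE F) hardy_coefB hardy_coefZ BE.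
split=> F.
  apply: hardy_norm_le; first exact: hardy_norm_ge0.
  move=> n; apply/ler_addgt0Pr => e e0.
  (* The identity leaves the block sum of B G minus that of G. It may be positive, as the block of B
     G reads one row further, but it is at most e once the block of G nearly exhausts its norm. *)
  have [N NP] := hardy_norm_approx (G F) e0.
  pose m := maxn n N; apply: le_trans (le_square_sum _ (leq_maxl n N)) _; rewrite -/m.
  have -> : square_sum (hardy_coef (D F)) m = square_sum (hardy_coef F) m +
      (1 - p ^+ 2) * (square_sum (hardy_coef (B (G F))) m - square_sum (hardy_coef (G F)) m).
    rewrite /square_sum -sumrB mulr_sumr -big_split/=; apply: eq_bigr => j _.
    rewrite -sumrB mulr_sumr -big_split/=; apply: eq_bigr => k _.
    by rewrite (coefD F) (coefF F) BE sqr_cnorm_swap.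
  rewrite lerD ?square_sum_hardy//.
  have h1 : square_sum (hardy_coef (B (G F))) m <= hardy_norm (G F) ^+ 2.
    by apply: le_trans (square_sum_hardy _ _) _; rewrite ler_pXn2r ?nnegrE ?hardy_norm_ge0.
  have h2 := NP _ (leq_maxr n N : (N <= m)%N).
  have q0 : 0 <= 1 - p ^+ 2 by rewrite subr_ge0 expr_le1// ltW.
  have q1 : 1 - p ^+ 2 <= 1 by rewrite gerBl sqr_ge0.
  nra.
move=> F1; have G1 : one_variable (G F).
  have : B2 (G F) = 0.
    apply: injB; rewrite (_ : B (B2 _) = B2 (B (G F))); last first.
      by apply: hardy_coef_inj; rewrite BE !B2E BE.
    rewrite -linearZ/= -linearB/= GE; apply: hardy_coef_inj; rewrite B2E.
    by apply/funext => -[j k]; rewrite /unshift2/= F1 hardy_coef0.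
  move=> /(congr1 (@hardy_coef R)); rewrite B2E => h j k.
  by have := congr1 (fun c => c (j, k)) h; rewrite hardy_coef0.
split=> [j k|]; first by rewrite coefD/= !G1 mulr0 subrr.
have [E [Ec E1]] := @hardy_one_exists R.
pose a := hardy_coef (G F) (0, 0)%N.
have G0 : G F - S (B (G F)) = a *: E.
  apply: hardy_coef_inj; rewrite hardy_coefB hardy_coefZ SE BE Ec.
  apply/funext => -[[|j] k].
    rewrite -[LHS]/(hardy_coef (G F) (0, k)%N - 0) -[RHS]/(a * _) subr0.
    by case: k => [|k]; rewrite ?G1 ?mulr0// mulr1.
  by rewrite -[LHS]/(hardy_coef (G F) (j.+1, k) - hardy_coef (G F) (j.+1, k)) -[RHS]/(a * 0) subrr mulr0.
(* Here g = a + z1 s, F = g - p s and D F = s - p g, so (1 - p z1) F - (z1 - p) D F = (1 - p^2) (g -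
   z1 s) = (1 - p^2) a. *)
exists (a * (1 - p%:C ^+ 2)) => z; rewrite DE G'E hardyB hardyZ.
have : G F z - S (B (G F)) z = a by rewrite -hardyB G0 hardyZ E1 mulr1.
rewrite (shift1_value (SE _)); set g := G F z; set s := B (G F) z => ga.
have Fz : F z = g - p%:C * s by rewrite /g /s -hardyZ -hardyB GE.
rewrite Fz /blaschke -ga.
set x := (val z).1; have := geometric_denom_neq0 p0 (ltW p1) (bidisk1 z).
by rewrite -/x; move: x g s {ga Fz} => x g s d0; field.
Qed.

Lemma cnorm_blaschke (p : R) (w : R[i]) : 0 <= p -> p < 1 -> cnorm w < 1 ->
  1 - cnorm (blaschke p w) ^+ 2 =
  (1 - p ^+ 2) * (1 - cnorm w ^+ 2) / cnorm (1 - p%:C * w) ^+ 2.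
Proof.
move=> p0 p1 w1; have d0 := geometric_denom_neq0 p0 (ltW p1) w1.
rewrite /blaschke cnorm_div expr_div_n.
have D0 : cnorm (1 - p%:C * w) ^+ 2 != 0 by rewrite expf_neq0// gt_eqF// cnorm_gt0.
apply: (mulIf D0); rewrite mulrBl mul1r !divfK//.
rewrite !cnorm_sqr; case: w {w1 d0 D0} => a b.
by rewrite !(cReB, cImB, cReM, cImM)/=; ring.
Qed.

Lemma cnorm_blaschke_le1 (p : R) (w : R[i]) : 0 <= p -> p < 1 -> cnorm w < 1 ->
  cnorm (blaschke p w) <= 1.
Proof.
move=> p0 p1 w1; rewrite -(@ler_pXn2r _ 2) ?nnegrE ?cnorm_ge0// expr1n.
rewrite -subr_ge0 cnorm_blaschke// divr_ge0 ?sqr_ge0// mulr_ge0//.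
  by rewrite subr_ge0 expr_le1// ltW.
by rewrite subr_ge0 expr_le1 ?cnorm_ge0// ltW.
Qed.

Lemma multiplier_blaschke (p : R) : 0 <= p -> p < 1 ->
  multiplier (fun z => blaschke p (val z).1).
Proof.
move=> p0 p1; apply: multiplierM (multiplier_geometric p0 p1).
exact: multiplierB multiplier_z1 (multiplier_cst _).
Qed.

(** Division peels off one zero at a time: F = b D F + a K gives F - b T (D F) = b (D F - T (D F)) +
    a K, one more dimension per zero. Repetitions in [ps] are multiplicities. *)
Lemma blaschke_residual (ps : seq R) : (forall p, p \in ps -> 0 <= p < 1) ->
  exists T : {linear hardy R -> hardy R},
    [/\ forall F, hardy_norm (T F) <= hardy_norm F,
        forall F z, cnorm (T F z : R[i]) <=
          (\prod_(p <- ps) cnorm (blaschke p (val z).1)) *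
          (hardy_norm F * Num.sqrt (kernel_bound (val z) 0 0))
      & exists e : 'I_(size ps) -> hardy R, forall F, one_variable F ->
          exists a : 'I_(size ps) -> R[i], F - T F = \sum_i a i *: e i].
Proof.
elim: ps => [|p ps IH] ps1.
  exists idfun; split=> //= [F z|].
    by rewrite big_nil mul1r hardy_value_le.
  by exists (fun=> 0) => F _; exists (fun=> 0); rewrite subrr big_ord0.
have [|T [T1 TB [e Te]]] := IH.
  by move=> q qps; apply: ps1; rewrite inE qps orbT.
have /andP[p0 p1] := ps1 p (mem_head _ _).
have [D [D1 DE]] := blaschke_divide p0 p1.
have [M ME] := multiplier_operator (multiplier_blaschke p0 p1).
have [K KE] := multiplier_hardy (multiplier_geometric p0 p1).
have linT : linear (fun F => M (T (D F))) by move=> a F H; rewrite !linearP.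
have [T' T'E] := linear_exists linT; exists T'; split=> [F|F z|].
- rewrite T'E; apply: le_trans (D1 F); apply: le_trans (T1 _).
  rewrite -[leRHS]mul1r; apply: hardy_norm_le_pointwise => // z.
  by rewrite ME cnormM ler_wpM2r ?cnorm_ge0// cnorm_blaschke_le1// bidisk1.
- rewrite T'E ME cnormM big_cons -mulrA ler_wpM2l ?cnorm_ge0//.
  apply: le_trans (TB _ _) _; rewrite ler_wpM2l//.
    by apply: prodr_ge0 => q _; exact: cnorm_ge0.
  by rewrite ler_wpM2r ?sqrtr_ge0.
- exists (fun i => if unlift ord0 i is Some j then M (e j) else K) => F F1.
  have [DF1 [c Fc]] := DE F F1; have [a aE] := Te _ DF1.
  exists (fun i => if unlift ord0 i is Some j then a j else c).
  rewrite big_ord_recl unlift_none; under eq_bigr do rewrite liftK.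
  under eq_bigr do rewrite -linearZ/=.
  rewrite -linear_sum/= -aE; apply: hardy_ext => z.
  by rewrite T'E hardyB hardyD hardyZ KE !ME hardyB (Fc z); ring.
Qed.

End blaschke_division.

(** * The cusp function *)

Section columns.
Context {R : realType}.
Implicit Types (F G H : hardy R) (z : bidisk R).

(** [V k] is the k-th power of the backward shift B in the second variable, and [U k] is V k - S V
    (k+1) with S the forward shift, so the expansion telescopes. The constant 2 is the triangle
    inequality. *)
Lemma column_split : exists U V : nat -> {linear hardy R -> hardy R},
  [/\ forall k F, hardy_norm (U k F) <= 2 * hardy_norm F,
      forall k F, hardy_norm (V k F) <= hardy_norm F,
      forall k F, one_variable (U k F)
    & forall n F z, F z = \sum_(k < n) (val z).2 ^+ k * U k F z + (val z).2 ^+ n * V n F z].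
Proof.
have [S [SE S1]] := coefficient_operator (@linear_shift2 R) (@square_sum_shift2 R).
have [B [BE B1]] := coefficient_operator (@linear_unshift2 R) (@square_sum_unshift2 R).
have linV k : linear (fun F => iter k B F).
  by elim: k => [|k IH] a F G //=; rewrite -linearP -IH.
pose V k := sval (cid (linear_exists (linV k))).
have VE k F : V k F = iter k B F by rewrite /V; case: cid.
have linU k : linear (fun F => V k F - S (V k.+1 F)).
  by move=> a F G; rewrite /= !(linearP (V _)) (linearP S) scalerBr opprD addrACA.
pose U k := sval (cid (linear_exists (linU k))).
have UE k F : U k F = V k F - S (V k.+1 F) by rewrite /U; case: cid.
have V1 k F : hardy_norm (V k F) <= hardy_norm F.
  rewrite VE; elim: k => [|k IH] //=; exact: le_trans (B1 _) IH.
exists U, V; split=> // [k F|k F j l|n F z].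
- rewrite UE -hardy_cnormE (le_trans (ler_cnormB _ _))// !hardy_cnormE.
  rewrite mulr_natl mulr2n lerD//; apply: le_trans (S1 _) _; exact: V1.
- rewrite UE hardy_coefB SE !VE iterS BE.
  by rewrite -[LHS]/(hardy_coef (iter k B F) (j, l.+1) - hardy_coef (iter k B F) (j, l.+1)) subrr.
- elim: n => [|n IH]; first by rewrite big_ord0 add0r expr0 mul1r VE.
  rewrite big_ord_recr/= {1}IH -addrA; congr (_ + _).
  rewrite UE hardyB (shift2_value (SE _)) exprSr; ring.
Qed.

End columns.

(** * The series v and its size at each scale *)

Section cusp.
Context {R : realType}.
Implicit Types (x : R[i]) (i n m : nat).

Definition knot i : R := 64^-1 ^+ (2 ^ i).
(** The factor 2^-7 keeps v so small that 2 Re v beats |v|^2 in [phi_scale]. *)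
Definition weight i : R := 2^-1 ^+ (i + 7).
Definition cusp_term i x : R[i] := x / (x + (knot i)%:C).
Definition cusp_sum n x : R[i] := \sum_(i < n) (weight i)%:C * cusp_term i x.
Definition cusp x : R[i] := lim ((cusp_sum ^~ x : nat -> R[i]^o) @ \oo).

Lemma knot_gt0 i : 0 < knot i.
Proof. by rewrite exprn_gt0// invr_gt0 ltr0n. Qed.

Lemma weight_gt0 i : 0 < weight i.
Proof. by rewrite exprn_gt0// invr_gt0 ltr0n. Qed.

Lemma knot_ge0 i : 0 <= knot i. Proof. exact/ltW/knot_gt0. Qed.
Lemma weight_ge0 i : 0 <= weight i. Proof. exact/ltW/weight_gt0. Qed.

Lemma weightS i : weight i.+1 = weight i / 2.
Proof. by rewrite /weight addSn exprSr. Qed.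

Lemma weight_cvg0 : (fun n => weight n) @ \oo --> (0 : R).
Proof.
rewrite (_ : (fun n => weight n) = (fun n => 2^-1 ^+ 7 * 2^-1 ^+ n)); last first.
  by apply/funext => n; rewrite /weight exprD mulrC.
have h : (2^-1 : R) < 1 by rewrite invf_lt1 ?ltr1n ?ltr0n.
have h0 : 0 <= (2^-1 : R) by rewrite invr_ge0 ler0n.
by have := cvgMl_tmp (a := 2^-1 ^+ 7) (cvg_exprR h0 h); rewrite mulr0; apply.
Qed.

Lemma sum_weight n m : (n <= m)%N -> \sum_(n <= i < m) weight i = 2 * weight n - 2 * weight m.
Proof.
move=> /subnKC <-; elim: (m - n)%N => [|d IH]; first by rewrite addn0 big_geq ?subrr.
by rewrite addnS big_nat_recr ?leq_addr//= IH weightS; field.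
Qed.

Lemma knotS i : knot i.+1 = knot i ^+ 2.
Proof. by rewrite /knot -exprM expnS mulnC. Qed.

Lemma knot_le i : knot i <= 64^-1.
Proof.
rewrite /knot -[leRHS]expr1 ler_wiXn2l ?expn_gt0//.
  by rewrite invf_le1 ?ler1n ?ltr0n.
Qed.

Lemma cnorm_addR x (t : R) : cnorm (x + t%:C) ^+ 2 = cnorm x ^+ 2 + 2 * t * Re x + t ^+ 2.
Proof. by rewrite !cnorm_sqr; case: x => a b; rewrite !(cReD, cImD)/=; ring. Qed.

Section right_half_plane.
Variables (x : R[i]) (x0 : 0 < Re x).

Lemma cnorm_rhp_gt0 : 0 < cnorm x.
Proof. exact: lt_le_trans (Re_le_cnorm x). Qed.

Lemma le_cnorm_addR (t : R) : 0 < t -> cnorm x <= cnorm (x + t%:C).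
Proof.
move=> t0; rewrite -(@ler_pXn2r _ 2) ?nnegrE ?cnorm_ge0// cnorm_addR -addrA lerDl.
by rewrite addr_ge0 ?sqr_ge0// mulr_ge0 ?ltW// mulr_gt0.
Qed.

Lemma le_cnorm_addR_r (t : R) : 0 < t -> t <= cnorm (x + t%:C).
Proof.
move=> t0; rewrite -(@ler_pXn2r _ 2) ?nnegrE ?cnorm_ge0 ?(ltW t0)// cnorm_addR lerDr.
by rewrite addr_ge0 ?sqr_ge0// mulr_ge0 ?ltW// mulr_gt0.
Qed.

Lemma cnorm_addR_gt0 (t : R) : 0 < t -> 0 < cnorm (x + t%:C).
Proof. by move=> t0; apply: lt_le_trans t0 (le_cnorm_addR_r t0). Qed.

Lemma addR_neq0 (t : R) : 0 < t -> x + t%:C != 0.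
Proof. by move=> /cnorm_addR_gt0; rewrite cnorm_gt0. Qed.

Lemma Re_div_addR (t : R) : 0 < t ->
  Re (x / (x + t%:C)) = (cnorm x ^+ 2 + t * Re x) / cnorm (x + t%:C) ^+ 2.
Proof.
move=> t0; have d0 := cnorm_addR_gt0 t0.
have D0 : cnorm (x + t%:C) ^+ 2 != 0 by rewrite expf_neq0// gt_eqF.
have -> : x / (x + t%:C) = x * conjc (x + t%:C) * ((cnorm (x + t%:C) ^+ 2)^-1)%:C.
  have field_eq (u d e : R[i]) : d != 0 -> e != 0 -> u / d = u * e * (d * e)^-1.
    by move=> d' e'; rewrite -mulrA invfM [e * _]mulrCA divff// mulr1.
  rewrite fmorphV/= cnorm_sqrC; apply: field_eq; first exact: addR_neq0.
  by rewrite conjc_eq0 addR_neq0.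
rewrite cReM/= mulr0 subr0; congr (_ / _); rewrite cnorm_sqr.
by case: (x) => a b /=; ring.
Qed.

Lemma cnorm_cusp_term_le1 i : cnorm (cusp_term i x) <= 1.
Proof.
rewrite /cusp_term cnorm_div ler_pdivrMr ?mul1r ?le_cnorm_addR ?knot_gt0//.
by rewrite cnorm_addR_gt0 ?knot_gt0.
Qed.

Lemma cnorm_cusp_term_le i : cnorm (cusp_term i x) <= cnorm x / knot i.
Proof.
rewrite /cusp_term cnorm_div ler_wpM2l ?cnorm_ge0// lef_pV2 ?posrE ?knot_gt0//.
  by rewrite le_cnorm_addR_r ?knot_gt0.
by rewrite cnorm_addR_gt0 ?knot_gt0.
Qed.

Lemma Re_cusp_term_ge0 i : 0 <= Re (cusp_term i x).
Proof.
rewrite Re_div_addR ?knot_gt0// divr_ge0 ?sqr_ge0// addr_ge0 ?sqr_ge0//.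
by rewrite mulr_ge0 ?knot_ge0// ltW.
Qed.

Lemma Re_cusp_term_ge i : knot i <= cnorm x -> 4^-1 <= Re (cusp_term i x).
Proof.
move=> tx; rewrite Re_div_addR ?knot_gt0// ler_pdivlMr ?exprn_gt0 ?cnorm_addR_gt0 ?knot_gt0//.
rewrite cnorm_addR; have := knot_gt0 i; have := Re_le_cnorm x.
move: x0 tx; move: (knot i) (cnorm x) (Re x) => t a r; nra.
Qed.

Lemma cusp_sum_close n m : (n <= m)%N -> cnorm (cusp_sum m x - cusp_sum n x) <= 2 * weight n.
Proof.
move=> nm; rewrite /cusp_sum -!(big_mkord xpredT (fun i => (weight i)%:C * cusp_term i x)).
rewrite (big_cat_nat (leq0n n) nm)/= addrAC subrr add0r.
apply: (le_trans (ler_cnorm_sum _ _ _)).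
apply: (@le_trans _ _ (\sum_(n <= i < m) weight i)).
  apply: ler_sum => i _; rewrite cnormM cnormR_ge0 ?weight_ge0//.
  by rewrite ler_piMr ?cnorm_cusp_term_le1// ?weight_ge0.
by rewrite sum_weight// gerBl mulr_ge0// ?weight_ge0.
Qed.

Lemma cvg_2weight : (fun n => 2 * weight n) @ \oo --> (0 : R).
Proof. by have := cvgMl_tmp (a := 2 : R) weight_cvg0; rewrite mulr0; apply. Qed.

Lemma cvg_cusp_sum : (cusp_sum ^~ x : nat -> R[i]^o) @ \oo --> (cusp x : R[i]^o).
Proof.
have [l [xl _]] := cauchy_rate_cvg cvg_2weight cusp_sum_close.
have xcv : cvg ((cusp_sum ^~ x : nat -> R[i]^o) @ \oo) by apply: cvgP xl.
exact: xcv.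
Qed.

Lemma Re_cusp_ge (M : R) : (exists N, forall n, (N <= n)%N -> M <= Re (cusp_sum n x)) ->
  M <= Re (cusp x).
Proof.
move=> [N NP]; have h := cvg_Re cvg_cusp_sum.
rewrite -(cvg_lim (@Rhausdorff R) h); apply: limr_ge; first exact: cvgP h.
by exists N.
Qed.

Lemma cnorm_cusp_le (M : R) : (forall n, cnorm (cusp_sum n x) <= M) -> cnorm (cusp x) <= M.
Proof. by move=> h; apply: cvg_cnorm_lim_le cvg_cusp_sum _; exists 0%N => n _. Qed.

(* Scale 0 has no upper limit: |1 - z1| may exceed [knot 0]. *)
Definition at_scale i (a : R) := knot i.+1 < a /\ (i = 0%N \/ a <= knot i).

(** Term i.+1 suffices: its knot is below |x|, so it contributes at least weight i.+1 / 4, and no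
    term has negative real part. *)
Lemma Re_cusp_scale i : knot i.+1 < cnorm x -> weight i / 8 <= Re (cusp x).
Proof.
move=> ix; apply: Re_cusp_ge; exists i.+2 => n ni; rewrite /cusp_sum Re_sum.
have Rw j : Re ((weight j)%:C * cusp_term j x) = weight j * Re (cusp_term j x).
  by rewrite cReM/= mul0r subr0.
rewrite (bigD1 (Ordinal ni))//= Rw; apply: ler_wpDr.
  by apply: sumr_ge0 => j _; rewrite Rw mulr_ge0 ?Re_cusp_term_ge0 ?weight_ge0.
rewrite weightS (_ : weight i / 8 = weight i / 2 * 4^-1); last by field.
by rewrite ler_wpM2l ?Re_cusp_term_ge ?divr_ge0 ?weight_ge0// ltW.
Qed.

(** Knots square at each step, so going from i to i.+1 multiplies the earlier sum and the new term
    by knot i <= 1/64, which beats the halving of the weight. *)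
Lemma sum_weight_knot i n : (n <= i)%N ->
  \sum_(l < n) weight l / knot l * knot i <= weight i.
Proof.
move=> ni; have pos l : 0 <= weight l / knot l * knot i.
  by rewrite mulr_ge0 ?divr_ge0 ?weight_ge0 ?knot_ge0.
apply: (@le_trans _ _ (\sum_(l < i) weight l / knot l * knot i)).
  rewrite (big_ord_widen _ (fun l => weight l / knot l * knot i) ni) big_mkcond/=.
  by apply: ler_sum => l _; case: ifP.
elim: i {ni pos} => [|i IH]; first by rewrite big_ord0 weight_ge0.
rewrite big_ord_recr/= weightS.
have -> : \sum_(l < i) weight l / knot l * knot i.+1 =
    knot i * \sum_(l < i) weight l / knot l * knot i.
  by rewrite mulr_sumr; apply: eq_bigr => l _; rewrite knotS; ring.
rewrite (_ : weight i / knot i * knot i.+1 = knot i * weight i); last first.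
  by rewrite knotS; field; rewrite gt_eqF ?knot_gt0.
have := knot_le i; have := knot_gt0 i; have := weight_gt0 i.
set s := (X in _ * X + _); have : s <= weight i := IH.
move: s (knot i) (weight i) => s t w sw w0 t0 t1.
have : t * s + t * w <= 64^-1 * (2 * w).
  rewrite -mulrDr; apply: (@le_trans _ _ (t * (2 * w))).
    by rewrite ler_wpM2l ?(ltW t0)//; lra.
  by rewrite ler_wpM2r// mulr_ge0// ltW.
lra.
Qed.

(** Terms below i are at most |x| / knot l and add up to at most weight i. From i on they are at
    most 1, and the weights add up to less than 2 weight i. *)
Lemma cnorm_cusp_scale i : i = 0%N \/ cnorm x <= knot i -> cnorm (cusp x) <= 3 * weight i.
Proof.
move=> ix; apply: cnorm_cusp_le => n; apply: (le_trans (ler_cnorm_sum _ _ _)).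
have w0 l := weight_ge0 l.
have le_head l : (l < i)%N -> cnorm ((weight l)%:C * cusp_term l x) <= weight l / knot l * knot i.
  case: ix => [->//|ix] _; rewrite cnormM cnormR_ge0// -mulrA ler_wpM2l//.
  by rewrite (le_trans (cnorm_cusp_term_le _))// mulrC ler_wpM2l// invr_ge0 knot_ge0.
have [ni|ni] := leqP n i.
  apply: (@le_trans _ _ (\sum_(l < n) weight l / knot l * knot i)).
    by apply: ler_sum => l _; apply: le_head; apply: leq_trans ni.
  by apply: (le_trans (sum_weight_knot ni)); have := w0 i; lra.
rewrite -(big_mkord xpredT (fun l => cnorm ((weight l)%:C * cusp_term l x))).
rewrite (big_cat_nat (leq0n i) (ltnW ni))/= (_ : 3 * _ = weight i + 2 * weight i); last by ring.
apply: lerD.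
  rewrite big_mkord; apply: le_trans (sum_weight_knot (leqnn i)).
  by apply: ler_sum => l _; apply: le_head.
apply: (@le_trans _ _ (\sum_(i <= l < n) weight l)).
  apply: ler_sum => l _; rewrite cnormM cnormR_ge0//.
  by rewrite ler_piMr ?cnorm_cusp_term_le1.
by rewrite (sum_weight (ltnW ni)) gerBl mulr_ge0.
Qed.

End right_half_plane.

Lemma scale_exists (a : R) : 0 < a -> exists i, at_scale i a.
Proof.
move=> a0; have ex : exists i, knot i.+1 < a.
  have h0 : 0 <= (2^-1 : R) by rewrite invr_ge0 ler0n.
  have h : (2^-1 : R) < 1 by rewrite invf_lt1 ?ltr1n ?ltr0n.
  have [N NP] := (cvgR_epsP _ _).1 (cvg_exprR h0 h) _ a0.
  exists N; have := NP _ (leqnn N); rewrite subr0 ger0_norm ?exprn_ge0//.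
  apply: le_lt_trans; rewrite /knot.
  apply: (@le_trans _ _ (2^-1 ^+ (2 ^ N.+1))).
    by rewrite ler_pXn2r ?nnegrE ?invr_ge0 ?ler0n ?expn_gt0// lef_pV2 ?posrE ?ltr0n ?ler_nat.
  by rewrite ler_wiXn2l ?(ltW h)// (leq_trans (leqnSn N))// ltnW// ltn_expl.
case: (ex_minnP ex) => i ia imin; exists i; split=> //.
case: i ia imin => [|i] ia imin; [by left|right].
by rewrite leNgt; apply/negP => /imin; rewrite ltnn.
Qed.

End cusp.

(** * The symbol at scale i: depth, second coordinate and kernel *)

Section symbol_estimates.
Context {R : realType}.
Implicit Types (w : R[i]) (i : nat) (z : bidisk R).

Definition phi w : R[i] := 1 - cusp (1 - w).
(** The factor 1/8 is dictated by scale 0, where only |1 - w| < 2 is known and |psi| <= 1/4 is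
    wanted. *)
Definition psi w : R[i] := (8^-1)%:C * (1 - w).

Lemma Re_oneB_gt0 w : cnorm w < 1 -> 0 < Re (1 - w).
Proof.
by move=> w1; rewrite cReB subr_gt0; apply: le_lt_trans w1; exact: Re_le_cnorm.
Qed.

Lemma cnorm_oneB_lt2 w : cnorm w < 1 -> cnorm (1 - w) < 2.
Proof.
move=> w1; apply: (le_lt_trans (ler_cnormB _ _)); rewrite cnorm1; lra.
Qed.

Lemma pow2V_gt0 i : 0 < (2^-1 : R) ^+ i.
Proof. by rewrite exprn_gt0// invr_gt0 ltr0n. Qed.

Lemma weightE i : weight i = (2^-1 : R) ^+ i / 128.
Proof. by rewrite /weight exprD; congr (_ * _); rewrite exprVn; congr (_^-1); rewrite -natrX. Qed.

Lemma pow2V_le1 i : (2^-1 : R) ^+ i <= 1.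
Proof. by rewrite exprn_ile1 ?invr_ge0 ?ler0n// invf_le1 ?ltr0n ?ler1n. Qed.

(** 1 - |1 - v|^2 = 2 Re v - |v|^2, where 2 Re v >= 2^-i / 512 and |v|^2 <= (3/128)^2 4^-i. *)
Lemma phi_scale w i : cnorm w < 1 -> at_scale i (cnorm (1 - w)) ->
  (2^-1 : R) ^+ i / 1024 <= 1 - cnorm (phi w) ^+ 2.
Proof.
move=> w1 [lo hi]; have x0 := Re_oneB_gt0 w1.
have h1 := Re_cusp_scale x0 lo; have h2 := cnorm_cusp_scale x0 hi.
have -> : cnorm (phi w) ^+ 2 = 1 - 2 * Re (cusp (1 - w)) + cnorm (cusp (1 - w)) ^+ 2.
  by rewrite /phi !cnorm_sqr !(cReB, cImB)/=; ring.
move: h1 h2; rewrite weightE; have := pow2V_gt0 i; have := pow2V_le1 i.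
have := cnorm_ge0 (cusp (1 - w)).
move: (2^-1 ^+ i) (Re _) (cnorm _) => s r a a0 s1 s0 h1 h2.
have : a ^+ 2 <= (3 * (s / 128)) ^+ 2 by rewrite ler_pXn2r ?nnegrE//; lra.
rewrite expr2 => h; nra.
Qed.

Lemma cnorm_phi_lt1 w : cnorm w < 1 -> cnorm (phi w) < 1.
Proof.
move=> w1; have [i ii] := scale_exists (cnorm_rhp_gt0 (Re_oneB_gt0 w1)).
have := phi_scale w1 ii; have := pow2V_gt0 i; have := cnorm_ge0 (phi w).
move: (2^-1 ^+ i) (cnorm (phi w)) => s a a0 s0 h.
rewrite ltNge; apply/negP => a1.
by have : 1 <= a ^+ 2; [rewrite expr_ge1|lra].
Qed.

Lemma cnorm_psi w : cnorm (psi w) = cnorm (1 - w) / 8.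
Proof. by rewrite /psi cnormM cnormR_ge0 ?invr_ge0 ?ler0n// mulrC. Qed.

Lemma psi_scale w i : cnorm w < 1 -> at_scale i (cnorm (1 - w)) ->
  cnorm (psi w) <= (2^-1 : R) ^+ (2 ^ i) / 2.
Proof.
move=> w1 [_ hi]; rewrite cnorm_psi; have h2 := cnorm_oneB_lt2 w1.
case: hi => [->|hi]; first by rewrite expn0 expr1; lra.
have : cnorm (1 - w) <= (2^-1 : R) ^+ (2 ^ i).
  apply: le_trans hi _; rewrite /knot ler_pXn2r ?nnegrE ?invr_ge0 ?ler0n ?expn_gt0//.
  by rewrite lef_pV2 ?posrE ?ltr0n ?ler_nat.
have := pow2V_gt0 (2 ^ i); lra.
Qed.

Lemma cnorm_psi_le w : cnorm w < 1 -> cnorm (psi w) <= 4^-1.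
Proof. by move=> w1; rewrite cnorm_psi; have := cnorm_oneB_lt2 w1; lra. Qed.

Definition zero_at i : R := 1 - 2^-1 ^+ i.
Definition contraction_rate : R := 1 - 8192^-1.

Lemma zero_at_bounds i : 0 <= zero_at i < 1.
Proof. by rewrite /zero_at subr_ge0 pow2V_le1 gtrBl pow2V_gt0. Qed.

(** In 1 - |b|^2 = (1 - p^2) (1 - |phi|^2) / |1 - p phi|^2 with p = 1 - 2^-i, the numerator is at
    least 4^-i / 1024 and the denominator at most 4 * 4^-i. Hence |b|^2 <= 1 - 1/4096, uniformly in
    i, and a square root gives 1 - 1/8192. *)
Lemma blaschke_phi_scale w i : cnorm w < 1 -> at_scale i (cnorm (1 - w)) ->
  cnorm (blaschke (zero_at i) (phi w)) <= contraction_rate.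
Proof.
move=> w1 ii; have phi1 := cnorm_phi_lt1 w1; have /andP[p0 p1] := zero_at_bounds i.
have h1 := phi_scale w1 ii.
have h2 := cnorm_cusp_scale (Re_oneB_gt0 w1) ii.2.
rewrite -(@ler_pXn2r _ 2) ?nnegrE ?cnorm_ge0//; last by rewrite /contraction_rate; lra.
have d0 : 0 < cnorm (1 - (zero_at i)%:C * phi w).
  by rewrite cnorm_gt0 geometric_denom_neq0 ?(ltW p1).
have hd : cnorm (1 - (zero_at i)%:C * phi w) <= 2 * 2^-1 ^+ i.
  have -> : 1 - (zero_at i)%:C * phi w =
      (2^-1 ^+ i)%:C + (zero_at i)%:C * cusp (1 - w).
    rewrite /phi /zero_at rmorphB/= rmorph1; ring.
  apply: (le_trans (ler_cnormD _ _)); rewrite cnormM !cnormR_ge0 ?(ltW (pow2V_gt0 _))//.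
  move: h2; rewrite weightE; have := pow2V_gt0 i; have := cnorm_ge0 (cusp (1 - w)).
  move: (cnorm _) (zero_at i) p0 p1 (2^-1 ^+ i) => a p p0 p1 s a0 s0 h2; nra.
have := cnorm_blaschke p0 p1 phi1.
move: d0 hd h1; rewrite /zero_at; have := pow2V_gt0 i; have := pow2V_le1 i.
move: (2^-1 ^+ i) (cnorm (1 - _ * phi w)) (cnorm (blaschke _ _)) (cnorm (phi w)).
move=> s d a f s1 s0 d0 hd h1 ea.
have D0 : 0 < d ^+ 2 by rewrite exprn_gt0.
have hD : d ^+ 2 <= 4 * s ^+ 2.
  by rewrite (_ : 4 * s ^+ 2 = (2 * s) ^+ 2); [rewrite ler_pXn2r ?nnegrE ?(ltW d0)//; lra|ring].
have : 4096^-1 <= 1 - a ^+ 2.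
  rewrite ea ler_pdivlMr//; apply: (@le_trans _ _ (s * (s / 1024))).
    by move: hD; rewrite !expr2; lra.
  apply: ler_pM; [lra|lra| |exact: h1].
  by rewrite expr2; nra.
by rewrite /contraction_rate !expr2; nra.
Qed.

Lemma pow2_ge1 i : 1 <= (2 : R) ^+ i.
Proof. by rewrite exprn_ege1// ler1n. Qed.

Lemma pow2VK i : (2^-1 : R) ^+ i * 2 ^+ i = 1.
Proof. by rewrite -exprMn mulVf ?expr1n// pnatr_eq0. Qed.

(** N u^N is at most the sum of the u^j with j < N, hence at most 1 / (1 - u). The dependence on 1 /
    (1 - u) is polynomial, so the majorant can absorb it uniformly in the point. *)
Lemma expr_le_harmonic (u : R) N : 0 <= u -> u < 1 -> (0 < N)%N ->
  u ^+ N <= (N%:R * (1 - u))^-1.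
Proof.
move=> u0 u1 N0; have q0 : 0 < N%:R * (1 - u) by rewrite mulr_gt0 ?subr_gt0 ?ltr0n.
rewrite -[leRHS]mul1r ler_pdivlMr// mulrA mulrC.
apply: (@le_trans _ _ ((1 - u) * \sum_(j < N) u ^+ j)).
  rewrite ler_wpM2l ?subr_ge0 ?(ltW u1)// mulr_natr -[X in _ *+ X]card_ord -sumr_const.
  by apply: ler_sum => j _; rewrite ler_wiXn2l ?(ltW u1)// ltnW.
by rewrite mulrC -ler_pdivlMr ?subr_gt0// mul1r geometric_sum_le.
Qed.

Lemma sqrt_kernel_phi w (v : R[i]) i : cnorm w < 1 -> cnorm v < 1 ->
  at_scale i (cnorm (1 - w)) ->
  Num.sqrt (kernel_bound (phi w, psi w * v) 0 0) <= 64 * 2 ^+ i.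
Proof.
move=> w1 v1 ii; have h := phi_scale w1 ii.
rewrite -[leRHS]ger0_norm ?mulr_ge0 ?exprn_ge0// -sqrtr_sqr ler_wsqrtr//.
rewrite /kernel_bound/= !expr0.
have hv : cnorm (psi w * v) ^+ 2 <= 16^-1.
  have : cnorm (psi w * v) <= 4^-1.
    rewrite cnormM -[leRHS]mulr1 ler_pM ?cnorm_ge0 ?cnorm_psi_le// ltW//.
  by have := cnorm_ge0 (psi w * v); rewrite expr2; nra.
move: h hv; have := pow2VK i; have := pow2_ge1 i; have := pow2V_gt0 i.
move: (2^-1 ^+ i) (2 ^+ i) (cnorm (phi w) ^+ 2) (cnorm (psi w * v) ^+ 2).
move=> s y a b s0 y1 sy ha hb.
have d0 : 0 < (1 - a) * (1 - b) by apply: mulr_gt0; lra.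
rewrite ler_pdivrMr//.
have : s / 1024 * (15 / 16) <= (1 - a) * (1 - b) by apply: ler_pM; lra.
rewrite exprMn => hd; apply: (@le_trans _ _ (64 ^+ 2 * y ^+ 2 * (s / 1024 * (15 / 16)))).
  have -> : 64 ^+ 2 * y ^+ 2 * (s / 1024 * (15 / 16)) = (s * y) * y * (64 ^+ 2 / 1024 * (15 / 16)).
    by rewrite !expr2; ring.
  rewrite sy; lra.
by rewrite ler_wpM2l// mulr_ge0 ?sqr_ge0.
Qed.

(** [expr_le_harmonic] contributes 2^i / N under the root, and the denominator of the kernel another
    2^i: this is 2^i / sqrt N after the root. *)
Lemma sqrt_kernel_phi_tail w (v : R[i]) i N : cnorm w < 1 -> cnorm v < 1 ->
  at_scale i (cnorm (1 - w)) -> (0 < N)%N ->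
  Num.sqrt (kernel_bound (phi w, psi w * v) N N) <= 2048 * 2 ^+ i / Num.sqrt N%:R.
Proof.
move=> w1 v1 ii N0; have h := phi_scale w1 ii.
have N0' : 0 < (N%:R : R) by rewrite ltr0n.
have r0 : 0 <= 2048 * 2 ^+ i / Num.sqrt (N%:R : R).
  apply: divr_ge0; last exact: sqrtr_ge0.
  by apply: mulr_ge0; [exact: ler0n|apply: exprn_ge0; exact: ler0n].
rewrite -(ger0_norm r0) -sqrtr_sqr; apply: ler_wsqrtr; move=> {r0}.
rewrite expr_div_n sqr_sqrtr ?ler0n// /kernel_bound/=.
have hv : cnorm (psi w * v) ^+ 2 <= 16^-1.
  have : cnorm (psi w * v) <= 4^-1.
    rewrite cnormM -[leRHS]mulr1 ler_pM ?cnorm_ge0 ?cnorm_psi_le// ltW//.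
  by have := cnorm_ge0 (psi w * v); rewrite expr2; nra.
have := sqr_ge0 (cnorm (phi w)); have := sqr_ge0 (cnorm (psi w * v)).
move: h hv; have := pow2VK i; have := pow2_ge1 i; have := pow2V_gt0 i.
move: (2^-1 ^+ i) (2 ^+ i) (cnorm (phi w) ^+ 2) (cnorm (psi w * v) ^+ 2).
move=> s y a b s0 y1 sy ha hb b0 a0.
have d0 : 0 < (1 - a) * (1 - b) by apply: mulr_gt0; lra.
rewrite ler_pdivrMr//.
have hd : s / 1024 * (15 / 16) <= (1 - a) * (1 - b) by apply: ler_pM; lra.
have inv_le (u c : R) : 0 < c -> c <= 1 - u -> 0 <= u -> u ^+ N <= c^-1 / N%:R.
  move=> c0 cu u0; have u1 : u < 1 by lra.
  apply: le_trans (expr_le_harmonic u0 u1 N0) _.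
  rewrite invfM mulrC ler_wpM2r ?invr_ge0 ?ler0n// lef_pV2 ?posrE//; lra.
have s1024 : (s / 1024)^-1 = 1024 * y.
  have ys : y = s^-1 by rewrite -[RHS]mulr1 -sy mulKf ?gt_eqF.
  by rewrite invfM invrK mulrC -ys.
have hA : a ^+ N <= 1024 * y / N%:R.
  by rewrite -s1024; apply: inv_le; [lra|exact: ha|exact: a0].
have hB : b ^+ N <= 2^-1^-1 / N%:R by apply: inv_le; lra.
apply: (@le_trans _ _ (1026 * y / N%:R)).
  apply: le_trans (lerD hA hB) _; rewrite -mulrDl invrK; apply: ler_wpM2r; last lra.
  by rewrite invr_ge0 ler0n.
rewrite [leRHS]mulrAC; apply: ler_wpM2r; first by rewrite invr_ge0 ler0n.
have h3 : y * (15 / 16384) <= y ^+ 2 * ((1 - a) * (1 - b)).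
  have -> : y * (15 / 16384) = y ^+ 2 * (s / 1024 * (15 / 16)).
    by rewrite (_ : y ^+ 2 * _ = (s * y) * y * (15 / 16384)); [rewrite sy mul1r|rewrite expr2; field].
  by apply: ler_wpM2l hd; exact: sqr_ge0.
rewrite exprMn -mulrA; move: h3; move: (y ^+ 2 * _) => q h3; rewrite expr2; lra.
Qed.

End symbol_estimates.

(** * The majorant *)

Section majorant.
Context {R : realType}.
Implicit Types (w : R[i]) (i : nat) (z : bidisk R).

Lemma Re_knot_div_ge0 (x : R[i]) i : 0 < Re x -> 0 <= Re ((knot i)%:C / (x + (knot i)%:C)).
Proof.
move=> x0; have k0 := @knot_gt0 R i.
have -> : (knot i)%:C / (x + (knot i)%:C) = 1 - cusp_term i x.
  by rewrite /cusp_term; apply: (mulIf (addR_neq0 x0 k0)); rewrite mulrBl !divfK ?addR_neq0//; ring.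
rewrite cReB Re_div_addR// subr_ge0 ler_pdivrMr ?exprn_gt0 ?cnorm_addR_gt0//.
rewrite mul1r cnorm_addR -addrA lerD2l.
have h1 := sqr_ge0 (knot i : R).
have h2 : 0 <= knot i * Re x by rewrite mulr_ge0// ltW.
lra.
Qed.

Lemma Re_knot_div_ge (x : R[i]) i : 0 < Re x -> cnorm x <= knot i ->
  4^-1 <= Re ((knot i)%:C / (x + (knot i)%:C)).
Proof.
move=> x0 xk; have k0 := @knot_gt0 R i.
have -> : (knot i)%:C / (x + (knot i)%:C) = 1 - cusp_term i x.
  by rewrite /cusp_term; apply: (mulIf (addR_neq0 x0 k0)); rewrite mulrBl !divfK ?addR_neq0//; ring.
rewrite cReB Re_div_addR//.
have d0 : 0 < cnorm (x + (knot i)%:C) ^+ 2 by rewrite exprn_gt0 ?cnorm_addR_gt0.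
rewrite -[Re 1]/(1 : R) lerBrDr addrC -lerBrDr ler_pdivrMr// cnorm_addR.
have h1 : cnorm x ^+ 2 <= knot i ^+ 2 by rewrite ler_pXn2r ?nnegrE ?cnorm_ge0 ?knot_ge0.
have h2 : 0 <= knot i * Re x by rewrite mulr_ge0 ?knot_ge0// ltW.
by have := sqr_ge0 (knot i : R); lra.
Qed.

Let pole i : R := (1 + knot i)^-1.

Let pole_ge0 i : 0 <= pole i.
Proof. by rewrite invr_ge0 addr_ge0 ?knot_ge0. Qed.

Let pole_lt1 i : pole i < 1.
Proof. by rewrite invf_lt1 ?ltrDl ?knot_gt0// addr_gt0 ?knot_gt0. Qed.

Lemma knot_resolventE w i : cnorm w < 1 ->
  (1 - w + (knot i)%:C)^-1 = (pole i)%:C * (1 - (pole i)%:C * w)^-1.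
Proof.
move=> w1; have t1 : (1 : R[i]) + (knot i)%:C != 0.
  by rewrite -(rmorph1 (real_complex R)) -rmorphD fmorph_eq0 gt_eqF// addr_gt0 ?knot_gt0.
rewrite /pole fmorphV rmorphD/= rmorph1 -invfM; congr (_ ^-1).
by rewrite mulrBr mulr1 mulVKf// addrAC.
Qed.

Lemma multiplier_knot_resolvent i : multiplier (fun z => (1 - (val z).1 + (knot i)%:C)^-1).
Proof.
apply: eq_multiplier (multiplierM (multiplier_cst (pole i)%:C) (multiplier_geometric (pole_ge0 i) (pole_lt1 i))).
by move=> z; rewrite knot_resolventE// bidisk1.
Qed.

(** With t = knot i and p = 1 / (1 + t), the squared norm is at most (t p)^2 / (1 - p^2) = t / (2 +
    t) <= t, and t is the square of 8^-(2^i). *)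
Lemma knot_function_exists i : exists T : hardy R,
  (forall z, T z = (knot i)%:C / (1 - (val z).1 + (knot i)%:C)) /\
  hardy_norm T <= 8^-1 ^+ (2 ^ i).
Proof.
have [G [GE G1]] := hardy_geometric (pole_ge0 i) (pole_lt1 i).
exists ((knot i * pole i)%:C *: G); split=> [z|].
  by rewrite hardyZ GE knot_resolventE ?bidisk1// rmorphM/= mulrA.
move: G1; rewrite /pole; have t0 := @knot_gt0 R i; set t := knot i in t0 *.
have t1 : 0 < 1 + t by rewrite addr_gt0.
pose p := (1 + t)^-1; rewrite -/p => G1.
rewrite -(@ler_pXn2r _ 2) ?nnegrE ?hardy_norm_ge0 ?exprn_ge0 ?invr_ge0 ?ler0n//.
rewrite hardy_normZ cnormR_ge0; last by rewrite mulr_ge0 ?invr_ge0// ltW.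
rewrite exprMn; have -> : (8^-1 ^+ (2 ^ i)) ^+ 2 = t.
  by rewrite exprAC /t /knot; congr (_ ^+ _); rewrite exprVn; congr (_ ^-1); rewrite -natrX.
apply: (@le_trans _ _ ((t * p) ^+ 2 * (1 - p ^+ 2)^-1)).
  by rewrite ler_wpM2l ?sqr_ge0.
have -> : (t * p) ^+ 2 * (1 - p ^+ 2)^-1 = t * (t / (t * (2 + t))).
  rewrite /p; field; have t2 : 0 < 2 + t by rewrite addr_gt0.
  rewrite (gt_eqF t2) (gt_eqF t0) (gt_eqF t1)/= gt_eqF// (_ : _ - 1 = t * (2 + t)); last by ring.
  exact: mulr_gt0.
by rewrite ler_piMr ?(ltW t0)// ler_pdivrMr ?mulr_gt0 ?addr_gt0// mul1r; nra.
Qed.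

(** H = 1 + sum of the 4^(2^i) t_i / (1 - z1 + t_i). The term i has norm at most 2^-(2^i), and real
    part at least 4^(2^i) / 4 once |1 - z1| <= t_i. All real parts are nonnegative, so nothing
    cancels. *)
Lemma majorant_exists : exists H : hardy R, hardy_norm H <= 2 /\
  forall z i, at_scale i (cnorm (1 - (val z).1)) -> 4 ^+ (2 ^ i) / 16 <= cnorm (H z : R[i]).
Proof.
have [E [EE E1]] := @hardy_geometric R 0 (lexx _) ltr01.
pose T i := sval (cid (knot_function_exists i)).
have TE i z : T i z = (knot i)%:C / (1 - (val z).1 + (knot i)%:C).
  by rewrite /T; case: cid => ? [].
have TN i : hardy_norm (T i) <= 8^-1 ^+ (2 ^ i) by rewrite /T; case: cid => ? [].
pose c i : R := 4 ^+ (2 ^ i).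
have c0 i : 0 <= c i by rewrite exprn_ge0.
pose u n := E + \sum_(i < n) (c i)%:C *: T i.
have cT i : hardy_norm ((c i)%:C *: T i) <= 2^-1 ^+ i.+1.
  rewrite hardy_normZ cnormR_ge0//.
  apply: (@le_trans _ _ (c i * 8^-1 ^+ (2 ^ i))); first by rewrite ler_wpM2l.
  rewrite /c -exprMn (_ : 4 * 8^-1 = 2^-1 :> R); last by field.
  by rewrite ler_wiXn2l ?invr_ge0 ?ler0n ?invf_le1 ?ler1n ?ltr0n// ltn_expl.
have ue n m : (n <= m)%N -> hardy_norm (u m - u n) <= 2^-1 ^+ n.
  move=> nm; rewrite /u opprD addrACA subrr add0r.
  rewrite -!(big_mkord xpredT (fun i => (c i)%:C *: T i)) (big_cat_nat (leq0n n) nm)/=.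
  rewrite addrAC subrr add0r -hardy_cnormE (le_trans (ler_cnorm_sum _ _ _))//.
  apply: (@le_trans _ _ (\sum_(n <= i < m) 2^-1 ^+ i.+1)); first by apply: ler_sum => i _; exact: cT.
  have -> : \sum_(n <= i < m) (2^-1 : R) ^+ i.+1 = 2^-1 ^+ n - 2^-1 ^+ m.
    rewrite -(subnKC nm); elim: (m - n)%N => [|d IH]; first by rewrite addn0 big_geq ?subrr.
    by rewrite addnS big_nat_recr ?leq_addr//= IH !exprS; field.
  by rewrite gerBl ltW ?pow2V_gt0.
have e0 : (fun n => 2^-1 ^+ n) @ \oo --> (0 : R).
  by apply: cvg_exprR; rewrite ?invr_ge0 ?ler0n// invf_lt1 ?ltr0n ?ltr1n.
have [H HP] := hardy_complete e0 ue.
exists H; split.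
  rewrite -[H](subrK (u 0%N)) -hardy_cnormE (le_trans (ler_cnormD _ _))//.
  rewrite !hardy_cnormE -[2]/(1 + 1) lerD//.
  rewrite /u big_ord0 addr0 -(@ler_pXn2r _ 2) ?nnegrE ?hardy_norm_ge0//.
  by apply: le_trans E1 _; rewrite expr0n subr0 invr1 expr1n.
move=> z i ii; apply: le_trans (Re_le_cnorm _).
have Hz : (fun n => u n z : R[i]^o) @ \oo --> (H z : R[i]^o).
  apply: cvg_hardy_value; apply: (squeeze_cvgr _ (cvg_cst 0) e0).
  by apply: nearW => n; rewrite hardy_norm_ge0 HP.
have RH := cvg_Re Hz.
rewrite -(cvg_lim (@Rhausdorff R) RH); apply: limr_ge; first exact: cvgP RH.
exists i.+1 => // n ni; have {}ni : (i < n)%N by exact: ni.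
have x0 := Re_oneB_gt0 (bidisk1 z).
rewrite /u hardyD hardy_sum cReD EE mul0r subr0 invr1 Re_sum.
have RT j : Re (((c j)%:C *: T j) z) = c j * Re ((knot j)%:C / (1 - (val z).1 + (knot j)%:C)).
  by rewrite hardyZ TE; move: (_ / _) => q; rewrite cReM/= mul0r subr0.
rewrite (bigD1 (Ordinal ni))//= RT.
have rest : 0 <= \sum_(j < n | j != Ordinal ni) Re (((c j)%:C *: T j) z).
  by apply: sumr_ge0 => j _; rewrite RT mulr_ge0 ?Re_knot_div_ge0.
have ti := Re_knot_div_ge0 i x0.
have ci := c0 i; move: rest ti (Re_knot_div_ge (i := i) x0) ci ii.2.
move: (\sum_(j < n | _) _) (Re (_ / _)) => s r s0 r0 hr ci [i0|/hr r4].
  (* At scale 0 the point may lie beyond knot 0; the constant 1 of H already exceeds 4 / 16. *)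
  have : 0 <= c i * r by rewrite mulr_ge0.
  by rewrite {2}i0 expn0 expr1; lra.
have : c i * 4^-1 <= c i * r by rewrite ler_wpM2l.
rewrite /c; move: ci; rewrite /c; lra.
Qed.

End majorant.

(** * The composition operator *)

Section composition.
Context {R : realType}.
Implicit Types (F G H f g : hardy R) (z : bidisk R).

Lemma symbol_subproof z :
  ((phi (val z).1, psi (val z).1 * (val z).2) : R[i]^o * R[i]^o) \in bidisk R.
Proof.
apply/mem_set; split; rewrite normr_lt1/=; first exact: cnorm_phi_lt1 (bidisk1 z).
rewrite cnormM; have := cnorm_psi_le (bidisk1 z); have := bidisk2 z.
have := cnorm_ge0 (psi (val z).1); have := cnorm_ge0 ((val z).2 : R[i]).
move: (cnorm _) (cnorm _) => a b a0 b0 a1 b1; nra.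
Qed.

Definition symbol z : bidisk R := SigSub (symbol_subproof z).

Lemma val_symbol z : val (symbol z) = (phi (val z).1, psi (val z).1 * (val z).2).
Proof. by []. Qed.

Lemma multiplier_phi : multiplier (fun z => phi (val z).1).
Proof.
apply: multiplierB; first exact: multiplier_cst.
apply: (@multiplier_lim R (fun n z => cusp_sum n (1 - (val z).1)) _ (fun n => 2 * weight n)).
- move=> n; apply: multiplier_sum => i _; apply: multiplierM; first exact: multiplier_cst.
  apply: multiplierM; last exact: multiplier_knot_resolvent.
  exact: multiplierB (multiplier_cst _) multiplier_z1.
- exact: cvg_2weight.
- by move=> n m z nm; apply: cusp_sum_close => //; exact: Re_oneB_gt0 (bidisk1 z).
- by move=> z; apply: cvg_cusp_sum; exact: Re_oneB_gt0 (bidisk1 z).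
Qed.

Lemma multiplier_psi : multiplier (fun z => psi (val z).1 * (val z).2).
Proof.
apply: multiplierM multiplier_z2; apply: multiplierM; first exact: multiplier_cst.
exact: multiplierB (multiplier_cst _) multiplier_z1.
Qed.

Lemma multiplier_rect_sum (c : nat * nat -> R[i]) m n :
  multiplier (fun z => rect_sum c (val (symbol z)) m n).
Proof.
apply: multiplier_sum => j _; apply: multiplier_sum => k _.
apply: multiplierM (multiplierX _ multiplier_psi).
apply: multiplierM (multiplierX _ multiplier_phi); exact: multiplier_cst.
Qed.

Lemma hardy_truncate f N : exists g, hardy_coef g = truncate (hardy_coef f) N N /\
  forall z, g z = rect_sum (hardy_coef f) (val z) N N.
Proof.
have le n : square_sum (truncate (hardy_coef f) N N) n <= hardy_norm f ^+ 2.
  apply: le_trans (square_sum_hardy f n); apply: ler_sum => j _; apply: ler_sum => k _.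
  by rewrite /truncate; case: ifP => // _; rewrite cnorm0 expr0n sqr_ge0.
have [|g gE] := @hardy_exists R (truncate (hardy_coef f) N N).
  by apply: le_lt_trans (sq_sum_le_bound le) _; rewrite ltry.
exists g; split=> // z.
have gz := @cvg_rect_sum R g z (addn^~ N) (addn^~ N) (leq_addr N) (leq_addr N).
apply: (cvg_unique_c gz); apply: (cvg_cnorm_le (e := fun=> 0)); first exact: cvg_cst.
by move=> n; rewrite gE rect_sum_truncate ?leq_addl// subrr cnorm0.
Qed.

Variable H : hardy R.
Hypothesis H_majorant : forall z i, at_scale i (cnorm (1 - (val z).1)) ->
  4 ^+ (2 ^ i) / 16 <= cnorm (H z : R[i]).

Lemma pow2_le_majorant z i : at_scale i (cnorm (1 - (val z).1)) ->
  2 ^+ i <= 16 * cnorm (H z : R[i]).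
Proof.
move=> /H_majorant; rewrite ler_pdivrMr ?ltr0n// mulrC; apply: le_trans.
rewrite -!natrX ler_nat; apply: leq_trans (ltnW (ltn_expl (2 ^ i) (isT : 1 < 4)%N)).
exact: leqnn.
Qed.

Lemma composition_value_le f z :
  cnorm (f (symbol z) : R[i]) <= hardy_norm f * 1024 * cnorm (H z : R[i]).
Proof.
have [i ii] := scale_exists (cnorm_rhp_gt0 (Re_oneB_gt0 (bidisk1 z))).
apply: le_trans (hardy_value_le f (symbol z)) _.
rewrite -mulrA ler_wpM2l ?hardy_norm_ge0//.
apply: le_trans (sqrt_kernel_phi (bidisk1 z) (bidisk2 z) ii) _.
have := pow2_le_majorant ii; lra.
Qed.

Lemma composition_value_tail f z N : (0 < N)%N ->
  (forall j k, (j < N)%N -> (k < N)%N -> hardy_coef f (j, k) = 0) ->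
  cnorm (f (symbol z) : R[i]) <=
    hardy_norm f * (2048 * 16) / Num.sqrt N%:R * cnorm (H z : R[i]).
Proof.
move=> N0 f0; have [i ii] := scale_exists (cnorm_rhp_gt0 (Re_oneB_gt0 (bidisk1 z))).
apply: le_trans (@hardy_value_bound R f (symbol z) N N f0) _.
rewrite -!mulrA; apply: ler_wpM2l; first exact: hardy_norm_ge0.
apply: le_trans (sqrt_kernel_phi_tail (bidisk1 z) (bidisk2 z) ii N0) _.
have s0 : 0 <= (Num.sqrt (N%:R : R))^-1 by rewrite invr_ge0 sqrtr_ge0.
have := ler_wpM2l s0 (pow2_le_majorant ii).
by move: (_^-1) (2 ^+ i) (cnorm _) => s y h; lra.
Qed.

Lemma cvg_div_sqrt (a : R) : (fun n => a / Num.sqrt n.+1%:R) @ \oo --> (0 : R).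
Proof.
have h := sqrt_cvg0 (@cvg_harmonic R).
have -> : (fun n => a / Num.sqrt n.+1%:R) = (fun n => a * Num.sqrt (harmonic n)).
  by apply/funext => n; rewrite /harmonic/= sqrtrV.
by have := cvgMl_tmp (a := a) h; rewrite mulr0; apply.
Qed.

(** Truncations of f become polynomials in the two coordinate multipliers of the symbol. The tail
    estimate makes them Cauchy in norm, and their limit is f o Phi at every point. *)
Lemma composition_in_hardy f : exists G, forall z, G z = f (symbol z).
Proof.
pose u n := sval (cid (multiplier_hardy (multiplier_rect_sum (hardy_coef f) n.+1 n.+1))).
have uE n z : u n z = rect_sum (hardy_coef f) (val (symbol z)) n.+1 n.+1.
  by rewrite /u; case: cid.
pose g n := sval (cid (hardy_truncate f n.+1)).
have [gc gE] : (forall n, hardy_coef (g n) = truncate (hardy_coef f) n.+1 n.+1) /\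
    (forall n z, g n z = rect_sum (hardy_coef f) (val z) n.+1 n.+1).
  by split=> n; rewrite /g; case: cid => ? [].
have g1 n m : hardy_norm (g m - g n) <= hardy_norm f + hardy_norm f.
  have gn k : hardy_norm (g k) <= hardy_norm f.
    apply: hardy_norm_le; first exact: hardy_norm_ge0.
    move=> l; rewrite gc; apply: le_trans (square_sum_hardy f l).
    apply: ler_sum => a _; apply: ler_sum => b _.
    by rewrite /truncate; case: ifP => // _; rewrite cnorm0 expr0n sqr_ge0.
  rewrite -hardy_cnormE; apply: le_trans (ler_cnormB _ _) _.
  by rewrite !hardy_cnormE lerD.
pose e n := (hardy_norm f + hardy_norm f) * (2048 * 16) * hardy_norm H / Num.sqrt n.+1%:R.
have e0 : e @ \oo --> (0 : R) by exact: cvg_div_sqrt.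
have s0 n : 0 < Num.sqrt (n.+1%:R : R) by rewrite sqrtr_gt0 ltr0n.
have ue n m : (n <= m)%N -> hardy_norm (u m - u n) <= e n.
  move=> nm; apply: (@le_trans _ _ (hardy_norm (g m - g n) * (2048 * 16) / Num.sqrt n.+1%:R * hardy_norm H)).
    apply: hardy_norm_le_pointwise.
      apply: divr_ge0; last exact: sqrtr_ge0.
      by apply: mulr_ge0; [exact: hardy_norm_ge0|by apply: mulr_ge0; exact: ler0n].
    move=> z; rewrite hardyB !uE -!gE -hardyB; apply: composition_value_tail => // j k jn kn.
    rewrite hardy_coefB !gc -[LHS]/(truncate _ _ _ (j, k) - truncate _ _ _ (j, k)).
    by rewrite /truncate/= jn kn !(leq_trans _ (nm : (n.+1 <= m.+1)%N))// subrr.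
  rewrite /e mulrAC; apply: ler_wpM2r; first by rewrite invr_ge0 ltW.
  apply: ler_wpM2r; first exact: hardy_norm_ge0.
  by apply: ler_wpM2r; [by apply: mulr_ge0; exact: ler0n|exact: g1].
have [G GP] := hardy_complete e0 ue.
exists G => z.
have Gz : (fun n => u n z : R[i]^o) @ \oo --> (G z : R[i]^o).
  apply: cvg_hardy_value; apply: (squeeze_cvgr _ (cvg_cst 0) e0).
  by apply: nearW => n; rewrite hardy_norm_ge0 GP.
apply: (cvg_unique_c Gz); under eq_cvg do rewrite uE.
exact: (@cvg_rect_sum R f (symbol z) succn succn leqnSn leqnSn).
Qed.

Lemma composition_operator_exists : exists C : {linear hardy R -> hardy R},
  forall f z, C f z = f (symbol z).
Proof.
pose C f := sval (cid (composition_in_hardy f)).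
have CE f z : C f z = f (symbol z) by rewrite /C; case: cid.
have linC : linear C.
  by move=> a f g; apply: hardy_ext => z; rewrite hardyD hardyZ !CE hardyD hardyZ.
by have [C' C'E] := linear_exists linC; exists C' => f z; rewrite C'E CE.
Qed.

Variable C : {linear hardy R -> hardy R}.
Hypothesis CE : forall f z, C f z = f (symbol z).

Lemma composition_norm_le f : hardy_norm (C f) <= 1024 * hardy_norm H * hardy_norm f.
Proof.
rewrite (_ : 1024 * _ * _ = hardy_norm f * 1024 * hardy_norm H); last by rewrite mulrC mulrA.
apply: hardy_norm_le_pointwise; first by apply: mulr_ge0; [exact: hardy_norm_ge0|exact: ler0n].
by move=> z; rewrite CE; exact: composition_value_le.
Qed.

Lemma composition_norm_tail f N : (0 < N)%N ->
  (forall j k, (j < N)%N -> (k < N)%N -> hardy_coef f (j, k) = 0) ->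
  hardy_norm (C f) <= hardy_norm f * (2048 * 16) / Num.sqrt N%:R * hardy_norm H.
Proof.
move=> N0 f0; apply: hardy_norm_le_pointwise.
  apply: divr_ge0; last exact: sqrtr_ge0.
  by apply: mulr_ge0; [exact: hardy_norm_ge0|by apply: mulr_ge0; exact: ler0n].
by move=> z; rewrite CE; exact: composition_value_tail.
Qed.

End composition.

(** * Approximation numbers and compactness *)

Section approximation_numbers.
Context {R : realType} {V W : normedModType R[i]}.
Implicit Types S T : {linear V -> W}.

Lemma operator_norm_ge0 (T : V -> W) : 0 <= operator_norm T.
Proof.
rewrite /operator_norm; set A := [set _ | _ in _].
have [sA|nA] := pselect (has_sup A); last by rewrite sup_out.
have [[x Ax] _] := sA; apply: (@le_trans _ _ x); last exact: sup_upper_bound.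
by case: Ax => v _ <-; exact: cnorm_ge0.
Qed.

Lemma operator_norm_le (T : V -> W) (e : R) :
  (forall x, cnorm x <= 1 -> cnorm (T x) <= e) -> operator_norm T <= e.
Proof.
move=> Te; apply: ge_sup => [|_ [x x1 <-]]; last exact: Te.
by exists (cnorm (T 0)); exists 0 => //=; rewrite cnorm0.
Qed.

(** Boundedness is essential: [sup] of an unbounded set is 0. *)
Lemma operator_norm_ge (T : V -> W) (M : R) (x : V) :
  (forall y, cnorm (T y) <= M * cnorm y) ->
  cnorm x <= 1 -> cnorm (T x) <= operator_norm T.
Proof.
move=> TM x1; apply: sup_upper_bound; last by exists x.
split; first by exists (cnorm (T x)); exists x.
exists `|M| => _ [y y1 <-]; apply: le_trans (TM y) _.
by have := ler_norm M; have := cnorm_ge0 y; have := normr_ge0 M; move: y1 => /=; nra.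
Qed.

Lemma approximation_number_le T S n (e : R) :
  bounded_operator S -> rank_lt S n ->
  (forall x, cnorm x <= 1 -> cnorm (T x - S x) <= e) ->
  approximation_number n T <= e.
Proof.
move=> bS rS TS; apply: (@le_trans _ _ (operator_norm (T \- S))).
  apply: ge_inf; last by exists S.
  by exists 0 => _ [U _ <-]; exact: operator_norm_ge0.
exact: operator_norm_le.
Qed.

Lemma approximation_number_ge T n (e : R) : (0 < n)%N ->
  (forall S, bounded_operator S -> rank_lt S n -> e <= operator_norm (T \- S)) ->
  e <= approximation_number n T.
Proof.
move=> n0 TS; apply: lb_le_inf => [|_ [S [bS rS] <-]]; last exact: TS.
(* The infimum must range over a nonempty set; the zero operator, of rank 0 < n, belongs to it. *)
have lin0 : linear (fun _ : V => 0 : W) by move=> a x y; rewrite scaler0 addr0.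
have [Z ZE] := linear_exists lin0.
exists (operator_norm (T \- Z)); exists Z => //; split.
  by exists 0 => x; rewrite ZE cnorm0 mul0r.
by exists 0%N, (fun=> 0); split=> // x; exists (fun=> 0); rewrite ZE big_ord0.
Qed.

End approximation_numbers.

Section finite_rank.
Context {R : realType} {V W : lmodType R[i]}.
Implicit Types S : V -> W.

(** Stated for plain functions and exactly n vectors, so that ranks of sums add without carrying
    linearity along. *)
Definition rank_le S n := exists e : 'I_n -> W,
  forall x, exists a : 'I_n -> R[i], S x = \sum_i a i *: e i.

Lemma rank_leD S S' m n : rank_le S m -> rank_le S' n ->
  rank_le (fun x => S x + S' x) (m + n).
Proof.
move=> [e eE] [e' eE'].
exists (fun i => match fintype.split i with inl j => e j | inr j => e' j end) => x.
have [a aE] := eE x; have [a' aE'] := eE' x.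
exists (fun i => match fintype.split i with inl j => a j | inr j => a' j end).
rewrite big_split_ord/= aE aE'; congr (_ + _); apply: eq_bigr => i _.
  by rewrite (unsplitK (inl i)).
by rewrite (unsplitK (inr i)).
Qed.

Lemma rank_le_sum (S : nat -> V -> W) (r : nat -> nat) n :
  (forall k, rank_le (S k) (r k)) ->
  rank_le (fun x => \sum_(k < n) S k x) (\sum_(k < n) r k).
Proof.
move=> Sr; elim: n => [|n IH].
  by rewrite big_ord0; exists (fun=> 0) => x; exists (fun=> 0); rewrite !big_ord0.
have [e eE] := rank_leD IH (Sr n); rewrite big_ord_recr/=.
by exists e => x; have [a aE] := eE x; exists a; rewrite big_ord_recr.
Qed.

End finite_rank.

Lemma rank_le_comp (R : realType) (V W X : lmodType R[i]) (S : V -> W)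
  (T : {linear W -> X}) n : rank_le S n -> rank_le (fun x => T (S x)) n.
Proof.
move=> [e eE]; exists (fun i => T (e i)) => x; have [a aE] := eE x; exists a.
by rewrite aE linear_sum; apply: eq_bigr => i _; rewrite linearZ.
Qed.

(** * Compactness from uniformly small tails *)

Section compactness.
Context {R : realType}.
Implicit Types (f g : hardy R).

Lemma ultra_fmap (T U : Type) (u : T -> U) (F : set_system T) :
  UltraFilter F -> UltraFilter (u @ F).
Proof.
move=> FU; split; first exact: fmap_proper_filter.
move=> G GF sFG; rewrite predeqE => A; split; last exact: sFG.
move=> GA; have [//|FnA] := in_ultra_setVsetC (u @^-1` A) FU.
have GnA : G (~` A) by exact: sFG.
by have /filter_ex[? []] : G (A `&` ~` A) by exact: filterI.
Qed.

Lemma ultra_bounded_cvg (T : Type) (F : set_system T) (u : T -> R) :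
  UltraFilter F -> F [set y | `|u y| <= 1] ->
  exists l : R, u @ F --> l.
Proof.
move=> FU uF.
have := @segment_compact R (-1) 1; rewrite compact_ultra => /(_ (u @ F) (ultra_fmap u FU)).
case.
  suff : F [set y | `[-1, 1]%classic (u y)] by [].
  by apply: filterS uF => y /=; rewrite ler_norml => uy; rewrite in_itv.
by move=> l [_ ul]; exists l.
Qed.

(** Take an ultrafilter on the image of the unit ball. The coefficients of chosen preimages are
    bounded, so each converges along it without any diagonal extraction, and the limits form some f
    in the ball. Then C (f - s y) has a high part, small by the tail bound, and finitely many low
    coefficients, small along the filter: C f is the limit. *)
Lemma compact_of_tail_bound (C : {linear hardy R -> hardy R}) (M K : R) :
  (forall f, hardy_norm (C f) <= M * hardy_norm f) ->
  (forall f N, (0 < N)%N ->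
    (forall j k, (j < N)%N -> (k < N)%N -> hardy_coef f (j, k) = 0) ->
    hardy_norm (C f) <= hardy_norm f * K / Num.sqrt N%:R) ->
  compact_operator C.
Proof.
move=> CM CK; apply: compact_precompact; first exact: norm_hausdorff.
set A := C @` _; rewrite compact_ultra => F FU FA.
have FF : Filter F by apply: filter_filter; exact: ultra_proper.
have s_ex y : exists g, A y -> cnorm g <= 1 /\ C g = y.
  have [[g g1 gy]|nAy] := pselect (A y); first by exists g.
  by exists 0 => /nAy.
pose s y := sval (cid (s_ex y)).
have sP y : A y -> cnorm (s y) <= 1 /\ C (s y) = y by rewrite /s; case: cid.
have bound y p : A y -> cnorm (hardy_coef (s y) p) <= 1.
  by move=> /sP[s1 _]; apply: le_trans (cnorm_coef_le _ _) _.
have re_ex p : exists l : R, (fun y => Re (hardy_coef (s y) p)) @ F --> l.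
  apply: ultra_bounded_cvg; apply: filterS FA => y Ay.
  by apply: le_trans (norm_Re_le _) (bound y p Ay).
have im_ex p : exists l : R, (fun y => Im (hardy_coef (s y) p)) @ F --> l.
  apply: ultra_bounded_cvg; apply: filterS FA => y Ay.
  by apply: le_trans (norm_Im_le _) (bound y p Ay).
pose c p : R[i] := Complex (sval (cid (re_ex p))) (sval (cid (im_ex p))).
have cre p : (fun y => Re (hardy_coef (s y) p)) @ F --> Re (c p) by rewrite /c/=; case: cid.
have cim p : (fun y => Im (hardy_coef (s y) p)) @ F --> Im (c p) by rewrite /c/=; case: cid.
have csum (G : nat -> hardy R -> R) (l : nat -> R) n :
    (forall j, G j @ F --> l j) ->
    (fun y => \sum_(j < n) G (nat_of_ord j) y) @ F --> \sum_(j < n) l (nat_of_ord j).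
  move=> Gl; elim: n => [|n IH].
    by under eq_cvg do rewrite big_ord0; rewrite big_ord0; exact: cvg_cst.
  by under eq_cvg do rewrite big_ord_recr; rewrite big_ord_recr; apply: cvgD.
have csq (d : nat * nat -> R[i]) n :
    (fun y => square_sum (hardy_coef (s y) - d) n) @ F --> square_sum (c - d) n.
  apply: (csum (fun j y => \sum_(k < n) cnorm ((hardy_coef (s y) - d) (j, nat_of_ord k)) ^+ 2)
     (fun j => \sum_(k < n) cnorm ((c - d) (j, nat_of_ord k)) ^+ 2)) => j.
  apply: (csum (fun k y => cnorm ((hardy_coef (s y) - d) (j, k)) ^+ 2)
     (fun k => cnorm ((c - d) (j, k)) ^+ 2)) => k.
  have E (e : nat * nat -> R[i]) : cnorm ((e - d) (j, k)) ^+ 2 =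
      (Re (e (j, k)) - Re (d (j, k))) * (Re (e (j, k)) - Re (d (j, k))) +
      (Im (e (j, k)) - Im (d (j, k))) * (Im (e (j, k)) - Im (d (j, k))).
    by rewrite cnorm_sqr -!expr2 -cReB -cImB.
  rewrite E; under eq_cvg do rewrite E.
  have hr : (fun y => Re (hardy_coef (s y) (j, k)) - Re (d (j, k))) @ F -->
      Re (c (j, k)) - Re (d (j, k)).
    by apply: cvgB; [exact: cre|exact: cvg_cst].
  have hi : (fun y => Im (hardy_coef (s y) (j, k)) - Im (d (j, k))) @ F -->
      Im (c (j, k)) - Im (d (j, k)).
    by apply: cvgB; [exact: cim|exact: cvg_cst].
  by apply: cvgD; apply: cvgM.
have c1 n : square_sum c n <= 1.
  have := csq 0 n; rewrite subr0 => h.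
  rewrite -(cvg_lim (@Rhausdorff R) h); apply: limr_le; first exact: cvgP h.
  apply: filterS FA => y /sP[s1 _]; rewrite subr0.
  apply: le_trans (square_sum_hardy _ _) _.
  by rewrite expr_le1 ?hardy_norm_ge0// -hardy_cnormE.
have [|f fc] := @hardy_exists R c.
  by apply: le_lt_trans (sq_sum_le_bound c1) _; rewrite ltry.
have f1 : hardy_norm f <= 1.
  by apply: hardy_norm_le => // n; rewrite fc expr1n.
exists (C f); split; first by exists f.
have dist g : hardy_norm g <= 1 -> hardy_norm (f - g) <= 2.
  move=> g1; rewrite -hardy_cnormE; apply: le_trans (ler_cnormB _ _) _.
  by rewrite !hardy_cnormE -[2]/(1 + 1) lerD.
have M0 : 0 <= `|M| by [].
have main (d : R) : 0 < d -> \forall y \near F, cnorm (C f - y) < d.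
  move=> d0.
  (* N bounds the high part g - t, of norm at most 2, by d / 2. The radius d / 2 / (|M| + 1) below
     does the same for the low part t. *)
  have [N0 N0P] : exists n : nat, 2 * `|K| / Num.sqrt n.+1%:R < d / 2.
    have [n nP] := (cvgR_epsP _ _).1 (cvg_div_sqrt (2 * `|K|)) _ (divr_gt0 d0 (ltr0n _ 2)).
    exists n; have := nP n (leqnn n); rewrite subr0; apply: le_lt_trans; exact: ler_norm.
  set N := N0.+1 in N0P.
  have e0 : 0 < (d / 2 / (`|M| + 1)) ^+ 2 by rewrite exprn_gt0// !divr_gt0// ltr_wpDl.
  have small : \forall y \near F, square_sum (hardy_coef (s y) - c) N < (d / 2 / (`|M| + 1)) ^+ 2.
    have := csq c N; rewrite subrr (_ : square_sum 0 N = 0); last first.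
      by rewrite /square_sum big1// => j _; rewrite big1// => k _; rewrite cnorm0 expr0n.
    move=> /cvgrPdist_lt/(_ _ e0); apply: filterS => y; rewrite sub0r normrN.
    by apply: le_lt_trans; exact: ler_norm.
  near=> y.
  have /sP[s1 sy] : A y by near: y.
  have sm : square_sum (hardy_coef (s y) - c) N < (d / 2 / (`|M| + 1)) ^+ 2 by near: y.
  pose g := f - s y; have [t [tc _]] := hardy_truncate g N.
  have gt : hardy_norm (g - t) <= 2.
    apply: hardy_norm_le => // n; rewrite hardy_coefB tc.
    apply: le_trans (square_sum_subtruncate _ _ _ _) _.
    apply: le_trans (square_sum_hardy _ _) _.
    by rewrite ler_pXn2r ?nnegrE ?hardy_norm_ge0// dist.
  have tn : hardy_norm t <= d / 2 / (`|M| + 1).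
    apply: hardy_norm_le => [|n]; first by rewrite !divr_ge0 ?addr_ge0// ltW.
    apply: le_trans (ltW sm).
    apply: (@le_trans _ _ (square_sum (hardy_coef t) (maxn n N))).
      by apply: le_square_sum; exact: leq_maxl.
    rewrite tc /g hardy_coefB fc /square_sum.
    rewrite [leRHS](big_ord_widen _ (fun j => \sum_(k < N) cnorm ((hardy_coef (s y) - c) (j, nat_of_ord k)) ^+ 2) (leq_maxr n N)).
    rewrite [leRHS]big_mkcond/=; apply: ler_sum => j _; rewrite /truncate/=.
    case: ifP => jN; last by rewrite big1// => k _; rewrite cnorm0 expr0n.
    rewrite [leRHS](big_ord_widen _ (fun k => cnorm ((hardy_coef (s y) - c) (nat_of_ord j, k)) ^+ 2) (leq_maxr n N)).
    rewrite [leRHS]big_mkcond/=; apply: ler_sum => k _.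
    case: ifP => kN; last by rewrite cnorm0 expr0n.
    by rewrite cnormBC.
  rewrite -sy -linearB -/g -[g](subrK t) linearD [d]splitr.
  apply: le_lt_trans (ler_cnormD _ _) _; rewrite !hardy_cnormE; apply: ltr_leD.
    apply: le_lt_trans N0P; apply: le_trans (CK (g - t) N isT _) _.
      move=> j k jN kN; rewrite hardy_coefB tc.
      rewrite -[LHS]/(hardy_coef g (j, k) - truncate (hardy_coef g) N N (j, k)).
      by rewrite /truncate/= jN kN subrr.
    rewrite ler_wpM2r ?invr_ge0 ?sqrtr_ge0//.
    apply: (@le_trans _ _ (hardy_norm (g - t) * `|K|)).
      by rewrite ler_wpM2l ?hardy_norm_ge0// ler_norm.
    by rewrite ler_wpM2r.
  apply: le_trans (CM t) _; apply: (@le_trans _ _ ((`|M| + 1) * hardy_norm t)).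
    rewrite ler_wpM2r ?hardy_norm_ge0// (le_trans (ler_norm M))// lerDl//.
  by rewrite mulrC -ler_pdivlMr// ltr_wpDl.
apply/cvgrPdist_lt => e e0.
have /complex_realP[d de] : e \is Num.real by rewrite realE ltW.
move: e0; rewrite de ltcR => /main; apply: filterS => y.
by rewrite -cnormE ltcR.
Unshelve. all: by end_near. Qed.

End compactness.

(** * Upper bound *)

Section zero_count.

(** The remainder 2 (L / 2^n) closes the induction: with m = L / 2^n, a step only uses m + 2 (m / 2)
    <= 2 m. *)
Lemma sum_divn_pow2 L n : (\sum_(i < n) L %/ 2 ^ i + 2 * (L %/ 2 ^ n) <= 2 * L)%N.
Proof.
elim: n => [|n IH]; first by rewrite big_ord0 expn0 divn1.
rewrite big_ord_recr/=; apply: leq_trans IH; rewrite -addnA leq_add2l.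
rewrite expnSr divnMA; set m := (L %/ 2 ^ n)%N.
by have := leq_trunc_div m 2; lia.
Qed.

Lemma sum_ltn m n : (\sum_(k < n) (k < m) = minn n m)%N.
Proof. by elim: n => [|n IH]; rewrite ?big_ord0 ?big_ord_recr/= ?IH; lia. Qed.

(** Summing over k first, depth i costs at most 1 for k = 0 and L / 2^i for the k >= 1; over all i
    this is L + 2 L. *)
Lemma zero_count_le L :
  (\sum_(k < L.+1) \sum_(i < L) (maxn k 1 * 2 ^ i <= L) <= 3 * L)%N.
Proof.
rewrite exchange_big/=.
apply: (@leq_trans (\sum_(i < L) (1 + L %/ 2 ^ i))%N); last first.
  rewrite big_split/= sum_nat_const card_ord muln1 mulSn leq_add2l.
  by apply: leq_trans (sum_divn_pow2 L L); exact: leq_addr.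
apply: leq_sum => i _; rewrite big_ord_recl leq_add//; first exact: leq_b1.
apply: (@leq_trans (\sum_(k < L) (k < L %/ 2 ^ i))%N).
  apply: leq_sum => k _; rewrite /= (maxn_idPl _)//.
  by rewrite leq_divRL ?expn_gt0.
by rewrite sum_ltn geq_minr.
Qed.

Context {R : realType}.

(* When [maxn k 1 * 2 ^ i > L], the k-th power of [psi] at scale i is small
   enough (for k = 0: the majorant is large enough) without any zero. *)
Definition zeros L k : seq R :=
  flatten [seq nseq L (zero_at i) | i <- iota 0 L & (maxn k 1 * 2 ^ i <= L)%N].

Lemma size_zeros L k : size (zeros L k) = (L * \sum_(i < L) (maxn k 1 * 2 ^ i <= L))%N.
Proof.
have gen (s : seq nat) : size (flatten [seq nseq L (zero_at i : R) | i <- s]) = (L * size s)%N.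
  by elim: s => [|i s IH]; rewrite /= ?muln0// size_cat size_nseq IH mulnS.
rewrite gen size_filter -sum1_count; congr (_ * _)%N.
have -> : iota 0 L = index_iota 0 L by rewrite /index_iota subn0.
by rewrite big_mkcond/= big_mkord; apply: eq_bigr => i _; case: leqP.
Qed.

Lemma zeros_bounds L k p : p \in zeros L k -> 0 <= p < 1.
Proof.
by move=> /flattenP[s /mapP[i _ ->]] /nseqP[-> _]; exact: zero_at_bounds.
Qed.

Lemma sum_size_zeros L : (\sum_(k < L.+1) size (zeros L k) <= 3 * L ^ 2)%N.
Proof.
under eq_bigr do rewrite size_zeros.
rewrite -big_distrr/= (_ : 3 * L ^ 2 = L * (3 * L))%N; last by lia.
by rewrite leq_mul2l zero_count_le orbT.
Qed.

Lemma prod_le1 (I : eqType) (s : seq I) (F : I -> R) :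
  (forall i, i \in s -> 0 <= F i <= 1) -> \prod_(i <- s) F i <= 1.
Proof.
move=> F01; suff : 0 <= \prod_(i <- s) F i <= 1 by case/andP.
elim: s F01 => [|i s IH] F01; first by rewrite big_nil ler01 lexx.
rewrite big_cons; have /andP[Fi0 Fi1] := F01 i (mem_head _ _).
have /andP[s0 s1] : 0 <= \prod_(i <- s) F i <= 1.
  by apply: IH => j js; apply: F01; rewrite inE js orbT.
by rewrite mulr_ge0//= mulr_ile1.
Qed.

(** The block of L copies of [zero_at i] gives q^L and the other factors are at most 1. The block is
    in the list, as 2^i <= L forces i < L. *)
Lemma prod_zeros_le L k i (F : R -> R) (q : R) :
  (forall p, p \in zeros L k -> 0 <= F p <= 1) -> F (zero_at i) <= q ->
  (maxn k 1 * 2 ^ i <= L)%N -> \prod_(p <- zeros L k) F p <= q ^+ L.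
Proof.
move=> F01 Fq ki.
have iL : (i < L)%N.
  apply: leq_trans (ltn_expl i (isT : 1 < 2)%N) _; apply: leq_trans ki.
  by rewrite leq_pmull// leq_max orbT.
have {}F01 j : j \in [seq j <- iota 0 L | (maxn k 1 * 2 ^ j <= L)%N] -> 0 <= F (zero_at j) <= 1.
  move=> jL; apply: F01; apply/flattenP; exists (nseq L (zero_at j)).
    by apply/mapP; exists j.
  by rewrite mem_nseq eqxx andbT; apply: leq_ltn_trans iL.
have iin : i \in [seq j <- iota 0 L | (maxn k 1 * 2 ^ j <= L)%N].
  by rewrite mem_filter ki mem_iota.
rewrite /zeros; move: iin F01; elim: [seq _ <- _ | _] => [//|j s IH].
have blk l : \prod_(p <- nseq L (zero_at l)) F p = F (zero_at l) ^+ L.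
  by rewrite big_nseq; elim: (L) => [|m IHm] //=; rewrite exprS IHm.
rewrite inE => ijs F01; rewrite /= big_cat/= blk.
have /andP[Fj0 Fj1] := F01 j (mem_head _ _).
have F01s l : l \in s -> 0 <= F (zero_at l) <= 1.
  by move=> ls; apply: F01; rewrite inE ls orbT.
have rest0 : 0 <= \prod_(p <- flatten [seq nseq L (zero_at l) | l <- s]) F p <= 1.
  elim: s F01s {IH ijs F01} => [|l s IH] Fs; first by rewrite big_nil ler01 lexx.
  rewrite /= big_cat/= blk; have /andP[Fl0 Fl1] := Fs l (mem_head _ _).
  have /andP[r0 r1] : 0 <= \prod_(p <- flatten [seq nseq L (zero_at l) | l <- s]) F p <= 1.
    by apply: IH => m ms; apply: Fs; rewrite inE ms orbT.
  by rewrite mulr_ge0 ?exprn_ge0//= mulr_ile1 ?exprn_ge0 ?exprn_ile1.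
have /andP[r0 r1] := rest0.
case/orP: ijs => [/eqP ij|is_].
  rewrite -ij in Fj0 Fj1 *.
  rewrite -[leRHS]mulr1; apply: ler_pM; rewrite ?exprn_ge0//.
  by rewrite ler_pXn2r ?nnegrE ?(leq_ltn_trans _ iL)// (le_trans Fj0).
rewrite -[leRHS]mul1r; apply: ler_pM; rewrite ?exprn_ge0 ?exprn_ile1//.
exact: IH is_ F01s.
Qed.

End zero_count.

Section upper_bound.
Context {R : realType}.
Implicit Types (f : hardy R) (z : bidisk R).

Variable H : hardy R.
Hypothesis H_majorant : forall z i, at_scale i (cnorm (1 - (val z).1)) ->
  4 ^+ (2 ^ i) / 16 <= cnorm (H z : R[i]).
Variable C : {linear hardy R -> hardy R}.
Hypothesis CE : forall f z, C f z = f (symbol z).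

Let q : R := contraction_rate.

Lemma contraction_rate_bounds : 2^-1 <= q < 1.
Proof. by rewrite /q /contraction_rate; apply/andP; split; lra. Qed.

(** If the zeros for (k, i) are present, b <= q^L. Otherwise k 2^i > L with k >= 1, and the power of
    a is below 2^-L <= q^L; or k = 0 and 2^i > L, where the factor 2^(2^i) makes up for the missing
    q^L. The spare 1/2 in the bound on a yields the summable 2^-k. *)
Lemma term_scale_le (a b : R) L k i : 0 <= a -> a <= 2^-1 ^+ (2 ^ i) / 2 -> 0 <= b -> b <= 1 ->
  ((maxn k 1 * 2 ^ i <= L)%N -> b <= q ^+ L) ->
  a ^+ k * b <= 2^-1 ^+ k * (2 ^+ (2 ^ i) * q ^+ L).
Proof.
move=> a0 ha b0 b1 hb; have /andP[q2 q1] := contraction_rate_bounds.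
have q0 : 0 < q by apply: lt_le_trans q2; rewrite invr_gt0 ltr0n.
have y1 := @pow2_ge1 R (2 ^ i).
have h0 : 0 <= (2^-1 : R) ^+ k by rewrite ltW ?pow2V_gt0.
have akk : a ^+ k <= (2^-1 ^+ (2 ^ i)) ^+ k * 2^-1 ^+ k.
  have b2 : 0 <= (2^-1 : R) ^+ (2 ^ i) / 2 by apply: le_trans a0 ha.
  by rewrite -exprMn; apply: lerXn2r.
have ak : a ^+ k <= 2^-1 ^+ k.
  by apply: le_trans akk _; rewrite ler_piMl// exprn_ile1 ?pow2V_le1// ltW// pow2V_gt0.
have [kL|kL] := leqP (maxn k 1 * 2 ^ i) L.
  apply: ler_pM; rewrite ?exprn_ge0//; apply: le_trans (hb kL) _.
  by rewrite ler_peMl// exprn_ge0// ltW.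
have hq m : (2^-1 : R) ^+ m <= q ^+ m.
  by apply: lerXn2r; rewrite ?nnegrE ?invr_ge0// ltW.
case: k kL {hb h0} akk ak => [|k] kL akk ak.
  rewrite !expr0 !mul1r; apply: le_trans b1 _.
  rewrite max0n mul1n in kL.
  apply: (@le_trans _ _ (2 ^+ (2 ^ i) * 2^-1 ^+ L)); last by rewrite ler_wpM2l ?exprn_ge0.
  rewrite -[leLHS](@pow2VK R (2 ^ i)) mulrC ler_wpM2l ?exprn_ge0//.
  by rewrite ler_wiXn2l ?invr_ge0 ?invf_le1 ?ler1n ?ltr0n// ltnW.
rewrite maxnC (maxn_idPr _)// in kL.
apply: (@le_trans _ _ (a ^+ k.+1)); first by rewrite ler_piMr// exprn_ge0.
apply: le_trans akk _; rewrite mulrC; apply: ler_wpM2l.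
  by rewrite ltW ?pow2V_gt0.
apply: (@le_trans _ _ (1 * q ^+ L)); last by rewrite ler_wpM2r// exprn_ge0// ltW.
rewrite mul1r -exprM; apply: le_trans (hq L).
by rewrite ler_wiXn2l ?invr_ge0 ?invf_le1 ?ler1n ?ltr0n// mulnC ltnW.
Qed.

(** The approximation of f precedes the composition, and its error need only be small on the range
    of Phi. The error comes from the residuals [T k (U k f)], and from the columns beyond L gathered
    in [V L.+1 f]. *)
Lemma finite_rank_approximation L : exists S : {linear hardy R -> hardy R},
  [/\ bounded_operator S, rank_le S (\sum_(k < L.+1) size (zeros L k : seq R))
    & forall f, hardy_norm (C f - S f) <= 5 * (64 * 16) * q ^+ L * hardy_norm f * hardy_norm H].
Proof.
have [U [V [U2 V1 Uone split_f]]] := @column_split R.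
pose T k := sval (cid (blaschke_residual (@zeros_bounds R L k))).
have TP k : [/\ forall F, hardy_norm (T k F) <= hardy_norm F,
    forall F z, cnorm (T k F z : R[i]) <=
      (\prod_(p <- zeros L k) cnorm (blaschke p (val z).1)) *
      (hardy_norm F * Num.sqrt (kernel_bound (val z) 0 0))
    & exists e : 'I_(size (zeros L k : seq R)) -> hardy R, forall F, one_variable F ->
      exists a : 'I_(size (zeros L k : seq R)) -> R[i], F - T k F = \sum_i a i *: e i].
  exact: svalP (cid (blaschke_residual (@zeros_bounds R L k))).
pose P k := sval (cid (multiplier_operator (multiplierX k (@multiplier_z2 R)))).
have PE k F z : P k F z = (val z).2 ^+ k * F z by rewrite /P; case: cid.
pose Q k f := U k f - T k (U k f).
pose s f := C (\sum_(k < L.+1) P k (Q k f)).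
have linQ k : linear (Q k).
  move=> a f g; rewrite /Q !(linearP (U k)) (linearP (T k)) scalerBr opprD addrACA.
  by [].
have lins : linear s.
  move=> a f g; rewrite /s -linearP; congr (C _); rewrite scaler_sumr -big_split/=.
  by apply: eq_bigr => k _; rewrite linQ linearP.
have [S SE] := linear_exists lins.
have q0 : 0 < q.
  have /andP[q2 _] := contraction_rate_bounds.
  by apply: lt_le_trans q2; rewrite invr_gt0 ltr0n.
have main f : hardy_norm (C f - S f) <= 5 * (64 * 16) * q ^+ L * hardy_norm f * hardy_norm H.
  apply: hardy_norm_le_pointwise.
    apply: mulr_ge0; last exact: hardy_norm_ge0.
    apply: mulr_ge0; last by rewrite exprn_ge0// ltW.
    by apply: mulr_ge0; [exact: ler0n|apply: mulr_ge0; exact: ler0n].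
  move=> z; rewrite SE /s -linearB CE.
  have [i ii] := scale_exists (cnorm_rhp_gt0 (Re_oneB_gt0 (bidisk1 z))).
  set w := symbol z; set y : R := 2 ^+ (2 ^ i).
  set K := Num.sqrt (kernel_bound (val w) 0 0).
  have K0 : 0 <= K by exact: sqrtr_ge0.
  have KK : K <= 64 * 2 ^+ i by exact: sqrt_kernel_phi (bidisk1 z) (bidisk2 z) ii.
  have res : (f - \sum_(k < L.+1) P k (Q k f)) w =
      \sum_(k < L.+1) (val w).2 ^+ k * T k (U k f) w + (val w).2 ^+ L.+1 * V L.+1 f w.
    rewrite hardyB hardy_sum (split_f L.+1 f w) addrAC; congr (_ + _).
    rewrite -sumrB; apply: eq_bigr => k _.
    by rewrite PE /Q hardyB mulrBr opprB addrCA subrr addr0.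
  have a0 : 0 <= cnorm ((val w).2 : R[i]) by exact: cnorm_ge0.
  have ha : cnorm ((val w).2 : R[i]) <= 2^-1 ^+ (2 ^ i) / 2.
    rewrite val_symbol cnormM; apply: le_trans (psi_scale (bidisk1 z) ii).
    by rewrite ler_piMr ?cnorm_ge0// ltW ?bidisk2.
  have phi1 : cnorm ((val w).1 : R[i]) < 1 by exact: bidisk1.
  have B01 k p : p \in (zeros L k : seq R) -> 0 <= cnorm (blaschke p (val w).1) <= 1.
    move=> /zeros_bounds/andP[p0 p1].
    by rewrite cnorm_ge0 cnorm_blaschke_le1.
  have prod0 k : 0 <= \prod_(p <- zeros L k) cnorm (blaschke p (val w).1).
    by apply: prodr_ge0 => p _; exact: cnorm_ge0.
  have term k : cnorm ((val w).2 ^+ k * T k (U k f) w : R[i]) <=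
      2^-1 ^+ k * (y * q ^+ L) * (2 * (hardy_norm f * K)).
    rewrite cnormM cnormX; have [_ TB _] := TP k.
    apply: (@le_trans _ _ (cnorm ((val w).2 : R[i]) ^+ k *
      ((\prod_(p <- zeros L k) cnorm (blaschke p (val w).1)) * (2 * (hardy_norm f * K))))).
      apply: ler_wpM2l; first by rewrite exprn_ge0.
      apply: le_trans (TB _ w) _; apply: ler_wpM2l => //.
      by rewrite mulrA; apply: ler_wpM2r.
    rewrite mulrA; apply: ler_wpM2r; first by rewrite !mulr_ge0 ?hardy_norm_ge0.
    apply: term_scale_le => //; first by apply: prod_le1 => p; exact: B01.
    move=> ki; apply: (@prod_zeros_le R L k i (fun p => cnorm (blaschke p (val w).1))) ki => //.
      exact: B01.
    by rewrite val_symbol; exact: blaschke_phi_scale (bidisk1 z) ii.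
  (* Here k = L + 1, so k 2^i > L at every scale: [term_scale_le] applies with b = 1 and no
     zeros. *)
  have last_term : cnorm ((val w).2 ^+ L.+1 * V L.+1 f w : R[i]) <=
      2^-1 ^+ L.+1 * (y * q ^+ L) * (hardy_norm f * K).
    rewrite cnormM cnormX; apply: ler_pM; rewrite ?exprn_ge0 ?cnorm_ge0//.
      rewrite -[leLHS]mulr1; apply: term_scale_le => //.
      by rewrite maxnC (maxn_idPr _)// leqNgt (leq_trans (ltnSn L))// leq_pmulr// expn_gt0.
    by apply: le_trans (hardy_value_le _ w) _; apply: ler_wpM2r.
  have yq0 : 0 <= y * q ^+ L by rewrite mulr_ge0 ?exprn_ge0// ltW.
  have fK0 : 0 <= hardy_norm f * K by rewrite mulr_ge0 ?hardy_norm_ge0.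
  have geo : \sum_(k < L.+1) (2^-1 : R) ^+ k <= 2.
    have h0 : 0 <= (2^-1 : R) by rewrite invr_ge0 ler0n.
    have h1 : (2^-1 : R) < 1 by rewrite invf_lt1 ?ltr1n ?ltr0n.
    by apply: le_trans (geometric_sum_le L.+1 h0 h1) _; rewrite (_ : 1 - 2^-1 = 2^-1) ?invrK//; field.
  (* 5 = 2 * 2 + 1: the geometric sum times the norm 2 of [U k], plus the last term. *)
  have total : cnorm ((f - \sum_(k < L.+1) P k (Q k f)) w : R[i]) <=
      5 * (y * q ^+ L) * (hardy_norm f * K).
    rewrite res; apply: le_trans (ler_cnormD _ _) _.
    apply: (@le_trans _ _ (\sum_(k < L.+1) (2^-1 ^+ k * (y * q ^+ L) * (2 * (hardy_norm f * K))) +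
        2^-1 ^+ L.+1 * (y * q ^+ L) * (hardy_norm f * K))).
      apply: lerD last_term; apply: le_trans (ler_cnorm_sum _ _ _) _.
      by apply: ler_sum => k _; exact: term.
    rewrite -!mulr_suml.
    have l1 := @pow2V_le1 R L.+1.
    have m0 : 0 <= (y * q ^+ L) * (hardy_norm f * K) by rewrite mulr_ge0.
    have := ler_wpM2r m0 geo; have := ler_wpM2r m0 l1.
    move: (\sum_(k < L.+1) _) (y * q ^+ L) (hardy_norm f * K) => S' A B; lra.
  apply: le_trans total _.
  (* K <= 64 * 2^i <= 64 y, and y^2 = 4^(2^i) is what the majorant dominates. *)
  have KyH : K * y <= 64 * 16 * cnorm (H z : R[i]).
    have hy : 2 ^+ i <= y by rewrite /y ler_eXn2l ?ltr1n// ltnW// ltn_expl.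
    have yy : y * y <= 16 * cnorm (H z : R[i]).
      have := H_majorant ii; rewrite /y -exprMn -natrM => h.
      by rewrite mulrC -ler_pdivrMr.
    have y0 : 0 <= y by rewrite exprn_ge0.
    apply: le_trans (ler_wpM2r y0 KK) _; rewrite -!mulrA.
    apply: ler_wpM2l; first exact: ler0n.
    by apply: le_trans yy; exact: ler_wpM2r.
  have fq : 0 <= hardy_norm f * q ^+ L by rewrite mulr_ge0 ?hardy_norm_ge0 ?exprn_ge0// ltW.
  have -> : 5 * (y * q ^+ L) * (hardy_norm f * K) = 5 * (hardy_norm f * q ^+ L * (K * y)).
    by ring.
  have -> : 5 * (64 * 16) * q ^+ L * hardy_norm f * cnorm (H z : R[i]) =
      5 * (hardy_norm f * q ^+ L * (64 * 16 * cnorm (H z : R[i]))) by ring.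
  by apply: ler_wpM2l; [exact: ler0n|exact: ler_wpM2l fq _ _ KyH].
exists S; split=> //.
- exists (1024 * hardy_norm H + 5 * (64 * 16) * q ^+ L * hardy_norm H) => f.
  rewrite !hardy_cnormE -[S f](subKr (C f)) -hardy_cnormE.
  apply: le_trans (ler_cnormB _ _) _; rewrite !hardy_cnormE.
  have := composition_norm_le H_majorant CE f; have := main f.
  move: (hardy_norm (C f)) (hardy_norm (C f - S f)) (hardy_norm H) (hardy_norm f) (q ^+ L).
  by move=> a b h g ql ha hb; lra.
- have : rank_le (fun f => C (\sum_(k < L.+1) P k (Q k f))) (\sum_(k < L.+1) size (zeros L k : seq R)).
    apply: rank_le_comp; apply: (@rank_le_sum _ _ _ (fun k f => P k (Q k f)) (fun k => size (zeros L k : seq R))).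
    move=> k; apply: rank_le_comp; have [_ _ [e eE]] := TP k.
    by exists e => f; exact: eE (Uone k f).
  by move=> [e eE]; exists e => f; rewrite SE; exact: eE.
Qed.

End upper_bound.

Section exponential_upper_bound.
Context {R : realType}.
Variable H : hardy R.
Hypothesis H_majorant : forall z i, at_scale i (cnorm (1 - (val z).1)) ->
  4 ^+ (2 ^ i) / 16 <= cnorm (H z : R[i]).
Variable C : {linear hardy R -> hardy R}.
Hypothesis CE : forall (f : hardy R) z, C f z = f (symbol z).

Lemma rank_level_exists n : (0 < n)%N -> exists L, (3 * L ^ 2 < n <= 3 * L.+1 ^ 2)%N.
Proof.
move=> n0; have ex : exists L, (3 * L ^ 2 < n)%N by exists 0%N.
have bd L : (3 * L ^ 2 < n)%N -> (L <= n)%N by nia.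
case: (ex_maxnP ex bd) => L Ln Lmax; exists L; rewrite Ln/= leqNgt.
by apply/negP => /Lmax; rewrite ltnn.
Qed.

Lemma exponential_upper_bound : exists a b : R, [/\ 0 < a, 0 < b &
  forall n, (1 <= n)%N -> approximation_number n C <= a * expR (- b * Num.sqrt n%:R)].
Proof.
have /andP[q2 q1] := @contraction_rate_bounds R.
set q : R := contraction_rate in q2 q1.
have q0 : 0 < q by apply: lt_le_trans q2; rewrite invr_gt0 ltr0n.
have lnq : ln q < 0 by apply: ln_lt0; rewrite q0.
pose A := 5 * (64 * 16) * hardy_norm H + 1.
have A0 : 0 < A.
  apply: ltr_wpDl => //; apply: mulr_ge0; last exact: hardy_norm_ge0.
  by apply: mulr_ge0; [exact: ler0n|apply: mulr_ge0; exact: ler0n].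
(* From n <= 3 (L + 1)^2 one gets sqrt n <= 2 (L + 1), so q^L = q^(L+1) / q is at most exp((ln q)
   sqrt n / 2) / q. *)
exists (A / q), (- ln q / 2); split; [exact: divr_gt0|by rewrite divr_gt0// oppr_gt0|].
move=> n n0; have [L /andP[Ln nL]] := rank_level_exists n0.
have [S [bS rS SC]] := finite_rank_approximation H_majorant CE L.
have qL0 : 0 <= q ^+ L by rewrite exprn_ge0// ltW.
apply: (@le_trans _ _ (A * q ^+ L)).
  apply: (@approximation_number_le _ _ _ C S) => //.
    have [e eE] := rS; exists (\sum_(k < L.+1) size (zeros L k : seq R))%N, e.
    by split=> //; apply: leq_ltn_trans Ln; exact: sum_size_zeros.
  move=> f; rewrite !hardy_cnormE => f1; apply: le_trans (SC f) _.
  apply: (@le_trans _ _ (5 * (64 * 16) * q ^+ L * 1 * hardy_norm H)).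
    apply: ler_wpM2r; first exact: hardy_norm_ge0.
    apply: ler_wpM2l; last exact: f1.
    apply: mulr_ge0; last exact: qL0.
    by apply: mulr_ge0; [exact: ler0n|apply: mulr_ge0; exact: ler0n].
  rewrite mulr1 mulrAC; apply: ler_wpM2r; first exact: qL0.
  by rewrite /A; apply: ler_wpDr.
rewrite -mulrA; apply: ler_wpM2l; first exact: ltW.
rewrite mulrC ler_pdivlMr// -exprSr -[q in leLHS]lnK ?posrE// -expRM_natl ler_expR.
have sn : Num.sqrt (n%:R : R) <= 2 * L.+1%:R.
  rewrite -[leRHS]ger0_norm ?mulr_ge0 ?ler0n// -sqrtr_sqr ler_wsqrtr//.
  rewrite exprMn -!natrX -natrM ler_nat; apply: leq_trans nL _.
  by rewrite leq_mul2r orbT.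
by have := ler_wnM2l (ltW lnq) sn; lra.
Qed.

End exponential_upper_bound.

(** * From approximation numbers to the parameters beta *)

Section limits_of_roots.
Context {R : realType}.
Local Open Scope ereal_scope.

Lemma limn_esup_le (u : nat -> \bar R) l :
  (exists N, forall n, (N <= n)%N -> u n <= l) -> limn_esup u <= l.
Proof.
move=> [N uN]; apply: (@le_trans _ _ (ereal_sup (u @` [set n | (N <= n)%N]))).
  by apply: ereal_inf_lbound; exists [set n | (N <= n)%N] => //; exists N.
by apply: ge_ereal_sup => _ [n Nn <-]; exact: uN.
Qed.

Lemma limn_einf_ge (u : nat -> \bar R) l :
  (exists N, forall n, (N <= n)%N -> l <= u n) -> l <= limn_einf u.
Proof.
move=> [N uN]; rewrite /limn_einf leeNr; apply: limn_esup_le; exists N => n Nn.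
by rewrite leeN2; exact: uN.
Qed.

End limits_of_roots.

Section beta_parameters.
Context {R : realType} {V W : normedModType R[i]} (T : {linear V -> W}).

Lemma approximation_number_ge0 n : (0 < n)%N -> 0 <= approximation_number n T.
Proof. by move=> n0; apply: approximation_number_ge => // S _ _; exact: operator_norm_ge0. Qed.

Lemma beta2_plus_lt1 (a b : R) : 0 < a -> 0 < b ->
  (forall n, (1 <= n)%N -> approximation_number n T <= a * expR (- b * Num.sqrt n%:R)) ->
  (beta2_plus T < 1)%E.
Proof.
move=> a0 b0 Tab; apply: (@le_lt_trans _ _ (expR (- b / 2))%:E); last first.
  by rewrite lte_fin expR_lt1 mulNr oppr_lt0 divr_gt0.
apply: limn_esup_le.
(* From N on, half of the exponent absorbs the constant a; the other half gives the limit
   exp(-b/2). *)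
have [N NP] : exists N : nat, ln a <= b / 2 * N%:R.
  exists (Num.truncn (ln a / (b / 2))).+1.
  rewrite mulrC -ler_pdivrMr ?divr_gt0//; apply: ltW; exact: truncnS_gt.
exists N.+1 => n Nn; have n0 : (0 < n)%N by apply: leq_trans Nn.
rewrite lee_fin.
have n0R : 0 < (n%:R : R) by rewrite ltr0n.
have h : approximation_number (n ^ 2) T <= (expR (- b / 2)) `^ n%:R.
  rewrite powR_mulrn ?expR_ge0// -expRM_natl.
  apply: le_trans (Tab _ _) _; first by rewrite expn_gt0 n0.
  rewrite natrX sqrtr_sqr ger0_norm ?ler0n// -{1}(lnK (x := a)) ?posrE// -expRD ler_expR.
  have : b / 2 * N%:R <= b / 2 * n%:R.
    by apply: ler_wpM2l; [exact/ltW/divr_gt0|rewrite ler_nat ltnW].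
  by move: NP; move: (ln a) (n%:R) (N%:R) => x y w; lra.
have := ge0_ler_powR (r := n%:R^-1) _ _ _ h.
rewrite -powRrM divff ?gt_eqF// powRr1 ?expR_ge0//; apply.
- by rewrite invr_ge0 ler0n.
- by rewrite nnegrE approximation_number_ge0// expn_gt0 n0.
- by rewrite nnegrE powR_ge0.
Qed.

Lemma beta2_minus_gt0 (c : R) : 0 < c ->
  (forall n, (0 < n)%N -> c ^+ n <= approximation_number (n ^ 2) T) ->
  (0 < beta2_minus T)%E.
Proof.
move=> c0 Tc; apply: (@lt_le_trans _ _ c%:E); first by rewrite lte_fin.
apply: limn_einf_ge; exists 1%N => n n0; rewrite lee_fin.
have := ge0_ler_powR (r := n%:R^-1) _ _ _ (Tc n n0).
rewrite -powR_mulrn ?(ltW c0)// -powRrM divff ?pnatr_eq0 -?lt0n// powRr1 ?(ltW c0)//; apply.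
- by rewrite invr_ge0 ler0n.
- by rewrite nnegrE powR_ge0.
- by rewrite nnegrE approximation_number_ge0// expn_gt0 n0.
Qed.

End beta_parameters.

(** * Lower bound *)

Section local_expansion.
Context {R : realType}.
Implicit Types (x y z w : R[i]).

(** The derivative of [cusp_sum n] at x = 1; its limit is the derivative of phi at 0. *)
Definition slope_sum n : R := \sum_(i < n) weight i * (knot i / (1 + knot i) ^+ 2).

Lemma slope_term_bounds i : 0 < (knot i : R) / (1 + knot i) ^+ 2 <= 1.
Proof.
have k0 := @knot_gt0 R i; have d0 : 0 < (1 + knot i : R) ^+ 2 by rewrite exprn_gt0// addr_gt0.
rewrite divr_gt0//= ler_pdivrMr// mul1r expr2; nra.
Qed.

Lemma slope_exists : exists2 s : R, 0 < s & slope_sum @ \oo --> s.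
Proof.
have close n m : (n <= m)%N -> `|slope_sum m - slope_sum n| <= 2 * weight n.
  move=> nm; rewrite /slope_sum -!(big_mkord xpredT (fun i => weight i * (knot i / (1 + knot i) ^+ 2))).
  rewrite (big_cat_nat (leq0n n) nm)/= addrAC subrr add0r.
  rewrite ger0_norm; last first.
    by apply: sumr_ge0 => i _; rewrite mulr_ge0 ?weight_ge0//; have /andP[/ltW] := slope_term_bounds i.
  apply: (@le_trans _ _ (\sum_(n <= i < m) weight i)).
    apply: ler_sum => i _; rewrite ler_piMr ?weight_ge0//.
    by have /andP[_] := slope_term_bounds i.
  by rewrite sum_weight// gerBl mulr_ge0// weight_ge0.
have /cvg_ex[/= s ss] := cauchy_rate_cvgR (@cvg_2weight R) close.
exists s => //; have h0 : 0 < (weight 0 : R) * (knot 0 / (1 + knot 0) ^+ 2).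
  by rewrite mulr_gt0 ?weight_gt0//; have /andP[] := slope_term_bounds 0.
apply: lt_le_trans h0 _; rewrite -(cvg_lim (@Rhausdorff R) ss); apply: limr_ge; first exact: cvgP ss.
exists 1%N => // n /= n0; rewrite /slope_sum; case: n n0 => [//|n] _.
rewrite big_ord_recl lerDl; apply: sumr_ge0 => i _.
by rewrite mulr_ge0 ?weight_ge0//; have /andP[/ltW] := slope_term_bounds (lift ord0 i).
Qed.

(** The error is the linear term times ((1 + t) (z + y) - z y) / P. The radius 1/10 keeps this
    quotient below 1/2 for every t, so the estimates can be summed with the positive weights. *)
Lemma resolvent_expansion (t : R) z y : 0 < t -> cnorm z <= 10^-1 -> cnorm y <= 10^-1 ->
  cnorm ((1 - y) / (1 - y + t%:C) - (1 - z) / (1 - z + t%:C)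
    - (t / (1 + t) ^+ 2)%:C * (z - y)) <= t / (1 + t) ^+ 2 / 2 * cnorm (z - y).
Proof.
move=> t0 z1 y1; have a0 : 0 < 1 + t by rewrite addr_gt0.
have lt1 (u : R[i]) : cnorm u <= 10^-1 -> 0 < Re (1 - u).
  by move=> u1; apply: Re_oneB_gt0; lra.
have dz := addR_neq0 (lt1 _ z1) t0; have dy := addR_neq0 (lt1 _ y1) t0.
have aE : (1 : R[i]) + t%:C = (1 + t)%:C by rewrite rmorphD/= rmorph1.
have ac0 : (1 : R[i]) + t%:C != 0 by rewrite aE fmorph_eq0 gt_eqF.
pose P := (1 - y + t%:C) * (1 - z + t%:C).
have -> : (1 - y) / (1 - y + t%:C) - (1 - z) / (1 - z + t%:C)
    - (t / (1 + t) ^+ 2)%:C * (z - y) =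
    (t / (1 + t) ^+ 2)%:C * (z - y) * (((1 + t%:C) * (z + y) - z * y) / P).
  rewrite rmorphM fmorphV rmorphXn/= -aE /P.
  by field; rewrite dz dy ac0.
rewrite !cnormM cnormR_ge0; last by rewrite divr_ge0 ?exprn_ge0// ltW.
rewrite -!mulrA; apply: ler_wpM2l; first exact: ltW.
apply: ler_wpM2l; first by rewrite invr_ge0 exprn_ge0// ltW.
rewrite mulrC; apply: ler_wpM2r; first exact: cnorm_ge0.
have lo u : cnorm u <= 10^-1 -> 9 / 10 * (1 + t) <= cnorm (1 - u + t%:C).
  move=> u1; have -> : 1 - u + t%:C = (1 + t)%:C - u by rewrite -aE addrAC.
  have := ler_cnormD ((1 + t)%:C - u) u; rewrite subrK cnormR_ge0 ?(ltW a0)//; lra.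
rewrite cnormV ler_pdivrMr; last by rewrite cnorm_gt0 mulf_neq0.
have hP : (9 / 10 * (1 + t)) ^+ 2 <= cnorm P.
  rewrite /P cnormM expr2; apply: ler_pM; rewrite ?lo//; lra.
have hN : cnorm ((1 + t%:C) * (z + y) - z * y) <= (1 + t) * (2 / 10) + 100^-1.
  apply: le_trans (ler_cnormB _ _) _; rewrite !cnormM aE cnormR_ge0 ?(ltW a0)//.
  apply: lerD.
    by apply: ler_wpM2l; [exact: ltW|apply: le_trans (ler_cnormD _ _) _; lra].
  rewrite (_ : 100^-1 = 10^-1 * 10^-1 :> R); last by field.
  by apply: ler_pM; rewrite ?cnorm_ge0.
apply: le_trans hN _; apply: le_trans (ler_wpM2l _ hP); last by lra.
by rewrite expr2; nra.
Qed.

(** It has two uses: it separates the images of the interpolation nodes, and it drives the iteration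
    showing that phi is onto a neighbourhood of phi 0. *)
Lemma phi_expansion : exists2 s : R, 0 < s & forall z y,
  cnorm z <= 10^-1 -> cnorm y <= 10^-1 ->
  cnorm (phi z - phi y - s%:C * (z - y)) <= s / 2 * cnorm (z - y).
Proof.
have [s s0 ss] := slope_exists; exists s => // z y z1 y1.
have lt1 (u : R[i]) : cnorm u <= 10^-1 -> 0 < Re (1 - u).
  by move=> u1; apply: Re_oneB_gt0; lra.
pose u n := cusp_sum n (1 - y) - cusp_sum n (1 - z) - (slope_sum n)%:C * (z - y).
have uc : (u : nat -> R[i]^o) @ \oo --> (phi z - phi y - s%:C * (z - y) : R[i]^o).
  have -> : phi z - phi y = cusp (1 - y) - cusp (1 - z) by rewrite /phi; ring.
  have sc : (fun n => (slope_sum n)%:C * (z - y) : R[i]^o) @ \oo --> (s%:C * (z - y) : R[i]^o).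
    rewrite mulrC; under eq_cvg do rewrite mulrC; apply: cvgMl_c.
    apply/cvg_epsP => e e0; have [N NP] := (cvgR_epsP _ _).1 ss _ e0.
    by exists N => n /NP; rewrite -rmorphB cnormR.
  apply: cvgB sc; apply: cvgB; apply: cvg_cusp_sum; exact: lt1.
have ub n : cnorm (u n) <= slope_sum n / 2 * cnorm (z - y).
  rewrite /u /cusp_sum /slope_sum -sumrB rmorph_sum/= mulr_suml -sumrB !mulr_suml.
  apply: le_trans (ler_cnorm_sum _ _ _) _; apply: ler_sum => i _.
  rewrite -mulrBr rmorphM/= -[X in _ - X]mulrA -mulrBr cnormM cnormR_ge0 ?weight_ge0//.
  rewrite -!mulrA; apply: ler_wpM2l; first exact: weight_ge0.
  by have := resolvent_expansion (knot_gt0 i) z1 y1; rewrite /cusp_term -!mulrA.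
have rc : (fun n => slope_sum n / 2 * cnorm (z - y)) @ \oo --> s / 2 * cnorm (z - y).
  by apply: cvgMr_tmp; apply: cvgMr_tmp.
have lc := @cvg_cnorm R R[i]^o _ _ uc.
rewrite -(cvg_lim (@Rhausdorff R) rc) -[leLHS](cvg_lim (@Rhausdorff R) lc).
by apply: ler_lim; [exact: cvgP lc|exact: cvgP rc|apply: nearW => n; exact: ub].
Qed.

End local_expansion.

(** * Lagrange interpolation at perturbed roots of unity *)

Section lagrange.
Context {R : realType}.

(** The product is the modulus of the derivative of X^n - 1 at w^a, that is of n w^(a (n - 1)). *)
Lemma prim_root_diff_prod n (w : R[i]) (a : 'I_n) : n.-primitive_root w ->
  \prod_(i < n | i != a) cnorm (w ^+ a - w ^+ i) = n%:R.
Proof.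
move=> wn; have n0 : (0 < n)%N by apply: leq_ltn_trans (ltn_ord a).
have h : 'X^n - 1 = ('X - (w ^+ a)%:P) * \prod_(i < n | i != a) ('X - (w ^+ i)%:P).
  by rewrite -(factor_Xn_sub_1 wn) big_mkord (bigD1 a).
have := congr1 (fun p : {poly R[i]} => cnorm (p^`()).[w ^+ a]) h.
rewrite derivM !derivB derivXn derivX !derivC subr0 subr0 mul1r.
rewrite hornerD hornerM !hornerE subrr mul0r addr0 horner_prod.
under eq_bigr do rewrite !hornerE.
rewrite cnorm_prod => <-.
rewrite -mulr_natl hornerM hornerXn -polyC1 -polyCMn hornerC cnormM !cnormX.
rewrite (cnorm_prim_root n0 wn) !expr1n mulr1.
by rewrite -(rmorph_nat (real_complex R)) cnormR_ge0.
Qed.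

Definition lagrange_factor n (s : 'I_n -> R[i]) (a : 'I_n) (x : R[i]) : R[i] :=
  \prod_(i < n | i != a) ((x - s i) / (s a - s i)).

Lemma lagrange_eq n (s : 'I_n -> R[i]) a b : injective s ->
  lagrange_factor s a (s b) = (a == b)%:R.
Proof.
move=> sI; have [<-|ab] := eqVneq a b.
  rewrite /lagrange_factor big1// => i ia; rewrite divff// subr_eq0.
  by apply: contra_neq ia => /sI.
by rewrite /lagrange_factor (bigD1 b) ?(eq_sym b)//= subrr mul0r mul0r.
Qed.

(** Up to the factor k, each denominator dominates a difference of roots of unity, and the product
    of those differences is n >= 1. Small individual gaps thus cost nothing beyond the geometric
    factor. *)
Lemma lagrange_bound n (w : R[i]) (s : 'I_n -> R[i]) (k : R) a x :
  n.-primitive_root w -> 0 < k -> k <= 1 ->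
  (forall i j : 'I_n, k * cnorm (w ^+ i - w ^+ j) <= cnorm (s i - s j)) ->
  (forall i, cnorm (s i) <= 1) -> cnorm x <= 1 ->
  cnorm (lagrange_factor s a x) <= (2 / k) ^+ n.
Proof.
move=> wn k0 k1 ks s1 x1; have n0 : (0 < n)%N by apply: leq_ltn_trans (ltn_ord a).
have kk : 1 <= 2 / k by rewrite ler_pdivlMr// mul1r; lra.
have wne (i : 'I_n) : i != a -> 0 < cnorm (w ^+ a - w ^+ i).
  move=> ia; rewrite cnorm_gt0 subr_eq0 (eq_prim_root_expr wn) !modn_small//.
  by apply: contra_neq ia => /val_inj.
rewrite /lagrange_factor cnorm_prod.
apply: (@le_trans _ _ (\prod_(i < n | i != a) (2 / k * (cnorm (w ^+ a - w ^+ i))^-1))).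
  apply: ler_prod => i ia; rewrite cnorm_ge0 cnorm_div -mulrA -invfM.
  apply: ler_pM; rewrite ?cnorm_ge0 ?invr_ge0 ?cnorm_ge0//.
    by apply: le_trans (ler_cnormB _ _) _; have := s1 i; lra.
  rewrite lef_pV2 ?posrE ?ks// ?mulr_gt0 ?wne//.
  by apply: lt_le_trans (ks a i); rewrite mulr_gt0 ?wne.
rewrite big_split/= prodfV (prim_root_diff_prod a wn) prodr_const.
apply: (@le_trans _ _ ((2 / k) ^+ #|[pred i | i != a]| * 1)).
  by rewrite ler_wpM2l ?exprn_ge0 ?(le_trans _ kk)// invf_le1 ?ltr0n ?ler1n.
rewrite mulr1 ler_weXn2l//; apply: leq_trans (max_card _) _.
by rewrite card_ord.
Qed.

End lagrange.

Section lower_bound.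
Context {R : realType}.

(** The coordinates of the S (F i) form a matrix with more rows than columns; a nonzero row vector
    annihilates it. *)
Lemma finite_rank_kernel (V W : normedModType R[i]) (S : {linear V -> W})
  (I : finType) (F : I -> V) : rank_lt S #|I| ->
  exists2 y : I -> R[i], (exists i, y i != 0) & S (\sum_i y i *: F i) = 0.
Proof.
move=> [k [e [kI Se]]].
pose a (i : I) : 'I_k -> R[i] := sval (cid (Se (F i))).
have aE i : S (F i) = \sum_l a i l *: e l by rewrite /a; case: cid.
pose A : 'M[R[i]]_(#|I|, k) := \matrix_(r, l) a (enum_val r) l.
have : kermx A != 0.
  by rewrite -mxrank_eq0 mxrank_ker -lt0n subn_gt0 (leq_ltn_trans (rank_leq_col A)).
move=> /rowV0Pn[u /sub_kermxP uA u0].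
exists (fun i => u 0 (enum_rank i)).
  have /existsP[r ur] : [exists r, u 0 r != 0].
    apply: contra_neqT u0 => /existsPn h; apply/rowP => r; rewrite mxE.
    by have := h r; rewrite negbK => /eqP.
  by exists (enum_val r); rewrite enum_valK.
rewrite linear_sum; under eq_bigr do rewrite linearZ/= aE scaler_sumr.
rewrite exchange_big/= big1// => l _.
under eq_bigr do rewrite scalerA.
rewrite -scaler_suml; set c := \sum_i _.
suff -> : c = 0 by rewrite scale0r.
have := congr1 (fun M : 'rV_k => M 0 l) uA; rewrite !mxE => <-.
rewrite /c (reindex (@enum_val I predT))/=; last first.
  by apply: onW_bij; exact: enum_val_bij.
by apply: eq_bigr => r _; rewrite mxE enum_valK.
Qed.

Lemma argmax_exists (I : finType) (y : I -> R) : (exists i, 0 < y i) ->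
  exists2 j, 0 < y j & forall i, y i <= y j.
Proof.
move=> [i0 yi0]; case: (@Order.TotalTheory.arg_maxP _ _ I i0 xpredT y) => // j _ ymax.
by exists j => [|i]; [apply: lt_le_trans yi0 (ymax _ _)|exact: ymax].
Qed.

Lemma double_sqr_le n : (2 * n ^ 2 <= 8 ^ n)%N.
Proof.
elim: n => // n; have le_sqr : (n <= n * n)%N by case: n => // n; rewrite leq_pmulr.
rewrite (expnS 8) -!mulnn; have : (0 < 8 ^ n)%N by rewrite expn_gt0.
have -> : (n.+1 * n.+1 = n * n + 2 * n + 1)%N by lia.
by move: (8 ^ n)%N (n * n)%N le_sqr => e m; lia.
Qed.

Variable C : {linear hardy R -> hardy R}.
Hypothesis CE : forall (f : hardy R) z, C f z = f (symbol z).
Hypothesis C_bounded : bounded_operator C.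

(** The second nodes psi(u_a) v_b depend on a, so [F (a, b)] interpolates in z2 at the nodes of
    column a only. This suffices, since its first factor vanishes on all other columns. *)
Lemma interpolating_family : exists2 B : R, 1 <= B & forall n, (0 < n)%N ->
  exists (F : 'I_n * 'I_n -> hardy R) (z : 'I_n * 'I_n -> bidisk R),
    [/\ forall p, hardy_norm (F p) <= B ^+ n,
        forall p p', F p (symbol (z p')) = (p == p')%:R
      & forall p (f : hardy R), cnorm (f (z p) : R[i]) <= 2 * hardy_norm f].
Proof.
have [s s0 sP] := @phi_expansion R.
(* [phi_expansion] gives |phi u_i - phi u_j| >= (s / 2) |u_i - u_j|, and |u_i - u_j| is |w^i - w^j|
   / 10. In the second variable, 1/20 is the lower bound 1/10 of |psi| times the radius 1/2. *)
pose k := Num.min 1 (s / 20).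
have k0 : 0 < k by rewrite lt_min ltr01 divr_gt0.
have k1 : k <= 1 by rewrite ge_min lexx.
have ks : k <= s / 20 by rewrite ge_min lexx orbT.
exists (2 / k * (2 / 20^-1)) => [|n n0].
  rewrite -[1](mulr1 1); apply: ler_pM => //; last by rewrite ler_pdivlMr; lra.
  by rewrite ler_pdivlMr// mul1r; lra.
have [w wn] := @prim_root_exists R n n0.
have wX a : cnorm (w ^+ a) = 1 by rewrite cnormX (cnorm_prim_root n0 wn) expr1n.
have wI : injective (fun i : 'I_n => w ^+ i).
  move=> i j /eqP; rewrite (eq_prim_root_expr wn) !modn_small// => /eqP.
  exact: val_inj.
pose u (i : 'I_n) : R[i] := (10^-1)%:C * w ^+ i.
pose v (i : 'I_n) : R[i] := (2^-1)%:C * w ^+ i.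
have uN i : cnorm (u i) = 10^-1 by rewrite /u cnormM wX mulr1 cnormR_ge0 ?invr_ge0.
have vN i : cnorm (v i) = 2^-1 by rewrite /v cnormM wX mulr1 cnormR_ge0 ?invr_ge0.
have u1 i : cnorm (u i) < 1 by rewrite uN; lra.
have v1 i : cnorm (v i) < 1 by rewrite vN; lra.
have psi_lo i : 10^-1 <= cnorm (psi (u i)).
  rewrite cnorm_psi ler_pdivlMr//.
  have := ler_cnormD (1 - u i) (u i); rewrite subrK cnorm1 uN; lra.
have psi_n0 i : psi (u i) != 0 by rewrite -cnorm_gt0; apply: lt_le_trans (psi_lo i); lra.
pose s1 i := phi (u i).
pose s2 a b := psi (u a) * v b.
have s1_sep (i j : 'I_n) : k * cnorm (w ^+ i - w ^+ j) <= cnorm (s1 i - s1 j).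
  have := sP (u i) (u j); rewrite !uN lexx => /(_ isT isT).
  have := ler_cnormB (s1 i - s1 j) (s1 i - s1 j - s%:C * (u i - u j)); rewrite subKr.
  rewrite /s1 /u -mulrBr !cnormM cnormR_ge0 ?(ltW s0)// cnormR_ge0 ?invr_ge0//.
  have := ler_wpM2r (cnorm_ge0 (w ^+ i - w ^+ j)) ks.
  move: (cnorm (w ^+ i - w ^+ j)) (cnorm _) (cnorm _) => d e e'; lra.
have s2_sep a (i j : 'I_n) : 20^-1 * cnorm (w ^+ i - w ^+ j) <= cnorm (s2 a i - s2 a j).
  rewrite /s2 /v -!mulrBr (cnormM (psi _)) (cnormM (2^-1)%:C) cnormR_ge0 ?invr_ge0// mulrA.
  apply: ler_wpM2r; first exact: cnorm_ge0.
  by have := psi_lo a; lra.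
have s1I : injective s1.
  move=> i j ij; apply: wI; apply/eqP; rewrite -subr_eq0; apply/eqP/cnorm0_eq0/eqP.
  rewrite eq_le cnorm_ge0 andbT -(ler_pM2l k0) mulr0.
  by apply: le_trans (s1_sep i j) _; rewrite ij subrr cnorm0.
have s2I a : injective (s2 a).
  move=> i j; rewrite /s2 => /(mulfI (psi_n0 a)).
  by rewrite /v => /mulfI ij; apply: wI; apply: ij; rewrite fmorph_eq0 invr_eq0 pnatr_eq0.
have s1_le i : cnorm (s1 i) <= 1 by rewrite ltW// cnorm_phi_lt1.
have s2_le a b : cnorm (s2 a b) <= 1.
  by rewrite /s2 cnormM vN; have := cnorm_psi_le (u1 a); lra.
pose g (p : 'I_n * 'I_n) (z : bidisk R) : R[i] :=
  lagrange_factor s1 p.1 (val z).1 * lagrange_factor (s2 p.1) p.2 (val z).2.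
have gm p : multiplier (g p).
  apply: multiplierM; apply: multiplier_prod => i _;
    apply: multiplierM (multiplier_cst _); apply: multiplierB (multiplier_cst _).
    exact: multiplier_z1.
  exact: multiplier_z2.
pose F p := sval (cid (multiplier_hardy (gm p))).
have FE p z : F p z = g p z by rewrite /F; case: cid.
have zex p : exists z : bidisk R, val z = ((u p.1, v p.2) : R[i] * R[i]).
  by apply: bidisk_exists; rewrite /=.
pose z p := sval (cid (zex p)).
have zE p : val (z p) = (u p.1, v p.2) by rewrite /z; case: cid.
have [E [EE E1]] := @hardy_geometric R 0 (lexx _) ltr01.
exists F, z; split=> [p|p p'|p f].
- apply: (@le_trans _ _ ((2 / k * (2 / 20^-1)) ^+ n * hardy_norm E)).
    apply: hardy_norm_le_pointwise.
      by rewrite exprn_ge0// !mulr_ge0 ?invr_ge0 ?invr_ge0 ?ler0n// ltW.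
    move=> x; rewrite FE EE mul0r subr0 invr1 cnorm1 mulr1 /g cnormM exprMn.
    apply: ler_pM; rewrite ?cnorm_ge0//.
      by apply: (@lagrange_bound R n w s1 k p.1 (val x).1) => //; rewrite ltW ?bidisk1.
    apply: (@lagrange_bound R n w (s2 p.1) 20^-1 p.2 (val x).2) => //; try lra.
    by rewrite ltW ?bidisk2.
  rewrite ler_piMr//.
    by rewrite exprn_ge0// !mulr_ge0 ?invr_ge0 ?invr_ge0 ?ler0n// ltW.
  rewrite -(@ler_pXn2r _ 2) ?nnegrE ?hardy_norm_ge0//.
  by apply: le_trans E1 _; rewrite expr0n subr0 invr1 expr1n.
- rewrite FE /g val_symbol zE /= lagrange_eq//.
  have [e1|e1] := eqVneq p.1 p'.1.
    rewrite mul1r e1 lagrange_eq//; congr (_%:R); rewrite [in RHS](surjective_pairing p).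
    by rewrite [in RHS](surjective_pairing p') xpair_eqE e1 eqxx.
  rewrite mul0r; case: eqP => // e; by rewrite e eqxx in e1.
- apply: le_trans (hardy_value_le f (z p)) _; rewrite mulrC.
  apply: ler_wpM2r; first exact: hardy_norm_ge0.
  (* The kernel bound at radii 1/10 and 1/2 is 2 / ((99/100) (3/4)) <= 4. *)
  rewrite -[leRHS]ger0_norm// -sqrtr_sqr ler_wsqrtr// /kernel_bound zE/= uN vN !expr0.
  rewrite ler_pdivrMr; first by lra.
  by apply: mulr_gt0; lra.
Qed.

(** S kills some f = sum of y_p F_p. If |y_j| is maximal, then |f| <= |y_j| n^2 B^n, while C f takes
    the value y_j at z_j, so |C f - S f| = |C f| >= |y_j| / 2. The 8 in c absorbs the factor 2
    n^2. *)
Lemma geometric_lower_bound : exists2 c : R, 0 < c & forall n, (0 < n)%N ->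
  c ^+ n <= approximation_number (n ^ 2) C.
Proof.
have [B B1 BP] := interpolating_family.
have B0 : 0 < B by apply: lt_le_trans B1.
exists (8 * B)^-1; first by rewrite invr_gt0 mulr_gt0.
move=> n n0; have [F [z [FN FE zN]]] := BP n n0.
apply: approximation_number_ge => [|S [N SN] rS]; first by rewrite expn_gt0 n0.
have card_n : #|{: 'I_n * 'I_n}| = (n ^ 2)%N by rewrite card_prod card_ord mulnn.
rewrite -card_n in rS.
have [y [i yi] Sy] := finite_rank_kernel F rS.
have [j yj ymax] : exists2 j, 0 < cnorm (y j) & forall i, cnorm (y i) <= cnorm (y j).
  by apply: argmax_exists; exists i; rewrite cnorm_gt0.
set f := \sum_i _ in Sy.
have f_le : hardy_norm f <= cnorm (y j) * ((n ^ 2)%:R * B ^+ n).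
  rewrite -hardy_cnormE; apply: le_trans (ler_cnorm_sum _ _ _) _.
  apply: (@le_trans _ _ (\sum_(p : 'I_n * 'I_n) cnorm (y j) * B ^+ n)).
    apply: ler_sum => p _; rewrite hardy_cnormE hardy_normZ.
    by apply: ler_pM; rewrite ?cnorm_ge0 ?hardy_norm_ge0.
  by rewrite sumr_const card_n -[leLHS]mulr_natl mulrCA.
have D0 : 0 < (n ^ 2)%:R * B ^+ n :> R.
  by rewrite mulr_gt0 ?exprn_gt0// ltr0n expn_gt0 n0.
pose r := (cnorm (y j) * ((n ^ 2)%:R * B ^+ n))^-1.
have r0 : 0 < r by rewrite invr_gt0 mulr_gt0.
pose x := r%:C *: f.
have x1 : cnorm x <= 1.
  rewrite hardy_cnormE hardy_normZ cnormR_ge0 ?(ltW r0)// /r mulrC.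
  by rewrite -[leRHS](divff (lt0r_neq0 (mulr_gt0 yj D0))) ler_wpM2r// ltW.
have Sx : S x = 0 by rewrite /x linearZ/= Sy scaler0.
have Cx : ((n ^ 2)%:R * B ^+ n)^-1 <= 2 * cnorm (C x).
  have fz : f (symbol (z j)) = y j.
    rewrite /f hardy_sum (bigD1 j)// big1 => [|p pj]; last by rewrite hardyZ FE (negbTE pj) mulr0.
    by rewrite hardyZ FE eqxx mulr1 /= addr0.
  have := zN j (C x); rewrite CE /x hardyZ fz cnormM cnormR_ge0 ?(ltW r0)// hardy_cnormE.
  have -> : r * cnorm (y j) = ((n ^ 2)%:R * B ^+ n)^-1.
    by rewrite /r invfM mulrAC mulVf ?mul1r// gt_eqF.
  exact.
have [M CM] := C_bounded.
have bnd g : cnorm ((C \- S) g) <= (M + N) * cnorm g.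
  apply: le_trans (ler_cnormB _ _) _; rewrite mulrDl; exact: lerD (CM g) (SN g).
apply: le_trans (operator_norm_ge bnd x1); rewrite /= Sx subr0.
apply: (@le_trans _ _ (((n ^ 2)%:R * B ^+ n)^-1 / 2)); last first.
  by rewrite ler_pdivrMr// [leRHS]mulrC.
rewrite exprVn -invfM lef_pV2 ?posrE ?mulr_gt0 ?exprn_gt0 ?mulr_gt0//.
  rewrite exprMn [leLHS]mulrAC; apply: ler_wpM2r; first by rewrite exprn_ge0// ltW.
  by rewrite -natrX -natrM ler_nat mulnC double_sqr_le.
by rewrite ltr0n expn_gt0 n0.
Qed.

End lower_bound.

(** * Analyticity, range and sup norm of the symbol *)

Section holomorphy.
Context {R : realType}.
Implicit Types (x h w : R[i]).

(** The remainder is exactly - h^2 t / ((x + t)^2 (x + h + t)). Its bound does not involve t,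
    because t <= |x + t|, and so it can be summed over the knots. *)
Lemma resolvent_increment (t : R) x h : 0 < t -> 0 < Re x -> cnorm h <= Re x / 2 ->
  cnorm ((x + h) / (x + h + t%:C) - x / (x + t%:C) - h * (t%:C / (x + t%:C) ^+ 2))
    <= 2 * cnorm h ^+ 2 / Re x ^+ 2.
Proof.
move=> t0 d0 hd.
have d1 : Re x / 2 <= Re (x + h).
  by rewrite cReD; have := norm_Re_le h; rewrite ler_norml => /andP[]; lra.
have d2 : 0 < Re (x + h) by apply: lt_le_trans d1; rewrite divr_gt0.
have n1 := addR_neq0 d0 t0; have n2 := addR_neq0 d2 t0.
have -> : (x + h) / (x + h + t%:C) - x / (x + t%:C) - h * (t%:C / (x + t%:C) ^+ 2) =
    - (h ^+ 2 * (t%:C / (x + t%:C) * ((x + t%:C)^-1 * (x + h + t%:C)^-1))).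
  by field; rewrite n1 n2.
rewrite cnormN cnormM cnormX [2 * _]mulrC -[leRHS]mulrA; apply: ler_wpM2l; first exact: sqr_ge0.
rewrite !cnormM !cnormV cnormR_ge0 ?(ltW t0)//.
have a1 : t / cnorm (x + t%:C) <= 1.
  by rewrite ler_pdivrMr ?cnorm_addR_gt0// mul1r le_cnorm_addR_r.
have a2 : (cnorm (x + t%:C))^-1 <= (Re x)^-1.
  rewrite lef_pV2 ?posrE ?cnorm_addR_gt0//.
  exact: le_trans (Re_le_cnorm x) (le_cnorm_addR d0 t0).
have a3 : (cnorm (x + h + t%:C))^-1 <= (Re x / 2)^-1.
  rewrite lef_pV2 ?posrE ?cnorm_addR_gt0 ?divr_gt0//.
  apply: le_trans d1 _; exact: le_trans (Re_le_cnorm _) (le_cnorm_addR d2 t0).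
rewrite -[leRHS]mul1r; apply: ler_pM => //.
- by rewrite divr_ge0 ?cnorm_ge0// ltW.
- by rewrite mulr_ge0 ?invr_ge0 ?cnorm_ge0.
rewrite (_ : 2 / Re x ^+ 2 = (Re x)^-1 * (Re x / 2)^-1); last by field; rewrite gt_eqF.
by apply: ler_pM => //; rewrite invr_ge0 cnorm_ge0.
Qed.

(** Differentiation under the sum: the remainders are uniform in the index, and the weights add up
    to less than 1. *)
Lemma cusp_derivative x : 0 < Re x -> exists D : R[i], forall h, cnorm h <= Re x / 2 ->
  cnorm (cusp (x + h) - cusp x - h * D) <= 2 * cnorm h ^+ 2 / Re x ^+ 2.
Proof.
move=> d0.
pose dterm i : R[i] := (knot i)%:C / (x + (knot i)%:C) ^+ 2.
pose dsum n : R[i] := \sum_(i < n) (weight i)%:C * dterm i.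
have dterm_le i : cnorm (dterm i) <= (Re x)^-1.
  rewrite /dterm cnormM cnormV cnormX cnormR_ge0 ?knot_ge0//.
  have k0 := @knot_gt0 R i; have c0 := cnorm_addR_gt0 d0 k0.
  have := le_cnorm_addR_r d0 k0.
  have := le_trans (Re_le_cnorm x) (le_cnorm_addR d0 k0).
  rewrite ler_pdivrMr ?exprn_gt0// mulrC ler_pdivlMr//.
  move: (cnorm _) c0 => c c0 h1 h2; rewrite expr2.
  by apply: ler_pM; rewrite ?knot_ge0 ?(ltW d0).
have close n m : (n <= m)%N -> cnorm (dsum m - dsum n) <= (Re x)^-1 * (2 * weight n).
  move=> nm; rewrite /dsum -!(big_mkord xpredT (fun i => (weight i)%:C * dterm i)).
  rewrite (big_cat_nat (leq0n n) nm)/= addrAC subrr add0r.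
  apply: (le_trans (ler_cnorm_sum _ _ _)).
  apply: (@le_trans _ _ (\sum_(n <= i < m) (Re x)^-1 * weight i)).
    apply: ler_sum => i _; rewrite cnormM cnormR_ge0 ?weight_ge0// mulrC.
    by apply: ler_wpM2r; [exact: weight_ge0|exact: dterm_le].
  rewrite -mulr_sumr sum_weight//; apply: ler_wpM2l; first by rewrite invr_ge0 ltW.
  by rewrite gerBl mulr_ge0 ?weight_ge0.
have rate0 : (fun n => (Re x)^-1 * (2 * weight n)) @ \oo --> (0 : R).
  by have := cvgMl_tmp (a := (Re x)^-1) (@cvg_2weight R); rewrite mulr0; apply.
have [D [Dc _]] := cauchy_rate_cvg rate0 close; exists D => h hd.
have d2 : 0 < Re (x + h).
  by rewrite cReD; have := norm_Re_le h; rewrite ler_norml => /andP[]; lra.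
have uc : (fun n => cusp_sum n (x + h) - cusp_sum n x - h * dsum n : R[i]^o) @ \oo -->
    (cusp (x + h) - cusp x - h * D : R[i]^o).
  have hc := @cvgMl_c R h _ _ Dc; apply: cvgB hc; apply: cvgB; exact: cvg_cusp_sum.
apply: cvg_cnorm_lim_le uc _; exists 0%N => n _.
rewrite /cusp_sum /dsum -sumrB mulr_sumr -sumrB.
apply: le_trans (ler_cnorm_sum _ _ _) _.
set K := leRHS; have K0 : 0 <= K by apply: divr_ge0 (sqr_ge0 _); apply: mulr_ge0 (sqr_ge0 _).
apply: (@le_trans _ _ (\sum_(0 <= i < n) weight i * K)).
  rewrite big_mkord; apply: ler_sum => i _.
  rewrite (mulrCA h) -!mulrBr cnormM cnormR_ge0 ?weight_ge0//.
  by apply: ler_wpM2l; [exact: weight_ge0|exact: resolvent_increment (knot_gt0 i) d0 hd].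
rewrite -mulr_suml sum_weight// ler_piMl//.
have := @weight_ge0 R n; rewrite (@weightE R 0%N) expr0; lra.
Qed.

Lemma phi_differentiable w : cnorm w < 1 ->
  differentiable (phi : R[i]^o -> R[i]^o) (w : R[i]^o).
Proof.
move=> w1; apply/derivable1_diffP.
have d0 := Re_oneB_gt0 w1; have [D DP] := cusp_derivative d0.
apply/cvg_ex; exists (D : R[i]^o); apply/cvgrPdist_lt => e e0.
have /complex_realP[r re] : e \is Num.real by rewrite realE ltW.
move: e0; rewrite re ltcR => r0.
set d := Re (1 - w) in d0 DP.
have K0 : 0 < 2 / d ^+ 2 by rewrite divr_gt0 ?exprn_gt0.
have del0 : 0 < Num.min (d / 2) (r / (2 / d ^+ 2)) by rewrite lt_min (divr_gt0 r0 K0) divr_gt0.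
near=> h.
have h0 : h != 0 :> R[i] by near: h; exact: nbhs_dnbhs_neq.
have : `|h| < (Num.min (d / 2) (r / (2 / d ^+ 2)))%:C.
  by near: h; apply: dnbhs0_lt; rewrite ltcR.
rewrite -cnormE ltcR lt_min => /andP[h1 h2]; rewrite -cnormE ltcR cnormBC.
have := DP (- h); rewrite cnormN => /(_ (ltW h1)).
have c0 : 0 < cnorm h by rewrite cnorm_gt0.
rewrite -(ltr_pM2l c0) -cnormM.
have -> : h * (h^-1 *: ((phi \o shift w) (h *: (1 : R[i]^o)) - phi w) - D) =
   - (cusp (1 - w + - h) - cusp (1 - w) - - h * D).
  rewrite /phi /= /GRing.scale /= mulr1 mulrBr mulrA divff// mul1r.
  by rewrite (_ : 1 - (h + w) = 1 - w + - h); ring.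
rewrite cnormN => /le_lt_trans; apply.
rewrite (_ : 2 * cnorm h ^+ 2 / d ^+ 2 = cnorm h * (cnorm h * (2 / d ^+ 2))); last by ring.
by rewrite ltr_pM2l// -ltr_pdivlMr.
Unshelve. all: by end_near. Qed.

Lemma analytic_symbol : analytic_self_map (@symbol R).
Proof.
(* The extension is the same formula; off the bidisk [cusp] is whatever [lim] returns. *)
exists (fun z => (phi z.1, psi z.1 * z.2)) => // z [z1 z2].
have dfst : differentiable (fst : R[i]^o * R[i]^o -> R[i]^o) z.
  by apply: linear_differentiable; by move=> ?; exact: cvg_fst.
have dsnd : differentiable (snd : R[i]^o * R[i]^o -> R[i]^o) z.
  by apply: linear_differentiable; by move=> ?; exact: cvg_snd.
apply: differentiable_pair.
  by apply: (differentiable_comp dfst); apply: phi_differentiable; rewrite -normr_lt1.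
apply: differentiableM dsnd; apply: differentiableM; first exact: differentiable_cst.
by apply: differentiableB dfst; exact: differentiable_cst.
Qed.

End holomorphy.

Section range_of_the_symbol.
Context {R : realType}.

(* Newton iteration with the fixed slope of [phi_expansion]. *)
Lemma phi_surjective_near : exists2 r : R, 0 < r & forall w : R[i],
  cnorm (w - phi 0) <= r -> exists2 z : R[i], cnorm z <= 10^-1 & phi z = w.
Proof.
(* The first step has length at most (s / 20) / s = 1/20 and each later one at most half the
   previous bound, so the iterates stay within radius 1/10. *)
have [s s0 sP] := @phi_expansion R; exists (s / 20) => [|w wr]; first by rewrite divr_gt0.
have sc0 : s%:C != 0 :> R[i] by rewrite fmorph_eq0 gt_eqF.
pose T (z : R[i]) := z - (phi z - w) / s%:C.
have T_contract z y : cnorm z <= 10^-1 -> cnorm y <= 10^-1 ->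
    cnorm (T z - T y) <= 2^-1 * cnorm (z - y).
  move=> z1 y1; have := sP z y z1 y1.
  rewrite (_ : T z - T y = - (phi z - phi y - s%:C * (z - y)) / s%:C); last by rewrite /T; field.
  by rewrite cnorm_div cnormN cnormR_ge0 ?(ltW s0)// ler_pdivrMr//; lra.
pose u n := iter n T 0; pose e n := 2^-1 ^+ n / 10 : R.
have uP n : cnorm (u n) <= 10^-1 - e n /\ cnorm (u n.+1 - u n) <= e n / 2.
  have e0 m : 0 <= e m by rewrite divr_ge0 ?exprn_ge0 ?invr_ge0.
  have eS m : e m.+1 = e m / 2 by rewrite /e exprS; field.
  elim: n => [|n [un dn]].
    split; first by rewrite /= cnorm0 /e expr0 mul1r subrr.
    rewrite /= subr0 /T sub0r cnormN cnorm_div cnormR_ge0 ?(ltW s0)// cnormBC.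
    by rewrite /e expr0 ler_pdivrMr//; apply: le_trans wr _; lra.
  have un1 : cnorm (u n.+1) <= 10^-1 - e n.+1.
    have := ler_cnormD (u n.+1 - u n) (u n); rewrite subrK eS; lra.
  split=> //; apply: le_trans (T_contract _ _ _ _) _.
  - by apply: le_trans un1 _; rewrite gerBl.
  - by apply: le_trans un _; rewrite gerBl.
  by rewrite eS mulrC ler_wpM2r// invr_ge0.
have e_cvg0 : (fun n => e n) @ \oo --> (0 : R).
  have h := @cvg_exprR R 2^-1; have := cvgMr_tmp (b := 10^-1 : R) (h _ _).
  by rewrite mul0r; apply; lra.
have close n m : (n <= m)%N -> cnorm (u m - u n) <= e n.
  move=> nm; suff : cnorm (u m - u n) <= e n - e m.
    by move/le_trans; apply; rewrite gerBl divr_ge0 ?exprn_ge0 ?invr_ge0.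
  rewrite -(subnKC nm); elim: (m - n)%N => [|d IH].
    by rewrite addn0 !subrr cnorm0.
  rewrite addnS; have [_ h] := uP (n + d)%N.
  have := ler_cnormD (u (n + d).+1 - u (n + d)%N) (u (n + d)%N - u n).
  rewrite addrA subrK; have -> : e (n + d).+1 = e (n + d)%N / 2 by rewrite /e exprS; field.
  lra.
have [l [ul lu]] := cauchy_rate_cvg e_cvg0 close.
have un10 n : cnorm (u n) <= 10^-1.
  by have [h _] := uP n; apply: le_trans h _; rewrite gerBl divr_ge0 ?exprn_ge0 ?invr_ge0.
have l10 : cnorm l <= 10^-1 by apply: cvg_cnorm_lim_le ul _; exists 0%N => n _.
exists l => //; have Tl : T l = l.
  apply: (@cvg_unique_c R (fun=> T l)); first exact: cvg_cst.
  apply: cvg_cnorm_le e_cvg0 _ => n.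
  have := ler_cnormD (T l - T (u n)) (u n.+1 - l); rewrite addrA subrK.
  move/le_trans; apply; have := T_contract _ _ l10 (un10 n).
  have := lu n; have := lu n.+1; rewrite [cnorm (u n.+1 - l)]cnormBC.
  have -> : e n.+1 = e n / 2 by rewrite /e exprS; field.
  lra.
have /eqP : (phi l - w) / s%:C = 0.
  by rewrite -[LHS](subKr l) -/(T l) Tl subrr.
by rewrite mulf_eq0 invr_eq0 (negbTE sc0) orbF subr_eq0 => /eqP.
Qed.

Lemma symbol_truly_2dimensional : truly_2dimensional (@symbol R).
Proof.
have [r r0 rP] := phi_surjective_near.
exists ((phi 0, 0) : R[i]^o * R[i]^o); apply/nbhs_ballP.
have d0 : 0 < Num.min r 10^-1 by rewrite lt_min r0 /= invr_gt0 ltr0n.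
exists (Num.min r 10^-1)%:C => /=; first by rewrite ltcR.
move=> [w1 w2] [/=]; rewrite -!ball_normE /= -!cnormE !ltcR sub0r cnormN cnormBC !lt_min.
move=> /andP[h1 _] /andP[_ h2].
have [z z10 zw] := rP _ (ltW h1).
(* 9/80 exceeds the bound 1/10 on |w2|, so that w2 / psi z lies in the disk. *)
have psi_lo : 9 / 80 <= cnorm (psi z).
  have := ler_cnormD (1 - z) z; rewrite subrK cnorm1 cnorm_psi; lra.
have psi0 : psi z != 0 by rewrite -cnorm_gt0; lra.
have [y yE] : exists y : bidisk R, val y = ((z, w2 / psi z) : R[i] * R[i]).
  apply: bidisk_exists => /=; first by lra.
  by rewrite cnorm_div ltr_pdivrMr ?cnorm_gt0//; lra.
by exists y => //; rewrite -[LHS]/(val (symbol y)) val_symbol yE /= zw mulrC divfK.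
Qed.

(** At z1 = 1 - knot n the value is phi = 1 - v(knot n), and |v(knot n)| <= 3 weight n tends to
    0. *)
Lemma sup_norm_symbol : sup_norm (@symbol R) = 1.
Proof.
have [b bE] : exists b : bidisk R, val b = ((0, 0) : R[i] * R[i]).
  by apply: bidisk_exists; rewrite /= cnorm0.
have le1 z : Num.max (cnorm (val (@symbol R z)).1) (cnorm (val (symbol z)).2) <= 1.
  by rewrite ge_max !ltW ?bidisk1 ?bidisk2.
apply/eqP; rewrite eq_le; apply/andP; split.
  apply: ge_sup => [|_ [z _ <-]]; last exact: le1.
  by exists (Num.max (cnorm (val (symbol b)).1) (cnorm (val (symbol b)).2)); exists b.
apply/ler_addgt0Pr => e e0.
have [n nP] := (cvgR_epsP _ _).1 (@weight_cvg0 R) _ (divr_gt0 e0 (ltr0n _ 3)).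
have := nP n (leqnn n); rewrite subr0 ger0_norm ?weight_ge0// ltr_pdivlMr// => we.
have k1 : knot n <= 1 :> R by apply: le_trans (knot_le n) _; lra.
have kE : 1 - (knot n)%:C = (1 - knot n)%:C :> R[i] by rewrite rmorphB rmorph1.
have [z zE] : exists z : bidisk R, val z = ((1 - (knot n)%:C, 0) : R[i] * R[i]).
  apply: bidisk_exists; rewrite /= ?cnorm0// kE cnormR_ge0 ?subr_ge0// gtrBl.
  exact: knot_gt0.
rewrite -lerBlDr; apply: (@le_trans _ _ (cnorm (val (symbol z)).1)); last first.
  apply: (@le_trans _ _ (Num.max (cnorm (val (symbol z)).1) (cnorm (val (symbol z)).2))).
    by rewrite le_max lexx.
  apply: sup_upper_bound; last by exists z.
  by split; [exists (Num.max (cnorm (val (symbol z)).1) (cnorm (val (symbol z)).2)); exists z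
            |exists 1 => _ [y _ <-]].
rewrite val_symbol zE /= /phi subKr.
have := @cnorm_cusp_scale R (knot n)%:C (knot_gt0 n) n.
rewrite cnormR_ge0 ?knot_ge0// => /(_ (or_intror (lexx _))).
have := ler_cnormD (1 - cusp (knot n)%:C) (cusp ((knot n)%:C : R[i])); rewrite subrK cnorm1.
lra.
Qed.

End range_of_the_symbol.

Theorem theorem5p12 (R : realType) :
  exists Phi : bidisk R -> bidisk R,
    analytic_self_map Phi /\
    exists C_Phi : {linear hardy R -> hardy R},
      [/\ is_composition_operator Phi C_Phi,
          bounded_operator C_Phi & compact_operator C_Phi] /\
      [/\ sup_norm Phi = 1, truly_2dimensional Phi
        & (0 < beta2_minus C_Phi)%E] /\
      (exists alpha beta : R, [/\ 0 < alpha, 0 < beta &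
         forall n : nat, (1 <= n)%N ->
           approximation_number n C_Phi
             <= alpha * expR (- beta * Num.sqrt n%:R)]) /\
      (beta2_plus C_Phi < 1)%E.
Proof.
exists (@symbol R); split; first exact: analytic_symbol.
have [H [_ H_majorant]] := @majorant_exists R.
have [C CE] := composition_operator_exists H_majorant; exists C.
have C_le f : hardy_norm (C f) <= 1024 * hardy_norm H * hardy_norm f.
  exact: composition_norm_le.
have C_bounded : bounded_operator C by exists (1024 * hardy_norm H) => f; exact: C_le.
have [a [b [a0 b0 ab]]] := exponential_upper_bound H_majorant CE.
have [c c0 cP] := geometric_lower_bound CE C_bounded.
split; first split => //.
- by move=> f; apply/funext => z; exact: CE.
- apply: (compact_of_tail_bound (K := 2048 * 16 * hardy_norm H) C_le) => f N N0 f0.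
  have := composition_norm_tail H_majorant CE N0 f0; move/le_trans; apply.
  by rewrite le_eqVlt; apply/orP; left; apply/eqP; ring.
split; first split.
- exact: sup_norm_symbol.
- exact: symbol_truly_2dimensional.
- exact: beta2_minus_gt0 c0 cP.
by split; [exists a, b|exact: beta2_plus_lt1 a0 b0 ab].
Qed.
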